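(* Let $a>0$ and let $q\in L_{1,1}$ satisfy $q(x)=0$ for $x\ge a$. Then any one of the following data, known for all $k>0$, determines $q$ uniquely: the $S$-matrix $S(k)$; the phase shift $\delta(k)$; the Jost function $f(k)$; the function $f'(0,k)$. That is, if two such potentials have the same $S(k)$ for all $k>0$ (respectively the same $\delta(k)$, the same $f(k)$, or the same $f'(0,k)$), then they coincide.
   Context: $L_{1,1}$ is the set of real-valued functions $q$ on $[0,\infty)$ with $\int_0^\infty(1+x)|q(x)|\,dx<\infty$ and $q\in L^2(0,c)$ for every $c<\infty$. For $q\in L_{1,1}$ and $\operatorname{Im}k\ge0$, the Jost solution $f(x,k)$ is the unique solution of $-f''+q(x)f=k^2f$, $x>0$, with $f(x,k)=e^{ikx}+o(1)$ as $x\to+\infty$. The Jost function is $f(k):=f(0,k)$; $f'(0,k)$ is the $x$-derivative of $f(x,k)$ at $x=0$; $S(k):=\frac{f(-k)}{f(k)}$ for real $k$; the phase shift is defined by $f(k)=|f(k)|e^{-i\delta(k)}$, $\delta(\infty)=0$, so that $S(k)=e^{2i\delta(k)}$. *)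

(* Defs.v *)
From HB Require Import structures.
From mathcomp Require Export all_boot all_order all_algebra.
From mathcomp Require Export complex.
From mathcomp Require Export all_classical all_reals all_analysis.
Export Order.TTheory GRing.Theory Num.Theory numFieldNormedType.Exports.

Set Implicit Arguments.
Unset Strict Implicit.
Unset Printing Implicit Defensive.

Local Open Scope classical_set_scope.
Local Open Scope ring_scope.
Local Open Scope complex_scope.

Section JostData.
Variable R : realType.
Implicit Types (q y : R -> R) (k : R).

Notation mu := (@lebesgue_measure R).

(* Only the values of q on [0, +oo[ matter; potentials are real functions on R
   whose values on the negative half-line are ignored throughout. *)
Definition L11 q : Prop :=
  [/\ measurable_fun (`[0, +oo[ : set R) q,
      (\int[mu]_(x in `[0%R, +oo[) ((1 + x) * `|q x|)%:E < +oo)%E &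
      forall c : R, (\int[mu]_(x in `]0%R, c[) ((q x) ^+ 2)%:E < +oo)%E].

(* -y'' + q y = k^2 y on the half-line, for merely locally integrable q: y is
   continuous up to 0, differentiable on ]0, +oo[, and y' is locally absolutely
   continuous (an indefinite integral of a locally integrable function y2,
   which is its derivative almost everywhere); the equation holds a.e. *)
Definition schrodinger_sol q k y : Prop :=
  [/\ y x @[x --> 0^'+] --> y 0,
      forall x, 0 < x -> derivable y x 1 &
      exists y2 : R -> R,
        [/\ forall c : R, mu.-integrable `[0, c] (EFin \o y2),
            forall s t : R, 0 < s -> s <= t ->
              derive1 y t - derive1 y s = \int[mu]_(x in `[s, t]) y2 x &
            {ae mu, forall x : R, 0 < x -> - y2 x + q x * y x = k ^+ 2 * y x}]].

Definition expi (t : R) : R[i] := cos t +i* sin t.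

(* For real k the equation has real coefficients, so a complex-valued f solves
   it iff its real and imaginary parts do. *)
Definition is_jost_solution q k (f : R -> R[i]) : Prop :=
  [/\ schrodinger_sol q k (fun x => complex.Re (f x)),
      schrodinger_sol q k (fun x => complex.Im (f x)),
      complex.Re (f x - expi (k * x)) @[x --> +oo] --> 0 &
      complex.Im (f x - expi (k * x)) @[x --> +oo] --> 0].

(* The Jost solution at real k, which is unique on [0, +oo[; its values at
   x < 0 are arbitrary and never used.  The Jost data considered here only
   involve real k. *)
Definition jost_solution q k : R -> R[i] :=
  xget (fun=> 0) [set f | is_jost_solution q k f].

Definition jost_function q k : R[i] := jost_solution q k 0.

Definition right_derivative (y : R -> R) (x : R) : R :=
  lim (h^-1 * (y (x + h) - y x) @[h --> 0^'+]).

(* f'(0, k): x = 0 is the endpoint of the half-line, so the derivative there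
   is one-sided. *)
Definition jost_derivative0 q k : R[i] :=
  right_derivative (fun x => complex.Re (jost_solution q k x)) 0 +i*
  right_derivative (fun x => complex.Im (jost_solution q k x)) 0.

Definition S_matrix q k : R[i] := jost_function q (- k) / jost_function q k.

(* f(k) = |f(k)| e^{-i delta(k)} fixes delta only modulo 2 pi at each k; the
   normalization delta(+oo) = 0 removes the ambiguity because delta is
   continuous on ]0, +oo[ (where f has no zeros). *)
Definition is_phase_shift q (delta : R -> R) : Prop :=
  [/\ forall k, 0 < k -> {for k, continuous delta},
      forall k, 0 < k ->
        jost_function q k = `|jost_function q k| * expi (- delta k) &
      delta k @[k --> +oo] --> 0].

End JostData.

(* Main.v *)
(* The Jost solution is f(x, k) = e^{ika} (phi(x, z) + i k psi(x, z)), z = k^2,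
   where phi, psi are the solutions with data (1, 0), (0, 1) at x = a; their
   values and derivatives at a fixed x are entire in z and have Wronskian 1.
   If two potentials have the same S(k), then phi1 psi2 = psi1 phi2 at x = 0,
   first for z > 0, hence for all z, and the Wronskian identity turns this into
   f2 = h f1 with h = phi2 psi1' - phi1' psi2 entire in z.  Since
   f(x, k) e^{-ikx} -> 1 as |k| -> oo in the closed upper half-plane, h -> 1, so
   h = 1 by Liouville.  The same device shows that f1 = f2 at x = 0 forces
   f1' = f2' at x = 0 and conversely, so that all the data determine the
   transfer matrix between 0 and a.  Finally (Marchenko), if the transfer
   matrices agree, then phi1 psi2 - psi1 phi2 at any x is entire in z and can be
   written with the Jost solutions f and the solutions e ~ e^{-ikx} normalised
   at 0 as (f1 e2 - f2 e1) / O(k) = O(1/k), so it vanishes; by the first step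
   phi1 = phi2 and psi1 = psi2 at every x, and therefore q1 = q2. *)
Require Import Defs.
From mathcomp Require Import measurable_realfun cyclic separable cyclotomic.
From mathcomp Require Import zify ring lra.

Set Implicit Arguments.
Unset Strict Implicit.
Unset Printing Implicit Defensive.

Local Open Scope classical_set_scope.
Local Open Scope ring_scope.

(** * Absolutely continuous functions *)

(** Since q is only integrable, solutions have a second derivative only almost everywhere; every
    differential statement is therefore phrased as an identity between a function and an indefinite
    integral, and products are differentiated in that form. Complex analysis is reduced to
    polynomials. Picard iteration presents phi and psi as uniform limits, on discs in z, of
    polynomials in z; averaging a polynomial over roots of unity gives Cauchy's coefficient
    estimate, and from it follow Liouville's theorem and the identity theorem on the positive
    half-axis. Multipliers such as h are written as Wronskians and never as quotients, so zeros of
    denominators play no part. The two converse steps are not symmetric. If f' agrees, the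
    multiplier is O(1/k), because f' grows like k. If f agrees, the multiplier is only bounded,
    because f' - ikf is O(1); it is constant by Liouville, and it vanishes because f' - ikf, divided
    by e^{ikx}, tends to 0 at x = 0 along the imaginary axis. This last fact comes from cutting off
    a short interval near 0 that carries little of the mass of q. *)

Section Primitive.
Variable R : realType.
Implicit Types (f g h : R -> R) (a b c s t x : R).

Notation mu := (@lebesgue_measure R).

(* f is absolutely continuous on [a, b] with (almost everywhere) derivative g. *)
Definition prim a b f g : Prop :=
  mu.-integrable `[a, b] (EFin \o g) /\
  forall s t, a <= s -> s <= t -> t <= b ->
    f t - f s = \int[mu]_(x in `[s, t]) g x.

Lemma sub_itvcc a b s t : a <= s -> t <= b -> `[s, t] `<=` `[a, b].
Proof.
move=> as_ tb x /=; rewrite !in_itv/= => /andP[sx xt].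
by rewrite (le_trans as_ sx) (le_trans xt tb).
Qed.

Lemma integrable_sub_itv a b s t g : a <= s -> t <= b ->
  mu.-integrable `[a, b] (EFin \o g) -> mu.-integrable `[s, t] (EFin \o g).
Proof.
move=> as_ tb; apply: integrableS; [exact: measurable_itv..|].
exact: sub_itvcc.
Qed.

Lemma integrable_itvD a b f g : mu.-integrable `[a, b] (EFin \o f) ->
  mu.-integrable `[a, b] (EFin \o g) ->
  mu.-integrable `[a, b] (EFin \o (fun x => f x + g x)).
Proof.
move=> i1 i2.
apply: (@eq_integrable _ _ _ mu _ (measurable_itv _)
  ((EFin \o f) \+ (EFin \o g))%E).
  by move=> x _ /=; rewrite EFinD.
by apply: integrableD.
Qed.

Lemma integrable_itvZ a b c f : mu.-integrable `[a, b] (EFin \o f) ->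
  mu.-integrable `[a, b] (EFin \o (fun x => c * f x)).
Proof.
move=> i1.
apply: (@eq_integrable _ _ _ mu _ (measurable_itv _)
  (fun x => c%:E * (EFin \o f) x)%E).
  by move=> x _ /=; rewrite EFinM.
by apply: integrableZl.
Qed.

Lemma Rintegral_split s t x g : s <= x -> x <= t ->
  mu.-integrable `[s, t] (EFin \o g) ->
  \int[mu]_(y in `[s, t]) g y =
  \int[mu]_(y in `[s, x]) g y + \int[mu]_(y in `[x, t]) g y.
Proof.
move=> sx xt ig.
rewrite -[X in _ + X]Rintegral_itv_obnd_cbnd; last first.
  apply: integrableS ig => //; exact: measurable_itv || idtac.
  by move=> y /=; rewrite !in_itv/= => /andP[xy ->]; rewrite (le_trans sx (ltW xy)).
by rewrite -(@Rintegral_itvB _ _ (BLeft s) (BRight t))// ?bnd_simp// addrC subrK.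
Qed.

Lemma primS a b s t f g : a <= s -> t <= b -> prim a b f g -> prim s t f g.
Proof.
move=> as_ tb [ig fg]; split; first exact: integrable_sub_itv ig.
by move=> u v su uv vt; apply: fg => //; [exact: le_trans su|exact: le_trans tb].
Qed.

Lemma prim_integral a b g : mu.-integrable `[a, b] (EFin \o g) ->
  prim a b (fun x => \int[mu]_(t in `[a, x]) g t) g.
Proof.
move=> ig; split => // s t as_ st tb.
rewrite (@Rintegral_split a t s)//; first by rewrite addrAC subrr add0r.
exact: integrable_sub_itv ig.
Qed.

Lemma prim_bwd_integral a b g : mu.-integrable `[a, b] (EFin \o g) ->
  prim a b (fun x => - \int[mu]_(t in `[x, b]) g t) g.
Proof.
move=> ig; split => // s t as_ st tb.
rewrite (@Rintegral_split s b t)//; first by rewrite opprK addrC addrK.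
exact: integrable_sub_itv ig.
Qed.

Lemma eq_prim a b f f' g g' :
  (forall x, a <= x <= b -> f x = f' x) ->
  (forall x, a <= x <= b -> g x = g' x) ->
  prim a b f g -> prim a b f' g'.
Proof.
move=> ff gg [ig fg]; split.
  apply: (@eq_integrable _ _ _ mu _ (measurable_itv _) (EFin \o g)) ig.
  by move=> x; rewrite inE/= in_itv/= => /gg ->.
move=> s t as_ st tb; rewrite -!ff ?fg ?as_ ?tb ?(le_trans as_ st)//; last first.
  exact: le_trans tb.
apply: eq_Rintegral => x; rewrite inE/= in_itv/= => /andP[sx xt].
by rewrite gg// (le_trans as_ sx) (le_trans xt tb).
Qed.

Lemma prim_cst a b c : prim a b (cst c) (cst 0).
Proof.
split; first exact: (integrable0 mu).
by move=> s t *; rewrite subrr Rintegral_cst ?mul0r.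
Qed.

Lemma primD a b f f' g g' : prim a b f g -> prim a b f' g' ->
  prim a b (fun x => f x + f' x) (fun x => g x + g' x).
Proof.
move=> [ig fg] [ig' fg']; split.
  exact: integrable_itvD.
move=> s t as_ st tb; have is_ := integrable_sub_itv as_ tb ig.
have is' := integrable_sub_itv as_ tb ig'.
rewrite RintegralD//.
by rewrite -fg// -fg'//; ring.
Qed.

Lemma primZ a b c f g : prim a b f g ->
  prim a b (fun x => c * f x) (fun x => c * g x).
Proof.
move=> [ig fg]; split; first exact: integrable_itvZ.
move=> s t as_ st tb; have is_ := integrable_sub_itv as_ tb ig; rewrite RintegralZl//.
by rewrite -fg//; ring.
Qed.

Lemma primN a b f g : prim a b f g -> prim a b (fun x => - f x) (fun x => - g x).
Proof.
by move=> /(primZ (-1)); apply: eq_prim => x _; rewrite mulN1r.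
Qed.

Lemma primB a b f f' g g' : prim a b f g -> prim a b f' g' ->
  prim a b (fun x => f x - f' x) (fun x => g x - g' x).
Proof. by move=> p /primN; exact: primD. Qed.

Lemma prim_continuous a b f g : a <= b -> prim a b f g ->
  {within `[a, b], continuous f}.
Proof.
move=> ab [ig fg].
have cI := parameterized_integral_continuous ab ig.
apply: (@subspace_eq_continuous _ _ _
  (fun x => f a + parameterized_integral mu a x g)).
  move=> x; rewrite inE/= in_itv/= => /andP[ax xb].
  by rewrite /parameterized_integral -fg// addrC subrK.
move=> x; apply: cvgD; [exact: cvg_cst|exact: cI].
Qed.

Lemma prim_measurable a b f g : a <= b -> prim a b f g ->
  measurable_fun `[a, b] f.
Proof.
move=> ab /(prim_continuous ab) cf.
by apply: measurable_realfun.subspace_continuous_measurable_fun.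
Qed.

Lemma within_continuous_bounded a b f : a <= b ->
  {within `[a, b], continuous f} ->
  exists2 M, 0 <= M & forall x, a <= x <= b -> `|f x| <= M.
Proof.
move=> ab cf.
have [c _ hc] := EVT_max ab cf; have [d _ hd] := EVT_min ab cf.
exists (`|f c| + `|f d|) => [|x xab]; first by rewrite addr_ge0.
have h1 : f x <= f c by apply: hc; rewrite in_itv.
have h2 : f d <= f x by apply: hd; rewrite in_itv.
have := ler_norm (f c); have := ler_norm (- f d); rewrite normrN => h3 h4.
have := normr_ge0 (f c); have := normr_ge0 (f d) => h5 h6.
by rewrite ler_norml; apply/andP; split; lra.
Qed.

Lemma prim_bounded a b f g : a <= b -> prim a b f g ->
  exists2 M, 0 <= M & forall x, a <= x <= b -> `|f x| <= M.
Proof. by move=> ab /(prim_continuous ab); exact: within_continuous_bounded. Qed.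

Lemma integrable_mul_bounded a b (M : R) f g : measurable_fun `[a, b] f ->
  (forall x, a <= x <= b -> `|f x| <= M) ->
  mu.-integrable `[a, b] (EFin \o g) ->
  mu.-integrable `[a, b] (EFin \o (fun x => f x * g x)).
Proof.
move=> mf fM ig.
apply: (@eq_integrable _ _ _ mu _ (measurable_itv _)
  ((EFin \o f) \* (EFin \o g))%E).
  by move=> x _ /=; rewrite EFinM.
apply: integrableMr => //.
exists M; split; first exact: num_real.
move=> y My x /=; rewrite in_itv/= => /fM /le_trans; apply; exact: ltW.
Qed.

Lemma integrable_prim_mul a b f f' g : a <= b -> prim a b f f' ->
  mu.-integrable `[a, b] (EFin \o g) ->
  mu.-integrable `[a, b] (EFin \o (fun x => f x * g x)).
Proof.
move=> ab pf; have [M _ hM] := prim_bounded ab pf.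
by apply: integrable_mul_bounded hM; exact: prim_measurable pf.
Qed.

Lemma prim_le a b f g h s t : prim a b f g ->
  mu.-integrable `[a, b] (EFin \o h) ->
  (forall x, s <= x <= t -> `|g x| <= h x) ->
  a <= s -> s <= t -> t <= b ->
  `|f t - f s| <= \int[mu]_(x in `[s, t]) h x.
Proof.
move=> [ig fg] ih gh as_ st tb; rewrite fg//.
have igs := integrable_sub_itv as_ tb ig.
apply: le_trans (le_normr_Rintegral _ igs) _ => //.
apply: le_Rintegral => //.
- exact: integrable_norm.
- exact: (integrable_sub_itv as_ tb ih).
Qed.

Lemma eq0_le_inv (x D : R) : (forall n, `|x| <= D / 2 ^+ n) -> x = 0.
Proof.
move=> h; apply/eqP; rewrite -normr_eq0; apply/eqP/le_anti/andP; split => //.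
have D0 : 0 <= D by have := h 0; rewrite expr0 divr1; exact: le_trans.
rewrite leNgt; apply/negP => x0.
pose n := (Num.truncn (D / `|x|)).+1; have hn := h n.
have : D / `|x| < 2 ^+ n.
  apply: lt_trans (truncnS_gt _) _; rewrite -natrX ltr_nat.
  exact: ltn_expl.
rewrite ltr_pdivrMr// mulrC => D2.
by move: hn; rewrite ler_pdivlMr ?exprn_gt0// leNgt D2.
Qed.

(** Bisection: the intermediate value theorem gives a point where [N] takes the mean of its end
    values. On each side the increment of [N] is halved and its square quartered, so the two sides
    together cost half of the previous bound. *)
Lemma quadratic_variation_eq a b (C : R) (f N : R -> R) : a <= b ->
  {within `[a, b], continuous N} ->
  (forall s t, a <= s -> s <= t -> t <= b -> N s <= N t) ->
  (forall s t, a <= s -> s <= t -> t <= b ->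
    `|f t - f s| <= C * (N t - N s) ^+ 2) ->
  f b = f a.
Proof.
move=> ab cN mN fN.
suff H n : forall s t, a <= s -> s <= t -> t <= b ->
    `|f t - f s| <= C * (N t - N s) ^+ 2 / 2 ^+ n.
  apply/eqP; rewrite -subr_eq0; apply/eqP.
  by apply: (@eq0_le_inv _ (C * (N b - N a) ^+ 2)) => n; exact: H.
elim: n => [|n IH] s t as_ st tb; first by rewrite expr0 divr1; exact: fN.
have cNst : {within `[s, t], continuous N}.
  by apply: continuous_subspaceW cN; exact: sub_itvcc.
have Nst := mN _ _ as_ st tb.
have [|m] := @IVT _ N s t ((N s + N t) / 2) st cNst.
  by rewrite min_l// max_r//; lra.
rewrite in_itv/= => /andP[sm mt] Nm.
have h1 := IH _ _ as_ sm (le_trans mt tb).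
have h2 := IH _ _ (le_trans as_ sm) mt tb.
have -> : f t - f s = (f t - f m) + (f m - f s) by ring.
apply: le_trans (ler_normD _ _) _; apply: le_trans (lerD h2 h1) _.
rewrite Nm le_eqVlt (exprS 2 n); apply/orP; left; apply/eqP.
by field; rewrite expf_neq0.
Qed.

(* The defect of the product rule is additive in the interval and quadratically
   small in the variation of the two factors, hence zero. *)
Lemma primM a b f f' g g' : a <= b -> prim a b f g -> prim a b f' g' ->
  prim a b (fun x => f x * f' x) (fun x => f x * g' x + f' x * g x).
Proof.
move=> ab pf pf'; have [ig fg] := pf; have [ig' fg'] := pf'.
have i1 := integrable_prim_mul ab pf ig'.
have i2 := integrable_prim_mul ab pf' ig.
pose h x := `|g x| + `|g' x|.
have iN : mu.-integrable `[a, b] (EFin \o (fun x => `|g x|)).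
  exact: integrable_norm ig.
have iN' : mu.-integrable `[a, b] (EFin \o (fun x => `|g' x|)).
  exact: integrable_norm ig'.
have ih : mu.-integrable `[a, b] (EFin \o h).
  exact: integrable_itvD.
have pN := prim_integral ih.
set N := (fun x => _) in pN.
have i12 : mu.-integrable `[a, b]
    (EFin \o (fun x => f x * g' x + f' x * g x)).
  exact: integrable_itvD.
split => // s t as_ st tb.
have pD := prim_integral i12; set D := (fun x => _) in pD.
have Nle u v : a <= u -> u <= v -> v <= b -> N u <= N v.
  move=> au uv vb; rewrite -subr_ge0 (pN.2 _ _ au uv vb).
  by apply: Rintegral_ge0 => x _; rewrite addr_ge0.
have -> : \int[mu]_(x in `[s, t]) (f x * g' x + f' x * g x) = D t - D s.
  by rewrite pD.2.
suff : f t * f' t - D t = f s * f' s - D s by lra.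
apply: (@quadratic_variation_eq s t 2 (fun x => f x * f' x - D x) N) => //.
- by apply: prim_continuous st _; exact: primS pN.
- by move=> u v su uv vt; apply: Nle => //;
    [exact: le_trans su|exact: le_trans tb].
move=> u v su uv vt.
have au := le_trans as_ su; have vb := le_trans vt tb.
have Nuv := Nle _ _ au uv vb.
have Df x : u <= x <= v -> `|f x - f u| <= N v - N u.
  move=> /andP[ux xv]; apply: (@le_trans _ _ (N x - N u)).
    rewrite (pN.2 _ _ au ux (le_trans xv vb)).
    apply: (prim_le pf) => //; last exact: le_trans vb.
    by move=> y _; rewrite lerDl.
  by rewrite lerB// Nle// (le_trans au ux).
have Df' x : u <= x <= v -> `|f' v - f' x| <= N v - N u.
  move=> /andP[ux xv]; apply: (@le_trans _ _ (N v - N x)).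
    rewrite (pN.2 _ _ (le_trans au ux) xv vb).
    apply: (prim_le pf') => //; last exact: le_trans ux.
    by move=> y _; rewrite lerDr.
  by rewrite lerB// Nle// (le_trans xv vb).
(* Freezing [f'] at [v] and [f] at [u] keeps the increment of the product, while the integrand
   becomes (f' v - f' x) g x - (f x - f u) g' x, where both brackets are at most the increment of
   [N]. *)
have -> : f v * f' v - D v - (f u * f' u - D u) =
    (fun x => f' v * f x + f u * f' x - D x) v -
    (fun x => f' v * f x + f u * f' x - D x) u by rewrite /=; ring.
have pE := primB (primD (primZ (f' v) pf) (primZ (f u) pf')) pD.
apply: le_trans (@prim_le a b _ _ (fun x => (N v - N u) * h x) u v pE _ _ _ _ _) _ => //.
- exact: integrable_itvZ.
- move=> x xuv.
  have -> : f' v * g x + f u * g' x - (f x * g' x + f' x * g x) =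
    (f' v - f' x) * g x + - (f x - f u) * g' x by ring.
  apply: le_trans (ler_normD _ _) _; rewrite !normrM normrN mulrDr.
  by apply: lerD; apply: ler_wpM2r => //; [exact: Df'|exact: Df].
have iuv := integrable_sub_itv au vb ih; rewrite RintegralZl//.
rewrite -(pN.2 _ _ au uv vb) -expr2 ler_peMl ?sqr_ge0//; lra.
Qed.

End Primitive.

(** * Limits, gluing and uniqueness of indefinite integrals *)

Section PrimitiveLimits.
Variable R : realType.
Implicit Types (f g h : R -> R) (a b c s t x : R).

Notation mu := (@lebesgue_measure R).

Lemma continuous_integrable_itv a b g : continuous g ->
  mu.-integrable `[a, b] (EFin \o g).
Proof.
move=> cg; apply: continuous_compact_integrable.
  exact: segment_compact.
exact: continuous_subspaceT.
Qed.

Lemma prim_is_derive a b f g : continuous g ->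
  (forall x, is_derive x 1 f (g x)) -> prim a b f g.
Proof.
move=> cg df; split; first exact: continuous_integrable_itv.
move=> s t _ + _; rewrite le_eqVlt => /predU1P[<-|st].
  by rewrite subrr set_itv1 Rintegral_set1.
rewrite /Rintegral (@continuous_FTC2 _ g f)//.
- exact: continuous_subspaceT.
- have cf : continuous f.
    by move=> x; apply: differentiable_continuous; apply/derivable1_diffP.
  split => [x _||].
  + exact: ex_derive.
  + exact: cvg_at_right_filter (cf s).
  + exact: cvg_at_left_filter (cf t).
- by move=> x _; rewrite derive1E; exact: derive_val.
Qed.

(** Convergence of the derivatives is uniform only relative to an integrable weight [h]: for the
    Picard series they contain the factor q - z, which may be unbounded. The bound at index 0 makes
    [g] integrable, and the general one lets the integrals converge. *)
Lemma prim_lim a b (f_ g_ : nat -> R -> R) (e : nat -> R) f g h :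
  (forall n, prim a b (f_ n) (g_ n)) ->
  (forall x, a <= x <= b -> f_ n x @[n --> \oo] --> f x) ->
  mu.-integrable `[a, b] (EFin \o h) ->
  (forall n x, a <= x <= b -> `|g_ n x - g x| <= e n * h x) ->
  e n @[n --> \oo] --> (0 : R) ->
  prim a b f g.
Proof.
move=> pn fn ih gn e0.
have mg : measurable_fun `[a, b] g.
  apply: (@measurable_fun_cvg _ _ _ _ (fun n x => g_ n x)).
    by move=> n; have [/measurable_int/measurable_EFinP] := pn n.
  move=> x /=; rewrite in_itv/= => xab.
  apply/cvgrPdist_le => eps eps0.
  have eh0 : e n * h x @[n --> \oo] --> 0.
    by rewrite -(mul0r (h x)); apply: cvgM => //; exact: cvg_cst.
  move/cvgrPdist_le : eh0 => /(_ _ eps0); apply: filterS => n.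
  rewrite sub0r normrN => h1; rewrite distrC; apply: le_trans (gn _ _ xab) _.
  exact: le_trans (ler_norm _) h1.
have ig : mu.-integrable `[a, b] (EFin \o g).
  have i1 : mu.-integrable `[a, b] (EFin \o (fun x => `|g_ 0 x|)).
    by apply: integrable_norm; exact: (pn 0).1.
  have i2 := integrable_itvD i1 (integrable_itvZ (e 0) ih).
  apply: (@le_integrable _ _ _ mu _ _ _
    (EFin \o (fun x => `|g_ 0 x| + e 0 * h x))) i2 => //.
    exact/measurable_EFinP.
  move=> x /=; rewrite in_itv/= => xab; rewrite lee_fin.
  have h1 := gn 0 _ xab.
  apply: le_trans (ler_norm _).
  have -> : g x = g_ 0 x - (g_ 0 x - g x) by ring.
  by apply: le_trans (ler_normB _ _) _; rewrite lerD2l.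
split => // s t as_ st tb.
have igs := integrable_sub_itv as_ tb ig.
have ihs := integrable_sub_itv as_ tb ih.
apply: (@cvg_unique _ (@Rhausdorff R) ((fun n => f_ n t - f_ n s) @ \oo)).
  by apply: cvgB; apply: fn; apply/andP; split => //;
    [exact: le_trans st|exact: le_trans tb].
apply/cvgrPdist_le => eps eps0.
have eh0 : e n * \int[mu]_(x in `[s, t]) h x @[n --> \oo] --> 0.
  rewrite -(mul0r (\int[mu]_(x in `[s, t]) h x)).
  by apply: cvgM => //; exact: cvg_cst.
move/cvgrPdist_le : eh0 => /(_ _ eps0); apply: filterS => n.
rewrite sub0r normrN => h1; rewrite distrC.
rewrite ((pn n).2 _ _ as_ st tb).
have ign := integrable_sub_itv as_ tb (pn n).1.
rewrite -RintegralB//.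
apply: le_trans; last exact: le_trans (ler_norm _) h1.
rewrite -RintegralZl//.
have ib : mu.-integrable `[s, t] (EFin \o (fun x => g_ n x - g x)).
  have := integrable_itvD ign (integrable_itvZ (-1) igs).
  apply: eq_integrable => // x _ /=; by rewrite mulN1r.
apply: le_trans (le_normr_Rintegral _ ib) _ => //.
apply: le_Rintegral => //.
- exact: integrable_norm.
- exact: integrable_itvZ.
- move=> x /=; rewrite in_itv/= => /andP[sx xt]; apply: gn.
  by rewrite (le_trans as_ sx) (le_trans xt tb).
Qed.

Lemma prim_glue a b c f g : mu.-integrable `[a, c] (EFin \o g) ->
  prim a b f g -> prim b c f g -> prim a c f g.
Proof.
move=> ig [_ p1] [_ p2].
split => // s t as_ st tc.
have [tb|bt] := leP t b; first exact: p1.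
have [sb|bs] := leP s b; last by apply: p2 => //; exact: ltW.
have igs := integrable_sub_itv as_ tc ig.
rewrite (@Rintegral_split _ s t b) ?(ltW bt)//.
by rewrite -p1// -p2// ?(ltW bt)//; ring.
Qed.

Lemma prim_is_derive_at a b f g x : a < x -> x < b -> prim a b f g ->
  {for x, continuous g} -> is_derive x 1 f (g x).
Proof.
move=> ax xb [ig fg] cg.
have [d1 d2] := continuous_FTC1_closed xb ig ax cg.
set F := (fun y => \int[mu]_(t in `[a, y]) g t) in d1 d2.
have dF : is_derive x 1 F (g x).
  by rewrite -d2 derive1E; exact/derivableP.
have dF2 : is_derive x 1 (F + cst (f a)) (g x).
  by apply: is_derive_eq; rewrite addr0.
apply: (near_eq_is_derive _ dF2).
have xab : x \in `]a, b[ by rewrite in_itv/= ax xb.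
have := near_in_itvoo xab; apply: filterS => y; rewrite in_itv/= => /andP[ay yb].
by rewrite /= /F fctE -fg ?subrK// ltW.
Qed.

Lemma ae_neq (c : R) : {ae mu, forall x, x != c}.
Proof.
exists [set c]; split => //; first exact: lebesgue_measure_set1.
by move=> x /= /negP/negPn/eqP.
Qed.

(** The difference, extended by 0 outside the interval, has indefinite integral 0, so Lebesgue
    differentiation makes it 0 almost everywhere. The point [a] is discarded because differentiation
    takes place strictly to its right. *)
Lemma prim_ae_unique a b f g1 g2 : prim a b f g1 -> prim a b f g2 ->
  {ae mu, forall x, a <= x <= b -> g1 x = g2 x}.
Proof.
move=> [i1 p1] [i2 p2].
pose p := (fun x => g1 x - g2 x) \_ `[a, b].
have i12 : mu.-integrable `[a, b] (EFin \o (fun x => g1 x - g2 x)).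
  apply: (@eq_integrable _ _ _ mu _ _ (EFin \o (fun x => g1 x + -1 * g2 x))) => //.
    by move=> x _ /=; rewrite mulN1r.
  exact: integrable_itvD i1 (integrable_itvZ (-1) i2).
have ip : mu.-integrable setT (EFin \o p).
  by rewrite /p -restrict_EFin; apply/(integrable_mkcond _ _).1.
have lp : locally_integrable setT p by exact: integrable_locally.
have ip' y : mu.-integrable [set` Interval (BLeft a) (BRight y)] (EFin \o p).
  exact: integrableS ip.
have F0 x : \int[mu]_(t in `[a, x]) p t = 0.
  rewrite /p -Rintegral_mkcondr.
  have [bx|xb] := leP b x.
    have -> : `[a, x]%classic `&` `[a, b]%classic = `[a, b]%classic :> set R.
      by apply/setIidPr; apply: sub_itvcc.
    have [ab|ba] := leP a b; last by rewrite set_itv_ge ?Rintegral_set0// bnd_simp -ltNge.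
    by rewrite RintegralB// -p1// -p2// subrr.
  have -> : `[a, x]%classic `&` `[a, b]%classic = `[a, x]%classic :> set R.
    by apply/setIidPl; apply: sub_itvcc => //; exact: ltW.
  have [ax|xa] := leP a x; last by rewrite set_itv_ge ?Rintegral_set0// bnd_simp -ltNge.
  have j1 := integrable_sub_itv (lexx a) (ltW xb) i1.
  have j2 := integrable_sub_itv (lexx a) (ltW xb) i2.
  by rewrite RintegralB// -p1 ?(ltW xb)// -p2 ?(ltW xb)// subrr.
have := FTC1 ip' lp; have := ae_neq a.
apply: filterS2; first exact: (ae_filter_ringOfSetsType mu).
move=> x xa dF /andP[ax xb].
have [|_] := dF; first by rewrite (@lte_fin R) lt_neqAle eq_sym xa ax.
have -> : (fun x => \int[mu]_(t in [set` Interval (BLeft a) (BRight x)]) p t) = cst 0.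
  by apply/funext => y; rewrite F0.
rewrite derive1_cst /p patchE mem_set/= ?in_itv/= ?ax// => /esym/eqP.
by rewrite subr_eq0 => /eqP.
Qed.

End PrimitiveLimits.

(** * Complex polynomials and their locally uniform limits *)

Section ComplexNorm.
Local Open Scope complex_scope.
Variable R : realType.
Implicit Types (z w : R[i]) (x y r : R).

(** The norm of [R[i]] takes its values in [R[i]]; its real part turns estimates into inequalities
    and limits between real numbers. *)
Definition cnorm z : R := complex.Re `|z|.

Lemma cnormE z : (cnorm z)%:C = `|z|.
Proof. by rewrite /cnorm normc_def. Qed.

Lemma cnormM z w : cnorm (z * w) = cnorm z * cnorm w.
Proof. by apply: complexI; rewrite rmorphM/= !cnormE normrM. Qed.

Lemma cnormX z n : cnorm (z ^+ n) = cnorm z ^+ n.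
Proof. by apply: complexI; rewrite rmorphXn/= !cnormE normrX. Qed.

Lemma cnorm_ge0 z : 0 <= cnorm z.
Proof. by rewrite -lecR cnormE normr_ge0. Qed.

Lemma cnormD z w : cnorm (z + w) <= cnorm z + cnorm w.
Proof. by rewrite -lecR rmorphD/= !cnormE ler_normD. Qed.

Lemma cnormN z : cnorm (- z) = cnorm z.
Proof. by apply: complexI; rewrite !cnormE normrN. Qed.

Lemma cnormB z w : cnorm (z - w) <= cnorm z + cnorm w.
Proof. by rewrite -(cnormN w) cnormD. Qed.

Lemma cnorm0 : cnorm 0 = 0.
Proof. by apply: complexI; rewrite cnormE normr0. Qed.

Lemma cnorm1 : cnorm 1 = 1.
Proof. by apply: complexI; rewrite cnormE normr1. Qed.

Lemma cnorm_real x : cnorm x%:C = `|x|.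
Proof. by apply: complexI; rewrite cnormE normc_def/= expr0n/= addr0 sqrtr_sqr. Qed.

Lemma cnorm_i : cnorm 'i = 1.
Proof. by rewrite /cnorm normc_def/= expr0n/= expr1n add0r sqrtr1. Qed.

Lemma cnorm_eq0 z : cnorm z = 0 -> z = 0.
Proof. by move=> h; apply/eqP; rewrite -normr_eq0 -cnormE h. Qed.

Lemma cnorm_gt0 z : z != 0 -> 0 < cnorm z.
Proof. by move=> h; rewrite -ltcR cnormE normr_gt0. Qed.

Lemma cnorm_nat n : cnorm n%:R = n%:R.
Proof. by apply: complexI; rewrite cnormE normr_nat rmorph_nat. Qed.

Lemma ler_cnorm_Re z : `|complex.Re z| <= cnorm z.
Proof. by rewrite -lecR cnormE normc_ge_Re. Qed.

Lemma cnorm_le_ReIm z : cnorm z <= `|complex.Re z| + `|complex.Im z|.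
Proof.
rewrite {1}[z]complexE; apply: le_trans (cnormD _ _) _.
by rewrite cnormM cnorm_i mul1r !cnorm_real.
Qed.

Lemma ler_cnorm_Im z : `|complex.Im z| <= cnorm z.
Proof.
have := ler_cnorm_Re (z * 'i); rewrite ReiNIm normrN.
by rewrite cnormM cnorm_i mulr1.
Qed.

Lemma cnorm_sum (I : Type) (s : seq I) (P : pred I) (F : I -> R[i]) :
  cnorm (\sum_(i <- s | P i) F i) <= \sum_(i <- s | P i) cnorm (F i).
Proof.
elim/big_rec2: _ => [|i y z _ h]; first by rewrite cnorm0.
by apply: le_trans (cnormD _ _) _; rewrite lerD2l.
Qed.

End ComplexNorm.

Section PolynomialLimits.
Local Open Scope complex_scope.
Variable R : realType.
Notation C := R[i].
Implicit Types (z w : C) (p : {poly C}) (h : C -> C) (r M : R).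

(** The separable polynomial X^n - 1 splits into n distinct factors, and n distinct n-th roots of
    unity include a primitive one. *)
Lemma complex_prim_root_exists n : (n > 0)%N -> exists w : C, n.-primitive_root w.
Proof.
pose p : {poly C} := 'X^n - 1; have [r Dp] := closed_field_poly_normal p.
move=> n_gt0; rewrite (monicP _) ?monicXnsubC // scale1r in Dp.
have rn1: all n.-unity_root r by apply/allP=> z; rewrite -root_prod_XsubC -Dp.
have sz_r: (n < (size r).+1)%N.
  by rewrite -(size_prod_XsubC r id) -Dp size_XnsubC.
have [|z] := hasP (has_prim_root n_gt0 rn1 _ sz_r); last by exists z.
by rewrite -separable_prod_XsubC -Dp separable_Xn_sub_1 // pnatr_eq0 -lt0n.
Qed.

Lemma sum_prim_root N (w : C) m : N.-primitive_root w ->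
  \sum_(i < N) (w ^+ m) ^+ i = if (N %| m)%N then N%:R else 0.
Proof.
move=> prw; rewrite (prim_order_dvd prw); case: eqP => [->|/eqP h].
  under eq_bigr do rewrite expr1n.
  by rewrite sumr_const card_ord.
have := subrX1 (w ^+ m) N; rewrite exprAC (prim_expr_order prw) expr1n subrr.
by move/esym/eqP; rewrite mulf_eq0 subr_eq0 (negbTE h)/= => /eqP.
Qed.

(** Cauchy's estimate without integrals: the mean of p(r w^i) w^(-ij) over the N-th roots of unity
    w^i is exactly the j-th term p_j r^j. The exponent -j is represented by [k], that is N - j. *)
Lemma coef_bound p r M j : 0 < r ->
  (forall z, cnorm z = r -> cnorm p.[z] <= M) -> cnorm p`_j * r ^+ j <= M.
Proof.
move=> r0 pM.
(* [N] exceeds both [size p] and [j], so l = j is the only index l < N for which N divides l + N -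
   j. *)
pose N := (size p + j).+1.
have [w prw] : exists w : C, N.-primitive_root w by exact: complex_prim_root_exists.
have nw : cnorm w = 1.
  have := congr1 (@cnorm R) (prim_expr_order prw).
  rewrite cnormX cnorm1 => /eqP; rewrite pexpr_eq1//; first by move/eqP.
  exact: cnorm_ge0.
pose k := (N - j)%N.
have E : \sum_(i < N) p.[r%:C * w ^+ i] * (w ^+ k) ^+ i =
         N%:R * (p`_j * (r%:C) ^+ j).
  transitivity (\sum_(i < N) \sum_(l < N)
      p`_l * (r%:C) ^+ l * (w ^+ (l + k)) ^+ i).
    apply: eq_bigr => i _.
    rewrite (@horner_coef_wide _ N); last by rewrite /N leqW// leq_addr.
    rewrite mulr_suml; apply: eq_bigr => l _.
    by rewrite exprMn -!exprM -!mulrA -exprD; congr (_ * (_ * _ ^+ _)); ring.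
  rewrite exchange_big/=.
  have jN : (j < N)%N by rewrite /N ltnS leq_addl.
  rewrite (bigD1 (Ordinal jN))//= [X in _ + X]big1 ?addr0.
    rewrite -mulr_sumr sum_prim_root// subnKC ?dvdnn ?(ltnW jN)//.
    by rewrite mulrC.
  move=> l lj; rewrite -mulr_sumr sum_prim_root//.
  case: ifP; rewrite ?mulr0// => /dvdnP[c hc]; exfalso.
  move/eqP: lj; apply; apply: val_inj => /=.
  have lN := ltn_ord l; rewrite /k in hc.
  case: c hc => [|[|c]] hc; [lia|lia|].
  have : (N + N <= c.+2 * N)%N by rewrite !mulSn addnA leq_addr.
  lia.
have := congr1 (@cnorm R) E; rewrite !cnormM cnorm_nat cnormX cnorm_real (gtr0_norm r0).
move=> E2.
have N0 : (0 : R) < N%:R by rewrite ltr0n.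
rewrite -(ler_pM2l N0) -E2; apply: le_trans (cnorm_sum _ _ _) _.
apply: (@le_trans _ _ (\sum_(i < N) M)); last first.
  by rewrite sumr_const card_ord mulr_natl.
apply: ler_sum => i _; rewrite cnormM !cnormX nw !expr1n mulr1; apply: pM.
by rewrite cnormM cnormX nw expr1n mulr1 cnorm_real gtr0_norm.
Qed.

(** By Cauchy's estimate the terms are dominated by a geometric series of ratio |z|/r, at most 1/2,
    whose sum is at most twice its first term. *)
Lemma poly_tail_bound p r M z J : 0 < r -> cnorm z <= r / 2 -> 0 <= M ->
  (forall w, cnorm w = r -> cnorm p.[w] <= M) ->
  cnorm (p.[z] - \sum_(i < J) p`_i * z ^+ i) <= 2 * M * (cnorm z / r) ^+ J.
Proof.
move=> r0 zr M0 pM; set t := cnorm z / r.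
have t0 : 0 <= t by rewrite divr_ge0 ?cnorm_ge0// ltW.
have t2 : t <= 1 / 2 by rewrite /t ler_pdivrMr//; lra.
have tr : cnorm z = t * r by rewrite /t divfK// gt_eqF.
clearbody t; rewrite (@horner_coef_wide _ (J + size p)) ?leq_addl//.
rewrite big_split_ord/= addrAC subrr add0r.
(* The factor 1 - t^n makes the induction close: the slack of one step is M t^(J+n) (1 - 2t),
   nonnegative since t is at most 1/2. *)
have H n : \sum_(i < n) cnorm (p`_(J + i)) * cnorm z ^+ (J + i) <=
    2 * M * t ^+ J * (1 - t ^+ n).
  elim: n => [|n IH]; first by rewrite big_ord0 expr0 subrr mulr0.
  rewrite big_ord_recr/=.
  have cb := coef_bound (J + n) r0 pM.
  have : cnorm p`_(J + n) * cnorm z ^+ (J + n) <= M * t ^+ (J + n).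
    by rewrite tr exprMn mulrCA [leRHS]mulrC ler_wpM2l// exprn_ge0.
  move/(lerD IH)/le_trans; apply; rewrite exprS exprD.
  have tn0 : 0 <= t ^+ n by rewrite exprn_ge0.
  have tJ0 : 0 <= t ^+ J by rewrite exprn_ge0.
  rewrite -subr_ge0.
  have -> : 2 * M * t ^+ J * (1 - t * t ^+ n) -
      (2 * M * t ^+ J * (1 - t ^+ n) + M * (t ^+ J * t ^+ n))
    = M * t ^+ J * t ^+ n * (1 - 2 * t) by ring.
  by rewrite mulr_ge0 ?mulr_ge0//; lra.
apply: le_trans (cnorm_sum _ _ _) _.
under eq_bigr do rewrite cnormM cnormX.
apply: le_trans (H _) _.
by rewrite ler_piMr ?mulr_ge0 ?exprn_ge0// gerBl exprn_ge0.
Qed.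

Lemma horner_sub0_bound p r M z : 0 < r -> cnorm z <= r / 2 -> 0 <= M ->
  (forall w, cnorm w = r -> cnorm p.[w] <= M) ->
  cnorm (p.[z] - p.[0]) <= 2 * M * (cnorm z / r).
Proof.
move=> r0 zr M0 pM; have := poly_tail_bound 1 r0 zr M0 pM.
by rewrite big_ord1 expr0 mulr1 expr1 horner_coef0.
Qed.

(* Holomorphy on the whole plane, encoded as locally uniform approximation by
   polynomials. *)
Definition entire h := forall r e, 0 < r -> 0 < e ->
  exists p : {poly C}, forall z, cnorm z <= r -> cnorm (h z - p.[z]) <= e.

Lemma poly_disk_bounded p r : 0 < r ->
  exists2 M, 0 <= M & forall z, cnorm z <= r -> cnorm p.[z] <= M.
Proof.
move=> r0; exists (\sum_(i < size p) cnorm p`_i * r ^+ i).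
  by apply: sumr_ge0 => i _; rewrite mulr_ge0 ?cnorm_ge0// exprn_ge0// ltW.
move=> z zr; rewrite horner_coef; apply: le_trans (cnorm_sum _ _ _) _.
apply: ler_sum => i _; rewrite cnormM cnormX ler_wpM2l ?cnorm_ge0//.
by apply: lerXn2r => //; rewrite nnegrE ?cnorm_ge0// ltW.
Qed.

Lemma entire_disk_bounded h r : entire h -> 0 < r ->
  exists2 M, 0 <= M & forall z, cnorm z <= r -> cnorm (h z) <= M.
Proof.
move=> eh r0; have [p hp] := eh r 1 r0 ltr01.
have [M M0 hM] := poly_disk_bounded p r0.
exists (1 + M) => [|z zr]; first by rewrite addr_ge0.
rewrite -[h z](subrK p.[z]); apply: le_trans (cnormD _ _) _.
by rewrite lerD// ?hp ?hM.
Qed.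

Lemma eq_entire h1 h2 : h1 =1 h2 -> entire h1 -> entire h2.
Proof.
move=> e12 eh r e r0 e0; have [p hp] := eh _ _ r0 e0; exists p => z zr.
by rewrite -e12; exact: hp.
Qed.

Lemma entire_poly p : entire (fun z => p.[z]).
Proof. by move=> r e r0 e0; exists p => z _; rewrite subrr cnorm0 ltW. Qed.

Lemma entireD h1 h2 : entire h1 -> entire h2 -> entire (fun z => h1 z + h2 z).
Proof.
move=> e1 e2 r e r0 e0; have e20 : 0 < e / 2 by rewrite divr_gt0.
have [p1 hp1] := e1 _ _ r0 e20; have [p2 hp2] := e2 _ _ r0 e20.
exists (p1 + p2) => z zr; rewrite hornerD.
have -> : h1 z + h2 z - (p1.[z] + p2.[z]) = (h1 z - p1.[z]) + (h2 z - p2.[z]) by ring.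
apply: le_trans (cnormD _ _) _; have := hp1 _ zr; have := hp2 _ zr; lra.
Qed.

Lemma entireM h1 h2 : entire h1 -> entire h2 -> entire (fun z => h1 z * h2 z).
Proof.
move=> e1 e2 r e r0 e0.
have [M M0 hM] := entire_disk_bounded e2 r0.
have eM0 : 0 < e / 2 / (M + 1) by rewrite !divr_gt0// ltr_wpDl.
have [p1 hp1] := e1 _ _ r0 eM0.
(* [p2] is chosen after [p1], because its tolerance depends on the size of [p1] on the disc. *)
have [N N0 hN] := poly_disk_bounded p1 r0.
have eN0 : 0 < e / 2 / (N + 1) by rewrite !divr_gt0// ltr_wpDl.
have [p2 hp2] := e2 _ _ r0 eN0.
exists (p1 * p2) => z zr; rewrite hornerM.
have -> : h1 z * h2 z - p1.[z] * p2.[z] =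
   (h1 z - p1.[z]) * h2 z + p1.[z] * (h2 z - p2.[z]) by ring.
apply: le_trans (cnormD _ _) _; rewrite !cnormM.
have H a b d : 0 <= a -> 0 <= b -> 0 <= d -> a <= e / 2 / (d + 1) -> b <= d ->
    a * b <= e / 2.
  move=> a0 b0 d0; rewrite ler_pdivlMr ?ltr_wpDl// => h1' h2'.
  apply: le_trans h1'; rewrite ler_wpM2l//; lra.
have h1' := H _ _ _ (cnorm_ge0 _) (cnorm_ge0 _) M0 (hp1 _ zr) (hM _ zr).
have h2' := H _ _ _ (cnorm_ge0 _) (cnorm_ge0 _) N0 (hp2 _ zr) (hN _ zr).
by rewrite [X in _ + X]mulrC; lra.
Qed.

Lemma entireB h1 h2 : entire h1 -> entire h2 -> entire (fun z => h1 z - h2 z).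
Proof.
move=> e1 e2; apply: (@eq_entire (fun z => h1 z + (-1)%:P.[z] * h2 z)).
  by move=> z; rewrite hornerC mulN1r.
by apply: entireD => //; apply: entireM => //; exact: entire_poly.
Qed.

Lemma eq0_cnorm_le (K : R) z : (forall e, 0 < e -> cnorm z <= e * K) -> z = 0.
Proof.
move=> H; apply: cnorm_eq0; apply/eqP.
rewrite eq_le cnorm_ge0 andbT leNgt; apply/negP => z0.
have K0 : 0 < K by have := H 1 ltr01; rewrite mul1r; exact: lt_le_trans.
have := H (cnorm z / K / 2); rewrite !divr_gt0// => /(_ isT).
rewrite mulrAC divfK ?gt_eqF//; lra.
Qed.

(** A polynomial close to [h] on a large disc is bounded on its circle independently of the radius,
    so Cauchy's estimate makes its increment from 0 to z of order |z|/r. The extra 1 in [M1] absorbs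
    the approximation error. *)
Lemma liouville h r0 M : entire h ->
  (forall z, r0 <= cnorm z -> cnorm (h z) <= M) -> forall z, h z = h 0.
Proof.
move=> eh hM z; apply/eqP; rewrite -subr_eq0; apply/eqP.
pose M1 := `|M| + 1; have M10 : 0 < M1 by rewrite ltr_wpDl.
apply: (@eq0_cnorm_le (2 + 2 * M1)) => e0' e0'0.
pose e := Num.min e0' 1; have e0 : 0 < e by rewrite lt_min e0'0 ltr01.
have ee : e <= e0' by rewrite ge_min lexx.
have e1 : e <= 1 by rewrite ge_min lexx orbT.
(* Large enough for three purposes: the circle lies where [h] is bounded, z lies in the half disc
   since e is at most 1, and |z|/r is at most e. *)
pose r := `|r0| + 1 + 2 * cnorm z / e.
have zN := cnorm_ge0 z.
have ze0 : 0 <= 2 * cnorm z / e by rewrite divr_ge0 ?mulr_ge0// ltW.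
have rgt0 : 0 < r by rewrite /r; have := normr_ge0 r0; lra.
have zr : cnorm z <= r / 2.
  have : 2 * cnorm z <= 2 * cnorm z / e.
    by rewrite ler_peMr ?mulr_ge0// invf_ge1.
  by rewrite /r; have := normr_ge0 r0; lra.
have [p hp] := eh _ _ rgt0 e0.
have pM w : cnorm w = r -> cnorm p.[w] <= M1.
  move=> wr; have -> : p.[w] = h w - (h w - p.[w]) by ring.
  apply: le_trans (cnormB _ _) _; rewrite lerD//; last first.
    by apply: le_trans (hp _ _) e1; rewrite wr.
  apply: le_trans (ler_norm _); apply: hM; rewrite wr /r.
  by have := ler_norm r0; lra.
have pz := horner_sub0_bound rgt0 zr (ltW M10) pM.
have -> : h z - h 0 = (h z - p.[z]) - (h 0 - p.[0]) + (p.[z] - p.[0]) by ring.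
apply: le_trans (cnormD _ _) _; have := cnormB (h z - p.[z]) (h 0 - p.[0]).
have : cnorm (h z - p.[z]) <= e by apply: hp; lra.
have : cnorm (h 0 - p.[0]) <= e by apply: hp; rewrite cnorm0 ltW.
have : cnorm z / r <= e.
  rewrite ler_pdivrMr// /r !mulrDr mulr1 [e * (_ / e)]mulrC divfK ?gt_eqF//.
  have : 0 <= e * `|r0| by rewrite mulr_ge0// ltW.
  lra.
move=> h1; have : 2 * M1 * (cnorm z / r) <= 2 * M1 * e0'.
  by rewrite ler_wpM2l//; lra.
lra.
Qed.

Lemma cvg0_sum J (u : nat -> nat -> R) (c : nat -> R) :
  (forall i, (i < J)%N -> u i n @[n --> \oo] --> (0 : R)) ->
  \sum_(i < J) u i n * c i @[n --> \oo] --> (0 : R).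
Proof.
elim: J => [|J IH] uJ.
  rewrite (_ : (fun _ => _) = cst 0); first exact: cvg_cst.
  by apply/funext => n; rewrite big_ord0.
rewrite (_ : (fun _ => _) = (fun n => \sum_(i < J) u i n * c i + u J n * c J));
  last by apply/funext => n; rewrite big_ord_recr.
have h1 : \sum_(i < J) u i n * c i @[n --> \oo] --> (0 : R).
  by apply: IH => i iJ; apply: uJ; exact: leqW.
have h2 : u J n * c J @[n --> \oo] --> 0 * c J.
  by apply: cvgM; [exact: uJ|exact: cvg_cst].
have := cvgD h1 h2; rewrite mul0r addr0; exact.
Qed.

(** Strong induction on j: at a small x the lower terms and the value tend to 0, the tail beyond j
    is at most 2 M x^(j+1), and division by x^j isolates the j-th coefficient. The point x is fixed
    before n grows. *)
Lemma coef_cvg0 (p_ : nat -> {poly C}) r M : 1 <= r -> 0 <= M ->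
  (forall n z, cnorm z = r -> cnorm (p_ n).[z] <= M) ->
  (forall x, 0 < x -> x <= 1 / 2 -> cnorm (p_ n).[x%:C] @[n --> \oo] --> (0 : R)) ->
  forall j, cnorm (p_ n)`_j @[n --> \oo] --> (0 : R).
Proof.
move=> r1 M0 pM px; elim/ltn_ind => j IH.
apply/cvgrPdist_le => eps eps0.
pose x := Num.min (1 / 2) (eps / 2 / (2 * M + 1)).
have M1 : 0 < 2 * M + 1 by lra.
have x0 : 0 < x by rewrite lt_min !divr_gt0//; lra.
have x2 : x <= 1 / 2 by rewrite ge_min lexx.
have xM : 2 * M * x <= eps / 2.
  have : x <= eps / 2 / (2 * M + 1) by rewrite ge_min lexx orbT.
  by rewrite ler_pdivlMr//; lra.
clearbody x.
have xj : 0 < x ^+ j by rewrite exprn_gt0.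
have S0 : cnorm (p_ n).[x%:C] + \sum_(i < j) cnorm (p_ n)`_i * x ^+ i
    @[n --> \oo] --> (0 : R).
  rewrite -[X in _ --> X](addr0 (0 : R)).
  exact: cvgD (px _ x0 x2) (@cvg0_sum j _ (fun i => x ^+ i) IH).
have e2 : 0 < eps / 2 * x ^+ j by rewrite mulr_gt0// divr_gt0.
move/cvgrPdist_le : S0 => /(_ _ e2); apply: filterS => n.
rewrite !sub0r !normrN => hn.
have {}hn := le_trans (ler_norm _) hn.
rewrite ger0_norm ?cnorm_ge0// -(ler_pM2r xj).
have r0 : 0 < r by exact: lt_le_trans r1.
have xr : cnorm x%:C <= r / 2 by rewrite cnorm_real gtr0_norm//; lra.
have := poly_tail_bound j.+1 r0 xr M0 (pM n).
rewrite big_ord_recr/= cnorm_real gtr0_norm//.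
set S := \sum_(i < j) _; set P := (p_ n).[_] => tl.
have : cnorm S <= \sum_(i < j) cnorm (p_ n)`_i * x ^+ i.
  apply: le_trans (cnorm_sum _ _ _) _; apply: ler_sum => i _.
  by rewrite cnormM cnormX cnorm_real gtr0_norm.
have tl2 : 2 * M * (x / r) ^+ j.+1 <= eps / 2 * x ^+ j.
  apply: (@le_trans _ _ (2 * M * x ^+ j.+1)).
    rewrite ler_wpM2l ?mulr_ge0//; apply: lerXn2r.
    - by rewrite nnegrE divr_ge0// ltW.
    - by rewrite nnegrE ltW.
    - by rewrite ler_pdivrMr// ler_peMr// ltW.
  by rewrite exprS mulrA ler_wpM2r// ltW.
have : cnorm (p_ n)`_j * x ^+ j = cnorm (P - S - (P - (S + (p_ n)`_j * x%:C ^+ j))).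
  have -> : P - S - (P - (S + (p_ n)`_j * x%:C ^+ j)) = (p_ n)`_j * x%:C ^+ j by ring.
  by rewrite cnormM cnormX cnorm_real gtr0_norm.
have := cnormB (P - S) (P - (S + (p_ n)`_j * x%:C ^+ j)).
have := cnormB P S.
lra.
Qed.

(** Polynomials that approximate [h] tend to 0 on the half-axis, so each of their coefficients tends
    to 0. At z a finite head is then small by convergence of the coefficients and the tail is small
    uniformly in n. *)
Lemma entire_eq0 h : entire h -> (forall x : R, 0 < x -> h x%:C = 0) ->
  forall z, h z = 0.
Proof.
move=> eh h0 z; pose r := 2 * (cnorm z + 1).
have z0 := cnorm_ge0 z.
have r1 : 1 <= r by rewrite /r; lra.
have r0 : 0 < r by exact: lt_le_trans r1.
have zr : cnorm z <= r / 2 by rewrite /r; lra.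
have [M M0 hM] := entire_disk_bounded eh r0.
have [p_ hp] : exists p_ : nat -> {poly C}, forall n w, cnorm w <= r ->
    cnorm (h w - (p_ n).[w]) <= n.+1%:R^-1.
  have H n : exists p : {poly C}, forall w, cnorm w <= r ->
      cnorm (h w - p.[w]) <= n.+1%:R^-1 by exact: eh.
  by exists (fun n => sval (cid (H n))) => n; exact: (svalP (cid (H n))).
have M10 : 0 <= M + 1 by lra.
have pM n w : cnorm w = r -> cnorm (p_ n).[w] <= M + 1.
  move=> wr; have -> : (p_ n).[w] = h w - (h w - (p_ n).[w]) by ring.
  apply: le_trans (cnormB _ _) _; rewrite lerD ?hM ?wr//.
  apply: le_trans (hp _ _ _) _; first by rewrite wr.
  by rewrite invf_le1// ler1n.
have inv0 : (n.+1%:R^-1 : R) @[n --> \oo] --> (0 : R) by exact: cvg_harmonic.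
have c0 := coef_cvg0 r1 M10 pM.
have {}c0 j : cnorm (p_ n)`_j @[n --> \oo] --> (0 : R).
  apply: c0 => x x0 x2; apply: (@squeeze_cvgr _ _ _ _ (cst 0) (fun n => n.+1%:R^-1)) => //.
    apply: nearW => n; rewrite cnorm_ge0/=.
    have := hp n x%:C; rewrite h0// sub0r cnormN; apply.
    by rewrite cnorm_real gtr0_norm//; lra.
  exact: cvg_cst.
apply: (@eq0_cnorm_le (2 * (M + 1) + 2)) => e e0.
(* J > 1/e and 2^J > J give 2^(-J) < e, while |z|/r is at most 1/2 by the choice of [r]. *)
pose J := (Num.truncn e^-1).+1.
have J2 : (cnorm z / r) ^+ J <= e.
  apply: (@le_trans _ _ ((1 / 2) ^+ J)).
    apply: lerXn2r; rewrite ?nnegrE ?divr_ge0// ?(ltW r0)//.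
    by rewrite ler_pdivrMr//; lra.
  rewrite expr_div_n expr1n div1r invf_ple ?posrE ?exprn_gt0//.
  apply/ltW/(lt_trans (truncnS_gt _)); rewrite -natrX ltr_nat; exact: ltn_expl.
have S0 : n.+1%:R^-1 + \sum_(i < J) cnorm (p_ n)`_i * cnorm z ^+ i
    @[n --> \oo] --> (0 : R).
  rewrite -[X in _ --> X](addr0 (0 : R)).
  exact: cvgD inv0 (@cvg0_sum J _ (fun i => cnorm z ^+ i) (fun i _ => c0 i)).
move/cvgrPdist_le : S0 => /(_ _ e0) [n _ /(_ n (leqnn n))].
rewrite sub0r normrN => /(le_trans (ler_norm _)) hn.
have tl := poly_tail_bound J r0 zr M10 (pM n).
have Sle : cnorm (\sum_(i < J) (p_ n)`_i * z ^+ i) <=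
    \sum_(i < J) cnorm (p_ n)`_i * cnorm z ^+ i.
  by apply: le_trans (cnorm_sum _ _ _) _; apply: ler_sum => i _;
    rewrite cnormM cnormX.
have hz : cnorm (h z - (p_ n).[z]) <= n.+1%:R^-1 by apply: hp; lra.
have Me : 2 * (M + 1) * (cnorm z / r) ^+ J <= 2 * (M + 1) * e.
  by rewrite ler_wpM2l// mulr_ge0.
set S := \sum_(i < J) (p_ n)`_i * _ in tl Sle.
have -> : h z = (h z - (p_ n).[z]) + (((p_ n).[z] - S) + S) by ring.
apply: le_trans (cnormD _ _) _; apply: le_trans (lerD hz (cnormD _ _)) _.
apply: le_trans (lerD (lexx _) (lerD (le_trans tl Me) Sle)) _.
rewrite addrCA; apply: le_trans (lerD (lexx _) hn) _; rewrite -subr_ge0.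
have -> : e * (2 * (M + 1) + 2) - (2 * (M + 1) * e + e) = e by ring.
exact: ltW.
Qed.

End PolynomialLimits.

(** * Complex-valued indefinite integrals and exponentials *)

Section ComplexPrimitive.
Local Open Scope complex_scope.
Variable R : realType.
Notation C := R[i].
Notation mu := (@lebesgue_measure R).
Notation Re := (@complex.Re R).
Notation Im := (@complex.Im R).
Implicit Types (F G : R -> C) (a b s t x : R) (w c : C).

Lemma ReD (z w : C) : Re (z + w) = Re z + Re w.
Proof. by case: z; case: w. Qed.

Lemma ImD (z w : C) : Im (z + w) = Im z + Im w.
Proof. by case: z; case: w. Qed.

Lemma ReB (z w : C) : Re (z - w) = Re z - Re w.
Proof. by case: z; case: w. Qed.

Lemma ImB (z w : C) : Im (z - w) = Im z - Im w.
Proof. by case: z; case: w. Qed.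

Lemma ReM (z w : C) : Re (z * w) = Re z * Re w - Im z * Im w.
Proof. by case: z; case: w. Qed.

Lemma ImM (z w : C) : Im (z * w) = Re z * Im w + Im z * Re w.
Proof. by case: z; case: w. Qed.

Lemma complex_ext (z w : C) : Re z = Re w -> Im z = Im w -> z = w.
Proof. by case: z => a b; case: w => d e /= -> ->. Qed.

Definition cprim a b F G : Prop :=
  prim a b (fun x => Re (F x)) (fun x => Re (G x)) /\
  prim a b (fun x => Im (F x)) (fun x => Im (G x)).

Lemma eq_cprim a b F F' G G' :
  (forall x, a <= x <= b -> F x = F' x) ->
  (forall x, a <= x <= b -> G x = G' x) ->
  cprim a b F G -> cprim a b F' G'.
Proof.
move=> FF GG [p1 p2]; split.
  by apply: eq_prim p1 => x xab; rewrite ?FF ?GG.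
by apply: eq_prim p2 => x xab; rewrite ?FF ?GG.
Qed.

Lemma cprim_cst a b c : cprim a b (cst c) (cst 0).
Proof. by split; exact: prim_cst. Qed.

Lemma cprimD a b F G F' G' : cprim a b F G -> cprim a b F' G' ->
  cprim a b (fun x => F x + F' x) (fun x => G x + G' x).
Proof.
move=> [p1 p2] [p1' p2']; split.
  by apply: eq_prim (primD p1 p1') => x _; rewrite ReD.
by apply: eq_prim (primD p2 p2') => x _; rewrite ImD.
Qed.

Lemma cprimZ a b c F G : cprim a b F G ->
  cprim a b (fun x => c * F x) (fun x => c * G x).
Proof.
move=> [p1 p2]; split.
  by apply: eq_prim (primB (primZ (Re c) p1) (primZ (Im c) p2)) => x _; rewrite ReM.
by apply: eq_prim (primD (primZ (Re c) p2) (primZ (Im c) p1)) => x _; rewrite ImM.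
Qed.

Lemma cprimB a b F G F' G' : cprim a b F G -> cprim a b F' G' ->
  cprim a b (fun x => F x - F' x) (fun x => G x - G' x).
Proof.
move=> p /(cprimZ (-1)) p'; apply: eq_cprim (cprimD p p') => x _;
  by rewrite mulN1r.
Qed.

Lemma cprimM a b F G F' G' : a <= b -> cprim a b F G -> cprim a b F' G' ->
  cprim a b (fun x => F x * F' x) (fun x => F x * G' x + F' x * G x).
Proof.
move=> ab [p1 p2] [p1' p2']; split.
  apply: eq_prim (primB (primM ab p1 p1') (primM ab p2 p2')) => x _.
    by rewrite ReM.
  by rewrite ReD !ReM; ring.
apply: eq_prim (primD (primM ab p1 p2') (primM ab p2 p1')) => x _.
  by rewrite ImM.
by rewrite ImD !ImM; ring.
Qed.

Lemma cprim_sum a b n (F G : nat -> R -> C) :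
  (forall i, cprim a b (F i) (G i)) ->
  cprim a b (fun x => \sum_(i < n) F i x) (fun x => \sum_(i < n) G i x).
Proof.
move=> p; elim: n => [|n IH].
  by apply: eq_cprim (cprim_cst a b 0) => x _; rewrite big_ord0.
by apply: eq_cprim (cprimD IH (p n)) => x _; rewrite big_ord_recr.
Qed.

Lemma prim_eq_cst a b f g : prim a b f g ->
  (forall x, a <= x <= b -> g x = 0) ->
  forall s t, a <= s <= b -> a <= t <= b -> f s = f t.
Proof.
move=> p g0.
have H s t : a <= s -> s <= t -> t <= b -> f s = f t.
  move=> as_ st tb; apply/esym/eqP; rewrite -subr_eq0 (p.2 _ _ as_ st tb).
  rewrite (@eq_Rintegral _ _ _ mu _ (cst 0)) ?Rintegral_cst ?mul0r//.
  move=> x; rewrite inE/= in_itv/= => /andP[sx xt].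
  by rewrite g0// (le_trans as_ sx) (le_trans xt tb).
move=> s t /andP[as_ sb] /andP[at_ tb].
by have [st|/ltW ts] := leP s t; [exact: H|apply/esym/H].
Qed.

Lemma cprim_eq_cst a b F G : cprim a b F G ->
  (forall x, a <= x <= b -> G x = 0) ->
  forall s t, a <= s <= b -> a <= t <= b -> F s = F t.
Proof.
move=> [p1 p2] G0 s t sab tab; apply: complex_ext.
  by apply: (prim_eq_cst p1) => // x /G0 ->.
by apply: (prim_eq_cst p2) => // x /G0 ->.
Qed.

(** The factor 2 comes from bounding real and imaginary parts separately; it reappears in the
    constants of all later estimates. *)
Lemma cprim_norm_le a b F G h s t : cprim a b F G ->
  mu.-integrable `[a, b] (EFin \o h) ->
  (forall x, s <= x <= t -> cnorm (G x) <= h x) ->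
  a <= s -> s <= t -> t <= b ->
  cnorm (F t - F s) <= 2 * \int[mu]_(x in `[s, t]) h x.
Proof.
move=> [p1 p2] ih Gh as_ st tb.
apply: le_trans (cnorm_le_ReIm _) _; rewrite ReB ImB mulr_natl mulr2n.
apply: lerD.
  apply: (prim_le p1) => // x xst; apply: le_trans (Gh _ xst).
  exact: ler_cnorm_Re.
apply: (prim_le p2) => // x xst; apply: le_trans (Gh _ xst).
exact: ler_cnorm_Im.
Qed.

Lemma cprim_bounded a b F G : a <= b -> cprim a b F G ->
  exists2 M, 0 <= M & forall x, a <= x <= b -> cnorm (F x) <= M.
Proof.
move=> ab [/(prim_bounded ab)[M1 M10 h1] /(prim_bounded ab)[M2 M20 h2]].
exists (M1 + M2) => [|x xab]; first exact: addr_ge0.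
apply: le_trans (cnorm_le_ReIm _) _; apply: lerD; [exact: h1|exact: h2].
Qed.

Lemma expiD (s t : R) : expi (s + t) = expi s * expi t.
Proof.
apply: complex_ext; rewrite ?ReM ?ImM/= ?cosD ?sinD//.
by rewrite addrC.
Qed.

Lemma expi0 : expi (0 : R) = 1.
Proof. by rewrite /expi cos0 sin0. Qed.

Lemma cnorm_expi (t : R) : cnorm (expi t) = 1.
Proof. by rewrite /cnorm normc_def/= cos2Dsin2 sqrtr1. Qed.

Definition cexp w x : C := (expR (Re w * x))%:C * expi (Im w * x).

Lemma cexp0 w : cexp w 0 = 1.
Proof. by rewrite /cexp !mulr0 expR0 expi0 mulr1. Qed.

Lemma cexpD w w' x : cexp (w + w') x = cexp w x * cexp w' x.
Proof.
rewrite /cexp ReD ImD !mulrDl expRD expiD rmorphM/=; ring.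
Qed.

Lemma cexpN w x : cexp (- w) x * cexp w x = 1.
Proof.
rewrite -cexpD addNr /cexp/= !mul0r expR0 expi0 mulr1//.
Qed.

Lemma cnorm_cexp w x : cnorm (cexp w x) = expR (Re w * x).
Proof.
by rewrite /cexp cnormM cnorm_expi mulr1 cnorm_real gtr0_norm ?expR_gt0.
Qed.

Lemma is_derive_scale (c x : R) : is_derive x 1 (fun y => c * y) c.
Proof.
have h : is_derive x 1 (c \*: (@id R)) (c *: 1) by exact: is_deriveZ.
have e : c *: (1 : R) = c by exact: mulr1.
by rewrite e in h; exact: h.
Qed.

Lemma prim_comp_scale a b (c : R) (f g : R -> R) :
  (forall x, is_derive x 1 f (g x)) -> continuous g ->
  prim a b (fun x => f (c * x)) (fun x => c * g (c * x)).
Proof.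
move=> df cg; apply: prim_is_derive => [x|x].
  apply: cvgM; first exact: cvg_cst.
  apply: continuous_comp; last exact: cg.
  by apply: cvgM; [exact: cvg_cst|exact: cvg_id].
have h := is_derive_scale c x.
have := is_derive1_comp (df (c * x)) h.
by rewrite mulrC.
Qed.

Lemma cprim_cexp a b w : a <= b -> cprim a b (cexp w) (fun x => w * cexp w x).
Proof.
move=> ab.
have pe := prim_comp_scale a b (Re w) (@is_derive_expR R) (@continuous_expR R).
have pc : prim a b (fun x => cos (Im w * x)) (fun x => Im w * - sin (Im w * x)).
  apply: (@prim_comp_scale _ _ _ _ (fun x => - sin x)).
  move=> x; apply: cvgN; exact: continuous_sin.
have ps := prim_comp_scale a b (Im w) (@is_derive_sin R) (@continuous_cos R).
split.
  apply: eq_prim (primM ab pe pc) => x _; first by rewrite /cexp ReM/= mul0r subr0.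
  by rewrite /cexp !ReM !ImM/=; ring.
apply: eq_prim (primM ab pe ps) => x _; first by rewrite /cexp ImM/= mul0r addr0.
by rewrite /cexp !ImM !ReM/=; ring.
Qed.

End ComplexPrimitive.

(** * Solutions depending on the energy *)

Section SeriesTail.
Local Open Scope complex_scope.
Variable R : realType.
Notation C := R[i].

Lemma series_dominated_tail (u e : nat -> R) : cvgn (series e) ->
  (forall n, `|u n| <= e n) ->
  forall N, `|limn (series u) - series u N| <= limn (series e) - series e N.
Proof.
move=> ce ue N.
have cu : cvgn (series u).
  apply: normed_cvg; apply: series_le_cvg ce => n /=.
  - exact: normr_ge0.
  - exact: le_trans (normr_ge0 _) (ue n).
  - exact: ue.
have c1 : (fun M => `|series u M - series u N|) @ \oo -->
    `|limn (series u) - series u N|.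
  by apply: cvg_norm; apply: cvgB => //; exact: cvg_cst.
have c2 : (fun M => series e M - series e N) @ \oo -->
    limn (series e) - series e N.
  by apply: cvgB => //; exact: cvg_cst.
apply: (ler_cvg_to c1 c2); near=> M.
have NM : (N <= M)%N by near: M; exists N.
rewrite !sub_series_geq//; apply: le_trans (ler_norm_sum _ _ _) _.
exact: ler_sum.
Unshelve. all: by end_near. Qed.

Definition cseries (u : nat -> C) : C :=
  limn (series (fun n => complex.Re (u n))) +i*
  limn (series (fun n => complex.Im (u n))).

Lemma Re_sum n (u : nat -> C) :
  complex.Re (\sum_(i < n) u i) = \sum_(i < n) complex.Re (u i).
Proof.
by elim: n => [|n IH]; rewrite ?big_ord0// !big_ord_recr/= ReD IH.
Qed.

Lemma Im_sum n (u : nat -> C) :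
  complex.Im (\sum_(i < n) u i) = \sum_(i < n) complex.Im (u i).
Proof.
by elim: n => [|n IH]; rewrite ?big_ord0// !big_ord_recr/= ImD IH.
Qed.

Lemma cseries_tail (u : nat -> C) (e : nat -> R) : cvgn (series e) ->
  (forall n, cnorm (u n) <= e n) ->
  forall N, cnorm (cseries u - \sum_(n < N) u n) <=
    2 * (limn (series e) - series e N).
Proof.
move=> ce ue N; apply: le_trans (cnorm_le_ReIm _) _.
rewrite ReB ImB Re_sum Im_sum/= mulr_natl mulr2n.
have h1 := @series_dominated_tail (fun n => complex.Re (u n)) e ce
  (fun n => le_trans (ler_cnorm_Re _) (ue n)) N.
have h2 := @series_dominated_tail (fun n => complex.Im (u n)) e ce
  (fun n => le_trans (ler_cnorm_Im _) (ue n)) N.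
by apply: lerD; [move: h1|move: h2]; rewrite /series/= big_mkord.
Qed.

Lemma series_tail_cvg0 (e : nat -> R) (c : R) : cvgn (series e) ->
  c * (limn (series e) - series e n) @[n --> \oo] --> (0 : R).
Proof.
move=> ce; rewrite -(mulr0 c); apply: cvgM; first exact: cvg_cst.
rewrite -(subrr (limn (series e))); apply: cvgB => //; exact: cvg_cst.
Qed.

End SeriesTail.

(** * Picard iteration from the endpoint [a] *)

Section Picard.
Local Open Scope complex_scope.
Variable R : realType.
Notation C := R[i].
Notation mu := (@lebesgue_measure R).
Variables (q : R -> R) (a y0 v0 : R).

(* Coefficients, as polynomials in z, of the Picard iterates at [a] of the
   system y' = v, v' = (q - z) y with data (y0, v0). *)
Fixpoint picard (n : nat) : (nat -> R -> R) * (nat -> R -> R) :=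
  if n is m.+1 then
    ((fun j x => - \int[mu]_(t in `[x, a]) (picard m).2 j t),
     (fun j x => - \int[mu]_(t in `[x, a])
        (q t * (picard m).1 j t - (if j is i.+1 then (picard m).1 i t else 0))))
  else ((fun j _ => if j is 0 then y0 else 0),
        (fun j _ => if j is 0 then v0 else 0)).

Definition picardY n (z : C) (x : R) : C :=
  \sum_(j < n.+1) ((picard n).1 j x)%:C * z ^+ j.

Definition picardV n (z : C) (x : R) : C :=
  \sum_(j < n.+1) ((picard n).2 j x)%:C * z ^+ j.

Hypotheses (a0 : 0 <= a) (iq : mu.-integrable `[0, a] (EFin \o q)).

Lemma integrable_cst_itv s t (c : R) :
  mu.-integrable `[s, t] (EFin \o (fun _ : R => c)).
Proof. by apply: continuous_integrable_itv; exact: cst_continuous. Qed.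

Lemma integrable_prim s t (f g : R -> R) : s <= t -> prim s t f g ->
  mu.-integrable `[s, t] (EFin \o f).
Proof.
move=> st p; have := integrable_prim_mul st p (integrable_cst_itv s t 1).
by apply: eq_integrable => // x _ /=; rewrite mulr1.
Qed.

Lemma picard_integrable n j :
  mu.-integrable `[0, a] (EFin \o (picard n).2 j) /\
  mu.-integrable `[0, a] (EFin \o (fun t =>
     q t * (picard n).1 j t - (if j is i.+1 then (picard n).1 i t else 0))).
Proof.
have sub f g : mu.-integrable `[0, a] (EFin \o f) ->
    mu.-integrable `[0, a] (EFin \o g) ->
    mu.-integrable `[0, a] (EFin \o (fun t => f t - g t)).
  move=> i1 i2; have := integrable_itvD i1 (integrable_itvZ (-1) i2).
  by apply: eq_integrable => // x _ /=; rewrite mulN1r.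
(* The iterates enter only as indefinite integrals, so this argument serves both the base case and
   the inductive step. *)
have H f g : (forall j, exists h, prim 0 a (f j) h) ->
    (forall j, exists h, prim 0 a (g j) h) -> forall j,
  mu.-integrable `[0, a] (EFin \o g j) /\
  mu.-integrable `[0, a] (EFin \o (fun t =>
     q t * f j t - (if j is i.+1 then f i t else 0))).
  move=> pf pg i; split; first by have [h /integrable_prim] := pg i; apply.
  apply: sub.
    have [h ph] := pf i; have := integrable_prim_mul a0 ph iq.
    by apply: eq_integrable => // x _ /=; rewrite mulrC.
  case: i => [|i]; first exact: integrable_cst_itv.
  by have [h /integrable_prim] := pf i; apply.
elim: n j => [|n IH] j.
  by apply: (H (fun j _ => _) (fun j _ => _)) => -[|i];
    exists (cst 0); exact: prim_cst.
by apply: H => i; eexists; apply: prim_bwd_integral; have [] := IH i.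
Qed.

(** The n-th iterate has degree at most n in z, so the sums over [j < n.+1] in [picardY] and
    [picardV] omit nothing. *)
Lemma picard_ge n j : (n < j)%N ->
  (picard n).1 j = cst 0 /\ (picard n).2 j = cst 0.
Proof.
elim: n j => [|n IH] [|j]//; rewrite ltnS => nj.
have [h1 h2] := IH j.+1 (ltnW nj); have [h3 _] := IH j nj.
by split; apply/funext => x /=; rewrite ?h1 ?h2 ?h3;
  under eq_Rintegral do rewrite /cst/= ?mulr0 ?subr0;
  rewrite Rintegral_cst// mul0r oppr0.
Qed.

Lemma picardY_prim n z : cprim 0 a (picardY n.+1 z) (picardV n z).
Proof.
have p j : cprim 0 a (fun x => z ^+ j * ((picard n.+1).1 j x)%:C)
    (fun x => z ^+ j * ((picard n).2 j x)%:C).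
  apply: cprimZ; split; last exact: prim_cst.
  by apply: prim_bwd_integral; have [] := picard_integrable n j.
apply: eq_cprim (cprim_sum n.+2 p) => x _.
  by apply: eq_bigr => j _; rewrite mulrC.
rewrite big_ord_recr/= (picard_ge (ltnSn n)).2 mulr0 addr0.
by apply: eq_bigr => j _; rewrite mulrC.
Qed.

Lemma picardV_prim n z :
  cprim 0 a (picardV n.+1 z) (fun x => ((q x)%:C - z) * picardY n z x).
Proof.
pose g j x := q x * (picard n).1 j x - (if j is i.+1 then (picard n).1 i x else 0).
have p j : cprim 0 a (fun x => z ^+ j * ((picard n.+1).2 j x)%:C)
    (fun x => z ^+ j * (g j x)%:C).
  apply: cprimZ; split; last exact: prim_cst.
  by apply: prim_bwd_integral; have [] := picard_integrable n j.
apply: eq_cprim (cprim_sum n.+2 p) => x _.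
  by apply: eq_bigr => j _; rewrite mulrC.
rewrite mulrBl /picardY.
have -> : \sum_(j < n.+2) z ^+ j * (g j x)%:C =
  \sum_(j < n.+2) (q x)%:C * (((picard n).1 j x)%:C * z ^+ j) -
  \sum_(j < n.+2) z ^+ j * (if j : nat is i.+1 then (picard n).1 i x else 0)%:C.
  rewrite -sumrB; apply: eq_bigr => j _.
  by rewrite /g rmorphB rmorphM/=; ring.
congr (_ - _).
  rewrite big_ord_recr/= (picard_ge (ltnSn n)).1/= mul0r mulr0 addr0.
  by rewrite mulr_sumr.
rewrite big_ord_recl/= mulr0 add0r mulr_sumr; apply: eq_bigr => j _.
by rewrite exprS; ring.
Qed.

Lemma picard_end n z : picardY n.+1 z a = 0 /\ picardV n.+1 z a = 0.
Proof.
by split; apply: big1 => j _ /=; rewrite set_itv1 Rintegral_set1 oppr0 mul0r.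
Qed.

Lemma picard0 z x : picardY 0 z x = y0%:C /\ picardV 0 z x = v0%:C.
Proof. by rewrite /picardY /picardV !big_ord1/= expr0 !mulr1. Qed.

(** For |z| at most r it dominates both coefficients of the system, 1 and q - z, so one estimate
    serves [picardY] and [picardV]. *)
Definition weight (r : R) (x : R) : R := 1 + `|q x| + r.
Definition cweight (r x : R) : R := \int[mu]_(t in `[x, a]) weight r t.

Lemma integrable_weight r : mu.-integrable `[0, a] (EFin \o weight r).
Proof.
apply: integrable_itvD; last exact: integrable_cst_itv.
by apply: integrable_itvD; [exact: integrable_cst_itv|exact: integrable_norm].
Qed.

Lemma cweight_prim r : prim 0 a (cweight r) (fun x => - weight r x).
Proof.
apply: eq_prim (primN (prim_bwd_integral (integrable_weight r))) => x _ //=.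
by rewrite opprK.
Qed.

(** Read backwards, this integrates [weight] times the n-th power of [cweight] exactly; the
    resulting divisors n + 1 build the factorials of the Picard bound. *)
Lemma cweightX_prim r n :
  prim 0 a (fun x => cweight r x ^+ n.+1)
    (fun x => - (n.+1%:R * (weight r x * cweight r x ^+ n))).
Proof.
elim: n => [|n IH].
  apply: eq_prim (cweight_prim r) => x _; first by rewrite expr1.
  by rewrite expr0 mulr1 mul1r.
apply: eq_prim (primM a0 (cweight_prim r) IH) => x _; first by rewrite -exprS.
by rewrite -[in RHS]natr1 exprS; ring.
Qed.

Lemma cweight_end r : cweight r a = 0.
Proof. by rewrite /cweight set_itv1 Rintegral_set1. Qed.

Lemma weight_ge0 r x : 0 <= r -> 0 <= weight r x.
Proof. by move=> r0; rewrite !addr_ge0. Qed.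

Lemma cweight_ge0 r x : 0 <= r -> 0 <= cweight r x.
Proof. by move=> r0; apply: Rintegral_ge0 => t _; exact: weight_ge0. Qed.

Lemma cweight_le0 r x : 0 <= r -> 0 <= x <= a -> cweight r x <= cweight r 0.
Proof.
move=> r0 /andP[x0 xa]; rewrite -subr_ge0 -opprB.
rewrite ((cweight_prim r).2 _ _ (lexx _) x0 xa) -mulN1r -RintegralZl//.
  apply: Rintegral_ge0 => t _; rewrite mulN1r opprK; exact: weight_ge0.
exact: integrable_sub_itv (cweight_prim r).1.
Qed.

Lemma picard_step (F G : R -> C) (K r : R) n x : 0 <= r -> 0 <= K ->
  cprim 0 a F G -> F a = 0 -> 0 <= x <= a ->
  (forall t, 0 <= t <= a ->
    cnorm (G t) <= weight r t * (K * cweight r t ^+ n)) ->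
  cnorm (F x) <= 2 * K / n.+1%:R * cweight r x ^+ n.+1.
Proof.
move=> r0 K0 p Fa /andP[x0 xa] GK.
(* This is the assumed bound on [G], written as a multiple of the derivative of a power of
   [cweight]. *)
pose h t := - (K / n.+1%:R) * - (n.+1%:R * (weight r t * cweight r t ^+ n)).
have pW := cweightX_prim r n.
have ih : mu.-integrable `[0, a] (EFin \o h) by apply: integrable_itvZ; exact: pW.1.
have := cprim_norm_le p ih _ x0 xa (lexx a); rewrite Fa sub0r cnormN => H.
apply: le_trans (H _) _ => [t /andP[xt ta]|].
  have -> : h t = weight r t * (K * cweight r t ^+ n).
    have n0 : n.+1%:R != 0 :> R by rewrite pnatr_eq0.
    by rewrite /h; move: (n.+1%:R : R) n0 => c c0; field.
  by apply: GK; rewrite (le_trans x0 xt) ta.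
have ipx := integrable_sub_itv x0 (lexx a) pW.1.
rewrite RintegralZl// -(pW.2 _ _ x0 xa (lexx a)) cweight_end expr0n/= sub0r.
by rewrite mulrNN !mulrA.
Qed.

(** The factors 2 and 1/(n+1) gained at each step multiply to the general term of the exponential
    series at [2 * cweight r x]. Values and derivatives are bounded together, since each feeds the
    other. *)
Lemma picard_bound r z n x : cnorm z <= r -> 0 <= x <= a ->
  cnorm (picardY n z x) <= (`|y0| + `|v0|) * exp_coeff (2 * cweight r x) n /\
  cnorm (picardV n z x) <= (`|y0| + `|v0|) * exp_coeff (2 * cweight r x) n.
Proof.
move=> zr; have r0 := le_trans (cnorm_ge0 _) zr.
have K0 : 0 <= `|y0| + `|v0| by rewrite addr_ge0.
elim: n x => [|n IH] x xab.
  have [-> ->] := picard0 z x.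
  by rewrite !cnorm_real /exp_coeff/= expr0 fact0 divr1 mulr1 lerDl lerDr !normr_ge0.
have [e1 e2] := picard_end n z.
pose K := (`|y0| + `|v0|) * 2 ^+ n / n`!%:R.
have K'0 : 0 <= K by rewrite !mulr_ge0// ?invr_ge0// exprn_ge0.
have E t : (`|y0| + `|v0|) * exp_coeff (2 * cweight r t) n = K * cweight r t ^+ n.
  by rewrite /exp_coeff/= exprMn /K; ring.
have E1 : (`|y0| + `|v0|) * exp_coeff (2 * cweight r x) n.+1 =
    2 * K / n.+1%:R * cweight r x ^+ n.+1.
  rewrite /exp_coeff/= exprMn /K factS natrM exprS.
  have n0 : n.+1%:R != 0 :> R by rewrite pnatr_eq0.
  have f0 : n`!%:R != 0 :> R by rewrite pnatr_eq0 -lt0n fact_gt0.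
  move: (n.+1%:R : R) (n`!%:R : R) n0 f0 => c f c0 f0.
  by field; rewrite c0 f0.
rewrite E1; split.
  apply: (picard_step r0 K'0 (picardY_prim n z) e1 xab) => t tab.
  have [_] := IH t tab; rewrite E => /le_trans; apply.
  rewrite ler_peMl ?mulr_ge0 ?exprn_ge0 ?cweight_ge0//.
  by rewrite /weight -addrA lerDl addr_ge0.
apply: (picard_step r0 K'0 (picardV_prim n z) e2 xab) => t tab.
have [+ _] := IH t tab; rewrite E cnormM => h.
apply: ler_pM => //; rewrite ?cnorm_ge0//.
apply: le_trans (cnormB _ _) _; rewrite cnorm_real /weight.
by rewrite lerD// lerDr.
Qed.

End Picard.

Section Solutions.
Local Open Scope complex_scope.
Variable R : realType.
Notation C := R[i].
Notation mu := (@lebesgue_measure R).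
Variables (q : R -> R) (a : R).

Lemma cprim_lim s t (F_ G_ : nat -> R -> C) (e : nat -> R) F G (h : R -> R) :
  (forall n, cprim s t (F_ n) (G_ n)) ->
  (forall n x, s <= x <= t -> cnorm (F_ n x - F x) <= e n) ->
  mu.-integrable `[s, t] (EFin \o h) ->
  (forall n x, s <= x <= t -> cnorm (G_ n x - G x) <= e n * h x) ->
  e n @[n --> \oo] --> (0 : R) ->
  cprim s t F G.
Proof.
move=> p Fe ih Ge e0.
have H (u : nat -> R) l : (forall n, `|u n - l| <= e n) -> u n @[n --> \oo] --> l.
  move=> ul; apply/cvgrPdist_le => eps eps0.
  move/cvgrPdist_le : e0 => /(_ _ eps0); apply: filterS => n.
  rewrite sub0r normrN distrC => h1; apply: le_trans (ul n) _.
  exact: le_trans (ler_norm _) h1.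
split.
  apply: (prim_lim (fun n => (p n).1) _ ih) e0 => [x xst|n x xst].
    apply: H => n; rewrite -ReB; exact: le_trans (ler_cnorm_Re _) (Fe n x xst).
  by rewrite -ReB; exact: le_trans (ler_cnorm_Re _) (Ge n x xst).
apply: (prim_lim (fun n => (p n).2) _ ih) e0 => [x xst|n x xst].
  apply: H => n; rewrite -ImB; exact: le_trans (ler_cnorm_Im _) (Fe n x xst).
by rewrite -ImB; exact: le_trans (ler_cnorm_Im _) (Ge n x xst).
Qed.

Definition solY y0 v0 (z : C) (x : R) : C :=
  cseries (fun n => picardY q a y0 v0 n z x).

Definition solV y0 v0 (z : C) (x : R) : C :=
  cseries (fun n => picardV q a y0 v0 n z x).

Hypotheses (a0 : 0 <= a) (iq : mu.-integrable `[0, a] (EFin \o q)).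
Variables (y0 v0 : R).

Let Yn := picardY q a y0 v0.
Let Vn := picardV q a y0 v0.
Let Y := solY y0 v0.
Let V := solV y0 v0.

(** [cweight] is largest at 0, so this majorant, and with it [tail], is uniform in x on [0, a] and
    in z on the disc of radius r. *)
Let maj r n : R := (`|y0| + `|v0|) * exp_coeff (2 * cweight q a r 0) n.
Let tail r n : R := 2 * (limn (series (maj r)) - series (maj r) n).

Let cvg_maj r : cvgn (series (maj r)).
Proof. by apply: is_cvg_seriesZ; exact: is_cvg_series_exp_coeff. Qed.

Let tail_cvg0 r : tail r n @[n --> \oo] --> (0 : R).
Proof. exact: series_tail_cvg0. Qed.

Let picard_le_maj r z x n : cnorm z <= r -> 0 <= x <= a ->
  cnorm (Yn n z x) <= maj r n /\ cnorm (Vn n z x) <= maj r n.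
Proof.
move=> zr xab; have r0 := le_trans (cnorm_ge0 _) zr.
have H : (`|y0| + `|v0|) * exp_coeff (2 * cweight q a r x) n <= maj r n.
  rewrite ler_wpM2l ?addr_ge0// /exp_coeff/= ler_wpM2r ?invr_ge0//.
  apply: lerXn2r; rewrite ?nnegrE ?mulr_ge0 ?cweight_ge0//.
  by rewrite ler_wpM2l// cweight_le0.
have [h1 h2] := picard_bound y0 v0 a0 iq n zr xab.
by split; [exact: le_trans h1 H|exact: le_trans h2 H].
Qed.

Let sol_tail r z x N : cnorm z <= r -> 0 <= x <= a ->
  cnorm (Y z x - \sum_(n < N) Yn n z x) <= tail r N /\
  cnorm (V z x - \sum_(n < N) Vn n z x) <= tail r N.
Proof.
move=> zr xab; split; apply: cseries_tail => // n.
  by have [] := picard_le_maj n zr xab.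
by have [] := picard_le_maj n zr xab.
Qed.

Let tail_ge0 r N : 0 <= r -> 0 <= tail r N.
Proof.
move=> r0; have := @sol_tail r 0 0 N; rewrite cnorm0 lexx a0 => /(_ r0 isT)[+ _].
exact: le_trans (cnorm_ge0 _).
Qed.

Lemma sol_prim z : cprim 0 a (Y z) (V z) /\
  cprim 0 a (V z) (fun x => ((q x)%:C - z) * Y z x).
Proof.
pose r := cnorm z; have r0 : 0 <= r := cnorm_ge0 z.
(* Since the 0-th iterate is constant, the derivatives of the partial sums lag one term behind; [e]
   dominates both tails. *)
pose e n := tail r n.+1 + tail r n.
have e0 : e n @[n --> \oo] --> (0 : R).
  rewrite -(addr0 (0 : R)); apply: cvgD => //.
  by rewrite (cvg_shiftS (tail r)).
have eT n : tail r n.+1 <= e n by rewrite lerDl tail_ge0.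
have eT' n : tail r n <= e n by rewrite lerDr tail_ge0.
split.
  apply: (@cprim_lim _ _ (fun N x => \sum_(n < N.+1) Yn n z x)
     (fun N x => \sum_(n < N) Vn n z x) e _ _ (fun _ => 1)) => //.
  - move=> N; apply: eq_cprim (cprimD (cprim_cst 0 a y0%:C)
      (cprim_sum N (fun n => picardY_prim y0 v0 a0 iq n z))) => x _ //=.
      by rewrite big_ord_recl/= /Yn (picard0 q a y0 v0 z x).1.
    by rewrite add0r.
  - move=> N x xab; rewrite -opprB cnormN; apply: le_trans (eT N).
    by have [] := sol_tail N.+1 (lexx r) xab.
  - exact: integrable_cst_itv.
  - move=> N x xab; rewrite mulr1 -opprB cnormN; apply: le_trans (eT' N).
    by have [] := sol_tail N (lexx r) xab.
apply: (@cprim_lim _ _ (fun N x => \sum_(n < N.+1) Vn n z x)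
   (fun N x => ((q x)%:C - z) * \sum_(n < N) Yn n z x) e _ _ (weight q r)) => //.
- move=> N; apply: eq_cprim (cprimD (cprim_cst 0 a v0%:C)
    (cprim_sum N (fun n => picardV_prim y0 v0 a0 iq n z))) => x _ //=.
    by rewrite big_ord_recl/= /Vn (picard0 q a y0 v0 z x).2.
  by rewrite add0r mulr_sumr.
- move=> N x xab; rewrite -opprB cnormN; apply: le_trans (eT N).
  by have [] := sol_tail N.+1 (lexx r) xab.
- exact: integrable_weight.
- move=> N x xab; rewrite -mulrBr cnormM mulrC; apply: ler_pM; rewrite ?cnorm_ge0//.
    rewrite -opprB cnormN; apply: le_trans (eT' N).
    by have [] := sol_tail N (lexx r) xab.
  apply: le_trans (cnormB _ _) _; rewrite cnorm_real /weight.
  by rewrite lerD// lerDr.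
Qed.

Lemma sol_end z : Y z a = y0%:C /\ V z a = v0%:C.
Proof.
pose r := cnorm z; have aa : 0 <= a <= a by rewrite a0 lexx.
have H (l l' : C) (S : nat -> C) : (forall N, S N.+1 = l') ->
    (forall N, cnorm (l - S N) <= tail r N) -> l = l'.
  move=> Sl lS; apply/eqP; rewrite -subr_eq0; apply/eqP.
  apply: (@eq0_cnorm_le _ 1) => eps eps0; rewrite mulr1.
  have := tail_cvg0 r; move/cvgrPdist_le => /(_ _ eps0) [N _ /(_ N.+1 (leqnSn N))].
  rewrite sub0r normrN => h1; rewrite -(Sl N); apply: le_trans (lS N.+1) _.
  exact: le_trans (ler_norm _) h1.
split.
  apply: (H _ _ (fun N => \sum_(n < N) Yn n z a)) => N; last first.
    by have [] := sol_tail N (lexx r) aa.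
  rewrite big_ord_recl/= /Yn (picard0 q a y0 v0 z a).1 big1 ?addr0// => n _.
  by have [] := picard_end q a y0 v0 n z.
apply: (H _ _ (fun N => \sum_(n < N) Vn n z a)) => N; last first.
  by have [] := sol_tail N (lexx r) aa.
rewrite big_ord_recl/= /Vn (picard0 q a y0 v0 z a).2 big1 ?addr0// => n _.
by have [] := picard_end q a y0 v0 n z.
Qed.

(** The partial sums of the Picard series are themselves the polynomials in z that [entire] asks
    for, with [tail r] as uniform error. *)
Lemma sol_entire x : 0 <= x <= a -> entire (Y ^~ x) /\ entire (V ^~ x).
Proof.
move=> xab.
have H (h : C -> C) (c : nat -> nat -> R) :
    (forall r z N, cnorm z <= r ->
      cnorm (h z - \sum_(n < N) \sum_(j < n.+1) (c n j)%:C * z ^+ j) <= tail r N) ->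
    entire h.
  move=> hc r e r0 e0; have := tail_cvg0 r.
  move/cvgrPdist_le => /(_ _ e0) [N _ /(_ N (leqnn N))].
  rewrite sub0r normrN => h1.
  exists (\sum_(n < N) \sum_(j < n.+1) (c n j)%:C *: 'X^j) => z zr.
  have -> : (\sum_(n < N) \sum_(j < n.+1) (c n j)%:C *: 'X^j).[z] =
      \sum_(n < N) \sum_(j < n.+1) (c n j)%:C * z ^+ j.
    rewrite horner_sum; apply: eq_bigr => n _.
    by rewrite horner_sum; apply: eq_bigr => j _; rewrite hornerZ hornerXn.
  exact: le_trans (hc _ _ _ zr) (le_trans (ler_norm _) h1).
split.
  apply: (H _ (fun n j => (picard q a y0 v0 n).1 j x)) => r z N zr.
  by have [] := sol_tail N zr xab.
apply: (H _ (fun n j => (picard q a y0 v0 n).2 j x)) => r z N zr.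
by have [] := sol_tail N zr xab.
Qed.

Lemma sol_real (t x : R) : complex.Im (Y t%:C x) = 0 /\ complex.Im (V t%:C x) = 0.
Proof.
have H (c : nat -> nat -> R) :
    limn (series (fun n => complex.Im (\sum_(j < n.+1) (c n j)%:C * t%:C ^+ j))) = 0.
  rewrite (_ : series _ = cst 0) ?lim_cst//; apply/funext => N.
  rewrite /series/= big1// => n _.
  have -> : \sum_(j < n.+1) (c n j)%:C * t%:C ^+ j =
      (\sum_(j < n.+1) c n j * t ^+ j)%:C.
    by rewrite rmorph_sum; apply: eq_bigr => j _; rewrite rmorphM rmorphXn.
  by [].
by split; [exact: (H (fun n j => (picard q a y0 v0 n).1 j x))
          |exact: (H (fun n j => (picard q a y0 v0 n).2 j x))].
Qed.

End Solutions.

Section Wronskian.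
Local Open Scope complex_scope.
Variable R : realType.
Notation C := R[i].

Lemma wronskian_cst s t (g : R -> C) (y v y' v' : R -> C) : s <= t ->
  cprim s t y v -> cprim s t v (fun x => g x * y x) ->
  cprim s t y' v' -> cprim s t v' (fun x => g x * y' x) ->
  forall x x', s <= x <= t -> s <= x' <= t ->
    y x * v' x - v x * y' x = y x' * v' x' - v x' * y' x'.
Proof.
move=> st p1 p2 p1' p2'.
have p := cprimB (cprimM st p1 p2') (cprimM st p2 p1').
by apply: (cprim_eq_cst p) => x _; ring.
Qed.

End Wronskian.

(** * Estimates in the upper half-plane *)

Section Estimates.
Local Open Scope complex_scope.
Variable R : realType.
Notation C := R[i].
Notation mu := (@lebesgue_measure R).
Notation Re := (@complex.Re R).
Variables (q : R -> R) (a : R).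
Hypotheses (a0 : 0 <= a) (iq : mu.-integrable `[0, a] (EFin \o q)).

Definition absint (s t : R) : R := \int[mu]_(x in `[s, t]) `|q x|.

Let iq' : mu.-integrable `[0, a] (EFin \o (fun x => `|q x|)).
Proof. exact: integrable_norm. Qed.

Lemma absint_ge0 s t : 0 <= absint s t.
Proof. by apply: Rintegral_ge0 => x _; exact: normr_ge0. Qed.

Lemma absint_le s t : 0 <= s -> s <= t -> t <= a -> absint s t <= absint 0 a.
Proof.
move=> s0 st ta; have i0t := integrable_sub_itv (lexx 0) ta iq'.
rewrite /absint (@Rintegral_split _ 0 a t) ?(le_trans s0 st)//.
rewrite (@Rintegral_split _ 0 t s)//.
have := absint_ge0 0 s; have := absint_ge0 t a; rewrite /absint; lra.
Qed.

Lemma cprim_absint_le (F G : R -> C) (B : R) s t : cprim 0 a F G ->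
  (forall x, s <= x <= t -> cnorm (G x) <= B * `|q x|) ->
  0 <= s -> s <= t -> t <= a -> cnorm (F t - F s) <= 2 * B * absint s t.
Proof.
move=> p GB s0 st ta.
have := cprim_norm_le p (integrable_itvZ B iq') GB s0 st ta.
have ist := integrable_sub_itv s0 ta iq'.
by rewrite RintegralZl// mulrA.
Qed.

(** The base point [b] may lie on either side of [x]: it will be [a] for the Jost solution and 0 for
    the reversed one. *)
Lemma cprim_between_le (F G : R -> C) (B : R) x b : cprim 0 a F G -> 0 <= B ->
  0 <= x <= a -> 0 <= b <= a ->
  (forall t, Num.min x b <= t <= Num.max x b -> cnorm (G t) <= B * `|q t|) ->
  cnorm (F x - F b) <= 2 * B * absint 0 a.
Proof.
move=> p B0 /andP[x0 xa] /andP[b0 ba].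
have B20 : 0 <= 2 * B by rewrite mulr_ge0.
have [xb|/ltW bx] := leP x b => GB.
  rewrite -opprB cnormN; apply: le_trans (cprim_absint_le p GB x0 xb ba) _.
  by rewrite ler_wpM2l// absint_le.
apply: le_trans (cprim_absint_le p GB b0 bx xa) _.
by rewrite ler_wpM2l// absint_le.
Qed.

Section Solution.
Variables (y v : R -> C) (z l : C).
Hypotheses (lz : l ^+ 2 = - z) (py : cprim 0 a y v)
  (pv : cprim 0 a v (fun x => ((q x)%:C - z) * y x)).

(* u = m', and u + 2 l m and e^{2 l x} u have derivatives q m, e^{2 l x} q m. *)
Let m x := cexp (- l) x * y x.
Let u x := cexp (- l) x * (v x - l * y x).

Let pm : cprim 0 a m u.
Proof.
apply: eq_cprim (cprimM a0 (cprim_cexp (- l) a0) py) => x _ //.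
by rewrite /u; ring.
Qed.

Let pU : cprim 0 a (fun x => cexp (2 * l) x * u x)
  (fun x => cexp (2 * l) x * ((q x)%:C * m x)).
Proof.
have pe := cprim_cexp (2 * l) a0.
have pu := cprimM a0 (cprim_cexp (- l) a0) (cprimB pv (cprimZ l py)).
apply: eq_cprim (cprimM a0 pe pu) => x _ //.
have -> : z = - l ^+ 2 by rewrite lz opprK.
by rewrite /m; ring.
Qed.

Let pL : cprim 0 a (fun x => u x + 2 * l * m x) (fun x => (q x)%:C * m x).
Proof.
have pu := cprimM a0 (cprim_cexp (- l) a0) (cprimB pv (cprimZ l py)).
apply: eq_cprim (cprimD pu (cprimZ (2 * l) pm)) => x _ //.
have -> : z = - l ^+ 2 by rewrite lz opprK.
by rewrite /m /u; ring.
Qed.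

(** Base point where m = 1 and u = 0. The condition [dir] gives |e^{2l(t-x)}| at most 1 for t
    between x and b. The Jost solution has l = ik and b = a; the reversed solution has l = -ik and b
    = 0. *)
Variable b : R.
Hypotheses (b0a : 0 <= b <= a)
  (dir : forall x, 0 <= x <= a -> Re l * (b - x) <= 0)
  (yb : cexp (- l) b * y b = 1) (vb : v b = l * y b) (l0 : l != 0)
  (lQ : 4 * absint 0 a <= cnorm l).

Let ub : u b = 0.
Proof. by rewrite /u vb subrr mulr0. Qed.

Let mem_between x t : 0 <= x <= a -> Num.min x b <= t <= Num.max x b ->
  0 <= t <= a /\ Re l * (t - x) <= 0.
Proof.
move=> xa; have := dir xa; move/andP: xa => [x0 xa].
have /andP[b0 ba] := b0a.
have [xb|bx] := leP x b => d /andP[t1 t2].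
  split; first by rewrite (le_trans x0 t1) (le_trans t2 ba).
  have [xb'|xb'] := ltP x b; last first.
    have -> : t = x by apply: le_anti; rewrite t1 (le_trans t2 xb').
    by rewrite subrr mulr0.
  have : Re l <= 0 by rewrite -(pmulr_lle0 _ (_ : 0 < b - x)) ?subr_gt0.
  by move=> h; rewrite mulr_le0_ge0// subr_ge0.
split; first by rewrite (le_trans b0 t1) (le_trans t2 xa).
have : 0 <= Re l by rewrite -(nmulr_lle0 _ (_ : b - x < 0)) ?subr_lt0.
by move=> h; rewrite mulr_ge0_le0// subr_le0.
Qed.

(** In effect u(x) is the integral from b to x of e^{2l(t-x)} q m, and the exponential has modulus
    at most 1 by [dir]. *)
Let bound_u M : 0 <= M -> (forall x, 0 <= x <= a -> cnorm (m x) <= M) ->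
  forall x, 0 <= x <= a -> cnorm (u x) <= 2 * M * absint 0 a.
Proof.
move=> M0 mM x xa.
have e0 : 0 < expR (Re (2 * l) * x) by exact: expR_gt0.
have := @cprim_between_le _ _ (expR (Re (2 * l) * x) * M) x b pU _ xa b0a _.
rewrite ub mulr0 subr0 cnormM cnorm_cexp => H.
have -> : 2 * M * absint 0 a =
    (expR (Re (2 * l) * x))^-1 * (2 * (expR (Re (2 * l) * x) * M) * absint 0 a).
  by field; rewrite gt_eqF.
rewrite ler_pdivlMl//; apply: H.
  by rewrite mulr_ge0// ltW.
move=> t txb; have [ta d] := mem_between xa txb.
rewrite cnormM cnorm_cexp cnormM cnorm_real mulrA mulrAC.
apply: ler_wpM2r => //; apply: ler_pM => //.
- exact: cnorm_ge0.
- rewrite ler_expR -subr_ge0; have -> : Re (2 * l) = 2 * Re l.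
    by rewrite !mulr_natl !mulr2n ReD.
  have -> : 2 * Re l * x - 2 * Re l * t = - (2 * (Re l * (t - x))) by ring.
  by rewrite oppr_ge0 pmulr_rle0.
- exact: mM.
Qed.

(** u + 2lm equals 2l at b and has derivative q m, so 2l(m - 1) is an integral of q m minus u;
    dividing by 2|l| produces the decay. *)
Let bound_m M : 0 <= M -> (forall x, 0 <= x <= a -> cnorm (m x) <= M) ->
  forall x, 0 <= x <= a -> cnorm (m x - 1) <= 2 * M * absint 0 a / cnorm l.
Proof.
move=> M0 mM x xa.
have lp := cnorm_gt0 l0.
have h1 := bound_u M0 mM xa.
have := @cprim_between_le _ _ M x b pL M0 xa b0a _.
rewrite ub add0r [m b]yb => H.
have {H}h2 : cnorm (u x + 2 * l * m x - 2 * l * 1) <= 2 * M * absint 0 a.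
  apply: H => t txb; have [ta _] := mem_between xa txb.
  by rewrite cnormM cnorm_real mulrC ler_wpM2r// mM.
have : cnorm (2 * l * (m x - 1)) <= 2 * (2 * M * absint 0 a).
  have -> : 2 * l * (m x - 1) = u x + 2 * l * m x - 2 * l * 1 - u x by ring.
  by apply: le_trans (cnormB _ _) _; lra.
rewrite !cnormM cnorm_nat -mulrA ler_pM2l// => h3.
by rewrite ler_pdivlMr// mulrC.
Qed.

(** Bootstrap from the bound [M] given by continuity: as 4 [absint 0 a] is at most |l|, each use of
    [bound_m] replaces a bound s by 1 + s/2. The fixed point is 2, and the excess over it is halved
    each time. *)
Let bound_m2 x : 0 <= x <= a -> cnorm (m x) <= 2.
Proof.
have [M M0 mM] := cprim_bounded a0 pm.
have lp := cnorm_gt0 l0.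
have H n : forall x, 0 <= x <= a -> cnorm (m x) <= 2 + M / 2 ^+ n.
  elim: n => [|n IH] t ta.
    by rewrite expr0 divr1; apply: le_trans (mM _ ta) _; lra.
  have p0 : 0 <= 2 + M / 2 ^+ n by rewrite addr_ge0// divr_ge0// exprn_ge0.
  have h := bound_m p0 IH ta.
  have -> : m t = (m t - 1) + 1 by ring.
  apply: le_trans (cnormD _ _) _; rewrite cnorm1.
  have -> : 2 + M / 2 ^+ n.+1 = 2^-1 * (2 + M / 2 ^+ n) + 1.
    by rewrite exprS; field; rewrite expf_neq0.
  rewrite lerD2r; apply: le_trans h _.
  have -> : 2 * (2 + M / 2 ^+ n) * absint 0 a / cnorm l =
     (2 * absint 0 a / cnorm l) * (2 + M / 2 ^+ n) by ring.
  rewrite ler_wpM2r// ler_pdivrMr// -subr_ge0.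
  have -> : 2^-1 * cnorm l - 2 * absint 0 a = 2^-1 * (cnorm l - 4 * absint 0 a).
    by field.
  by rewrite mulr_ge0// subr_ge0.
move=> xa; have x2 : cnorm (m x) - 2 <= 0.
  rewrite leNgt; apply/negP => h.
  suff : cnorm (m x) - 2 = 0 by move=> e; rewrite e ltxx in h.
  apply: (@eq0_le_inv _ _ M) => n; rewrite gtr0_norm//.
  by have := H n _ xa; lra.
by lra.
Qed.

Lemma jost_estimate x : 0 <= x <= a ->
  cnorm (cexp (- l) x * y x - 1) <= 4 * absint 0 a / cnorm l /\
  cnorm (cexp (- l) x * (v x - l * y x)) <= 4 * absint 0 a.
Proof.
move=> xa; split.
  by have := bound_m (ler0n _ 2) bound_m2 xa; rewrite (_ : 2 * 2 = 4)//; ring.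
by have := bound_u (ler0n _ 2) bound_m2 xa; rewrite (_ : 2 * 2 = 4)//; ring.
Qed.

(** The left side is u(0). Beyond d the exponential damps the contribution, and before d there is
    only the mass of q on [0, d]; a suitable d improves O(1) to o(1), as in the Riemann-Lebesgue
    lemma. *)
Lemma jost_estimate_split d : 0 <= d <= a ->
  (forall x, 0 <= x <= a -> expR (Re (2 * l) * x) <= 1) ->
  cnorm (v 0 - l * y 0) <=
    expR (Re (2 * l) * d) * (4 * absint 0 a) + 4 * absint 0 d.
Proof.
move=> da e1; have /andP[d0 d1] := da.
have h1 : cnorm (cexp (2 * l) d * u d - cexp (2 * l) 0 * u 0) <= 2 * 2 * absint 0 d.
  apply: (cprim_absint_le pU) => // x /andP[x0 xd].
  have xa : 0 <= x <= a by rewrite x0 (le_trans xd d1).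
  rewrite cnormM cnorm_cexp cnormM cnorm_real mulrA mulrAC ler_wpM2r//.
  by rewrite -[leRHS]mul1r; apply: ler_pM; rewrite ?expR_ge0 ?cnorm_ge0 ?e1 ?bound_m2.
have h2 : cnorm (cexp (2 * l) d * u d) <= expR (Re (2 * l) * d) * (4 * absint 0 a).
  rewrite cnormM cnorm_cexp ler_wpM2l ?expR_ge0//.
  by have [] := jost_estimate da.
have -> : v 0 - l * y 0 = cexp (2 * l) d * u d -
    (cexp (2 * l) d * u d - cexp (2 * l) 0 * u 0).
  by rewrite /u !cexp0; ring.
apply: le_trans (cnormB _ _) _; lra.
Qed.

End Solution.

Lemma absint_small (e : R) : 0 < a -> 0 < e ->
  exists2 d, 0 < d <= a & absint 0 d <= e.
Proof.
move=> a00 e0.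
have := prim_continuous a0 (prim_integral iq').
move/(continuous_within_itvP _ a00) => [_ + _].
rewrite set_itv1 Rintegral_set1 => /cvgrPdist_le /(_ _ e0) H.
near (0 : R)^'+ => d; exists d; last first.
  apply: le_trans (ler_norm _) _; rewrite -normrN -sub0r.
  by near: d; exact: H.
by apply/andP; split; near: d; [exact: nbhs_right_gt|exact: nbhs_right_le].
Unshelve. all: by end_near. Qed.

End Estimates.

(** * Liouville's theorem with bounds in the upper half-plane of k *)

Section UpperHalfPlane.
Local Open Scope complex_scope.
Variable R : realType.
Notation C := R[i].
Implicit Types (h : C -> C) (k z : C).

Lemma sqrt_upper z : exists2 k, k ^+ 2 = z & 0 <= complex.Im k.
Proof.
have e := sqr_sqrtc z.
have [h|h] := leP 0 (complex.Im (sqrtc z)); first by exists (sqrtc z).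
exists (- sqrtc z); first by rewrite sqrrN.
by move: h; case: (sqrtc z) => b c /= /ltW; rewrite oppr_ge0.
Qed.

(** Every z is the square of some k with nonnegative imaginary part, so a function of z = k^2 need
    only be bounded where the Jost estimates hold. *)
Lemma liouville_upper h (r0 M : R) : entire h ->
  (forall k, 0 <= complex.Im k -> r0 <= cnorm k -> cnorm (h (k ^+ 2)) <= M) ->
  forall z, h z = h 0.
Proof.
move=> eh hM; apply: (@liouville _ h (r0 ^+ 2) M eh) => z r0z.
have [k kz k0] := sqrt_upper z; rewrite -kz; apply: hM => //.
rewrite leNgt; apply/negP => kr.
have := cnorm_ge0 k => k1.
have : cnorm z < r0 ^+ 2 by rewrite -kz cnormX ltrXn2r// (le_trans k1 (ltW kr)).
by rewrite ltNge r0z.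
Qed.

(** The function is constant, and its value is seen to be 0 at k = it with t large. *)
Lemma liouville_decay h (r0 M : R) : entire h ->
  (forall k, 0 <= complex.Im k -> r0 <= cnorm k ->
    cnorm (h (k ^+ 2)) <= M / cnorm k) ->
  forall z, h z = 0.
Proof.
move=> eh hM.
have h0 z : h z = h 0.
  apply: (@liouville_upper h (Num.max r0 1) `|M| eh) => k k0.
  rewrite ge_max => /andP[rk k1]; apply: le_trans (hM _ k0 rk) _.
  have kp : 0 < cnorm k by exact: lt_le_trans k1.
  rewrite ler_pdivrMr//; apply: le_trans (ler_norm _) _.
  by rewrite ler_peMr.
move=> z; rewrite h0; apply: (@eq0_cnorm_le _ 1) => e e0; rewrite mulr1.
pose t := Num.max `|r0| (`|M| / e + 1).
have t0 : 0 < t.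
  by rewrite lt_max; apply/orP; right; rewrite ltr_wpDl// divr_ge0// ltW.
have nt : cnorm ('i * t%:C) = t by rewrite cnormM cnorm_i mul1r cnorm_real gtr0_norm.
have := hM ('i * t%:C); rewrite h0 nt ImM/= mul0r mul1r add0r => /(_ (ltW t0)) H.
apply: le_trans (H _) _.
  by rewrite le_max ler_norm.
rewrite ler_pdivrMr//; apply: le_trans (ler_norm _) _.
have : `|M| / e <= t by rewrite le_max; apply/orP; right; rewrite lerDl.
by rewrite ler_pdivrMr// mulrC.
Qed.

Lemma le_of_mul_half (x y c : R) : 0 <= x -> x * y <= c -> 1 / 2 <= y -> x <= 2 * c.
Proof.
move=> x0 xy y2; have : x * (1 / 2) <= x * y by rewrite ler_wpM2l.
lra.
Qed.

End UpperHalfPlane.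

(** * The fundamental system, the Jost solution and the reversed solution *)

Section Fundamental.
Local Open Scope complex_scope.
Variable R : realType.
Notation C := R[i].
Notation mu := (@lebesgue_measure R).
Variables (q : R -> R) (a : R).

Definition phi := solY q a 1 0.
Definition dphi := solV q a 1 0.
Definition psi := solY q a 0 1.
Definition dpsi := solV q a 0 1.

Hypotheses (a0 : 0 < a) (iq : mu.-integrable `[0, a] (EFin \o q)).

Let a0' := ltW a0.

Lemma phi_prim z : cprim 0 a (phi z) (dphi z) /\
  cprim 0 a (dphi z) (fun x => ((q x)%:C - z) * phi z x).
Proof. exact: sol_prim. Qed.

Lemma psi_prim z : cprim 0 a (psi z) (dpsi z) /\
  cprim 0 a (dpsi z) (fun x => ((q x)%:C - z) * psi z x).
Proof. exact: sol_prim. Qed.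

Lemma phi_end z : phi z a = 1 /\ dphi z a = 0.
Proof. exact: sol_end. Qed.

Lemma psi_end z : psi z a = 0 /\ dpsi z a = 1.
Proof. exact: sol_end. Qed.

Lemma fundamental_entire x : 0 <= x <= a ->
  entire (phi ^~ x) /\ entire (dphi ^~ x) /\
  entire (psi ^~ x) /\ entire (dpsi ^~ x).
Proof.
move=> xa; have [h1 h2] := sol_entire a0' iq 1 0 xa.
have [h3 h4] := sol_entire a0' iq 0 1 xa.
exact: (conj h1 (conj h2 (conj h3 h4))).
Qed.

Lemma fundamental_real (t x : R) :
  (complex.Im (phi t%:C x) = 0 /\ complex.Im (dphi t%:C x) = 0) /\
  (complex.Im (psi t%:C x) = 0 /\ complex.Im (dpsi t%:C x) = 0).
Proof. by split; exact: sol_real. Qed.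

(* Failed unifications would otherwise unfold the series behind phi and psi. *)
Opaque phi dphi psi dpsi.

Definition jostF (k : C) (x : R) : C := phi (k ^+ 2) x + 'i * k * psi (k ^+ 2) x.
Definition jostG (k : C) (x : R) : C := dphi (k ^+ 2) x + 'i * k * dpsi (k ^+ 2) x.

(* The solution with reversed data (1, - i k) at the endpoint 0. *)
Definition revF (k : C) (x : R) : C :=
  (dpsi (k ^+ 2) 0 + 'i * k * psi (k ^+ 2) 0) * phi (k ^+ 2) x -
  (dphi (k ^+ 2) 0 + 'i * k * phi (k ^+ 2) 0) * psi (k ^+ 2) x.
Definition revG (k : C) (x : R) : C :=
  (dpsi (k ^+ 2) 0 + 'i * k * psi (k ^+ 2) 0) * dphi (k ^+ 2) x -
  (dphi (k ^+ 2) 0 + 'i * k * phi (k ^+ 2) 0) * dpsi (k ^+ 2) x.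

Lemma fundamental_det z x : 0 <= x <= a ->
  phi z x * dpsi z x - dphi z x * psi z x = 1.
Proof.
move=> xa.
have [p1 p1'] := phi_prim z; have [p2 p2'] := psi_prim z.
have aa : 0 <= a <= a by rewrite a0' lexx.
rewrite (wronskian_cst a0' p1 p1' p2 p2' xa aa).
have [-> ->] := phi_end z; have [-> ->] := psi_end z.
by rewrite mulr1 mul0r subr0.
Qed.

Lemma lincomb_prim z (c d : C) :
  cprim 0 a (fun x => c * phi z x + d * psi z x)
            (fun x => c * dphi z x + d * dpsi z x) /\
  cprim 0 a (fun x => c * dphi z x + d * dpsi z x)
            (fun x => ((q x)%:C - z) * (c * phi z x + d * psi z x)).
Proof.
have [p1 p1'] := phi_prim z; have [p2 p2'] := psi_prim z.
split; first exact: (cprimD (cprimZ c p1) (cprimZ d p2)).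
apply: eq_cprim (cprimD (cprimZ c p1') (cprimZ d p2')) => x _ //.
by rewrite mulrDr !(mulrCA (_ - z)).
Qed.

Section Upper.
Variable k : C.
(** The factor 8 makes 4 [absint q 0 a] / |k| at most 1/2, which keeps the normalised Jost solution
    away from 0 and allows division by it. *)
Hypotheses (k0 : 0 <= complex.Im k) (k1 : 1 <= cnorm k)
  (kQ : 8 * absint q 0 a <= cnorm k).

Let l : C := 'i * k.

Let l2 : l ^+ 2 = - k ^+ 2.
Proof. by rewrite exprMn sqr_i mulN1r. Qed.

Let nl : cnorm l = cnorm k.
Proof. by rewrite cnormM cnorm_i mul1r. Qed.

Let l0 : l != 0.
Proof.
apply/eqP => l0; move: k1; rewrite -nl l0 cnorm0 => h.
by have := lt_le_trans ltr01 h; rewrite ltxx.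
Qed.

Let Q0 : 0 <= absint q 0 a := absint_ge0 q 0 a.

Let lQ : 4 * absint q 0 a <= cnorm l.
Proof. by rewrite nl; apply: le_trans kQ; rewrite ler_wpM2r// ler_nat. Qed.

Let Rel : complex.Re l = - complex.Im k.
Proof. by rewrite ReM/= mul0r mul1r sub0r. Qed.

Let ratio : 4 * absint q 0 a / cnorm l <= 1 / 2.
Proof.
rewrite ler_pdivrMr ?cnorm_gt0// nl -(ler_pM2l (ltr0n R 2)) mulrA -natrM.
by rewrite div1r mulVKf ?pnatr_eq0.
Qed.

Let pF : cprim 0 a (fun x => cexp l a * jostF k x) (fun x => cexp l a * jostG k x) /\
  cprim 0 a (fun x => cexp l a * jostG k x)
    (fun x => ((q x)%:C - k ^+ 2) * (cexp l a * jostF k x)).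
Proof.
have [p1 p2] := lincomb_prim (k ^+ 2) (cexp l a) (cexp l a * l).
have eF x : cexp l a * jostF k x =
    cexp l a * phi (k ^+ 2) x + cexp l a * l * psi (k ^+ 2) x.
  by rewrite /jostF mulrDr mulrA.
have eG x : cexp l a * jostG k x =
    cexp l a * dphi (k ^+ 2) x + cexp l a * l * dpsi (k ^+ 2) x.
  by rewrite /jostG mulrDr mulrA.
split.
  by apply: eq_cprim p1 => x _; [rewrite eF|rewrite eG].
by apply: eq_cprim p2 => x _; [rewrite eG|rewrite eF].
Qed.

Let end_F : jostF k a = 1 /\ jostG k a = l.
Proof.
rewrite /jostF /jostG.
have [-> ->] := phi_end (k ^+ 2); have [-> ->] := psi_end (k ^+ 2).
by rewrite mulr0 addr0 mulr1 add0r.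
Qed.

Let dirF x : 0 <= x <= a -> complex.Re l * (a - x) <= 0.
Proof.
by move=> /andP[_ xa]; rewrite Rel mulNr oppr_le0 mulr_ge0// subr_ge0.
Qed.

Let aa : 0 <= a <= a. Proof. by rewrite a0' lexx. Qed.

Let baseF : cexp (- l) a * (cexp l a * jostF k a) = 1.
Proof. by rewrite end_F.1 mulr1 cexpN. Qed.

Let baseG : cexp l a * jostG k a = l * (cexp l a * jostF k a).
Proof. by rewrite end_F.1 end_F.2 mulr1 mulrC. Qed.

Lemma jostF_estimate x : 0 <= x <= a ->
  cnorm (cexp (- l) x * cexp l a * jostF k x - 1) <= 4 * absint q 0 a / cnorm k /\
  cnorm (cexp (- l) x * cexp l a * (jostG k x - l * jostF k x)) <=
    4 * absint q 0 a.
Proof.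
move=> xa.
have := jost_estimate a0' iq l2 pF.1 pF.2 aa dirF baseF baseG l0 lQ xa.
rewrite nl -!mulrA => -[h1 h2]; split => //.
by move: h2; congr (cnorm _ <= _); ring.
Qed.

Lemma jostF_split d : 0 <= d <= a ->
  cnorm (cexp l a * (jostG k 0 - l * jostF k 0)) <=
    expR (- 2 * complex.Im k * d) * (4 * absint q 0 a) + 4 * absint q 0 d.
Proof.
move=> da.
have Re2 : complex.Re (2 * l) = - 2 * complex.Im k.
  by rewrite mulr_natl mulr2n ReD Rel; ring.
have := jost_estimate_split a0' iq l2 pF.1 pF.2 aa dirF baseF baseG l0 lQ da.
rewrite Re2; have -> : cexp l a * jostG k 0 - l * (cexp l a * jostF k 0) =
  cexp l a * (jostG k 0 - l * jostF k 0) by ring.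
apply => x /andP[x0 _]; rewrite -expR0 ler_expR -mulrA mulNr oppr_le0.
by rewrite !mulr_ge0.
Qed.

Lemma jostF_near1 x : 0 <= x <= a ->
  1 / 2 <= cnorm (cexp (- l) x * cexp l a * jostF k x) <= 2.
Proof.
move=> /jostF_estimate[+ _]; rewrite -nl => /le_trans /(_ ratio).
move: (_ * jostF k x) => m h.
have := cnormD (m - 1) 1; have := cnormD m (1 - m).
rewrite subrK addrC subrK cnorm1 -(opprB m) cnormN.
move: (cnorm m) (cnorm (m - 1)) h => u w h h1 h2.
by apply/andP; split; lra.
Qed.

(** The general estimate with -l and base point 0. The unit Wronskian at 0 shows that [revF] and
    [revG] start there with 1 and -l. *)
Lemma revF_bound x : 0 <= x <= a -> cnorm (cexp l x * revF k x) <= 2.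
Proof.
move=> xa.
set c : C := dpsi (k ^+ 2) 0 + 'i * k * psi (k ^+ 2) 0.
set d : C := - (dphi (k ^+ 2) 0 + 'i * k * phi (k ^+ 2) 0).
have [p1 p2] := lincomb_prim (k ^+ 2) c d.
have e1 : (fun x => c * phi (k ^+ 2) x + d * psi (k ^+ 2) x) = revF k.
  by apply/funext => t; rewrite /revF /d mulNr.
have e2 : (fun x => c * dphi (k ^+ 2) x + d * dpsi (k ^+ 2) x) = revG k.
  by apply/funext => t; rewrite /revG /d mulNr.
rewrite e1 e2 in p1; rewrite e2 in p2.
have {}p2 : cprim 0 a (revG k) (fun x => ((q x)%:C - k ^+ 2) * revF k x).
  by apply: eq_cprim p2 => t _ //; rewrite -e1.
have aa0 : 0 <= (0 : R) <= a by rewrite a0' lexx.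
have det := fundamental_det (k ^+ 2) aa0.
have r0 : revF k 0 = 1 by rewrite /revF -det; ring.
have r1 : revG k 0 = - l.
  by rewrite /revG /l -[RHS]mulr1 -det; ring.
have nl2 : (- l) ^+ 2 = - k ^+ 2 by rewrite sqrrN.
have dirR t : 0 <= t <= a -> complex.Re (- l) * (0 - t) <= 0.
  move=> /andP[t0 _]; have -> : complex.Re (- l) = complex.Im k.
    by rewrite -sub0r ReB Rel/= sub0r opprK.
  by rewrite sub0r mulrN oppr_le0 mulr_ge0.
have baseR : cexp (- - l) 0 * revF k 0 = 1 by rewrite cexp0 r0 mulr1.
have baseR' : revG k 0 = - l * revF k 0 by rewrite r0 r1 mulr1.
have nl0 : - l != 0 by rewrite oppr_eq0.
have nlQ : 4 * absint q 0 a <= cnorm (- l) by rewrite cnormN.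
have := jost_estimate a0' iq nl2 p1 p2 aa0 dirR baseR baseR' nl0 nlQ xa.
rewrite opprK cnormN => -[/le_trans /(_ ratio) h _].
have := cnormD (cexp l x * revF k x - 1) 1.
by rewrite subrK cnorm1; lra.
Qed.

(** Up to sign, [jostG] + l [jostF] at 0 is the Wronskian of the Jost and the reversed solution. It
    differs by 2l [jostF], of normalised size at least |k|, from a term of size at most 4
    [absint q 0 a], hence at most |k|/2. *)
Lemma jost_wronskian_lower :
  cnorm k / 2 <= cnorm (cexp l a * (jostG k 0 + l * jostF k 0)).
Proof.
have aa0 : 0 <= (0 : R) <= a by rewrite a0' lexx.
have [_] := jostF_estimate aa0; have /andP[+ _] := jostF_near1 aa0.
rewrite cexp0 (mul1r (cexp l a)) => h1 h2.
have := cnormB (cexp l a * (jostG k 0 + l * jostF k 0))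
  (cexp l a * (jostG k 0 - l * jostF k 0)).
have -> : cexp l a * (jostG k 0 + l * jostF k 0) -
  cexp l a * (jostG k 0 - l * jostF k 0) = 2 * l * (cexp l a * jostF k 0) by ring.
rewrite [cnorm (_ * (_ * jostF _ _))]cnormM [cnorm (2 * l)]cnormM cnorm_nat nl.
have : cnorm k * (1 / 2) <= cnorm k * cnorm (cexp l a * jostF k 0).
  by rewrite ler_wpM2l ?cnorm_ge0.
have := kQ; rewrite -[2 * _ * _]mulrA; move: h2; move: (cnorm _) (cnorm _) => u w; lra.
Qed.

(** [jostG] is l [jostF], of normalised size at least |k|/2, up to an error 4 [absint q 0 a]; the
    factor 16 makes this error at most |k|/4. *)
Lemma jostG_lower :
  16 * absint q 0 a <= cnorm k -> cnorm k / 4 <= cnorm (cexp l a * jostG k 0).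
Proof.
move=> k16.
have aa0 : 0 <= (0 : R) <= a by rewrite a0' lexx.
have [_] := jostF_estimate aa0; have /andP[+ _] := jostF_near1 aa0.
rewrite cexp0 (mul1r (cexp l a)) => h1 h2.
have := cnormB (cexp l a * jostG k 0) (cexp l a * (jostG k 0 - l * jostF k 0)).
have -> : cexp l a * jostG k 0 - cexp l a * (jostG k 0 - l * jostF k 0) =
  l * (cexp l a * jostF k 0) by ring.
rewrite [cnorm (l * _)]cnormM nl.
have : cnorm k * (1 / 2) <= cnorm k * cnorm (cexp l a * jostF k 0).
  by rewrite ler_wpM2l ?cnorm_ge0.
by lra.
Qed.

End Upper.

Lemma jostF_derivative_decay e : 0 < e -> exists K : R, forall t, K <= t ->
  1 <= t -> 8 * absint q 0 a <= t ->
  cnorm (cexp ('i * ('i * t%:C)) a * (jostG ('i * t%:C) 0 -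
     'i * ('i * t%:C) * jostF ('i * t%:C) 0)) <= 5 * e.
Proof.
move=> e0; have [d /andP[d0 da] dQ] := absint_small a0' iq a0 e0.
have Q0 := absint_ge0 q 0 a.
(* Bounding e^{-2td} by 1/(2td), the damped term is at most e exactly when t reaches this value. The
   short interval contributes 4e, whence 5e. *)
exists (2 * absint q 0 a / (d * e)) => t Kt t1 tQ.
have t0 : 0 < t by exact: lt_le_trans t1.
have nt : cnorm ('i * t%:C : C) = t.
  by rewrite cnormM cnorm_i mul1r cnorm_real gtr0_norm.
have it : complex.Im ('i * t%:C : C) = t.
  by rewrite ImM/= mul0r mul1r add0r.
have dd : 0 <= d <= a by rewrite ltW.
have := @jostF_split ('i * t%:C); rewrite nt it => /(_ (ltW t0) t1 tQ d dd).
move/le_trans; apply; have -> : 5 * e = e + 4 * e by ring.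
apply: lerD; last by rewrite ler_pM2l.
have X0 : 0 < 2 * t * d by rewrite !mulr_gt0.
apply: (@le_trans _ _ ((2 * t * d)^-1 * (4 * absint q 0 a))).
  rewrite ler_wpM2r ?mulr_ge0// -mulrA mulNr mulrA expRN lef_pV2 ?posrE ?expR_gt0//.
  by apply: le_trans (expR_ge1Dx _); rewrite lerDr.
rewrite mulrC ler_pdivrMr//.
by move: Kt; rewrite ler_pdivrMr ?mulr_gt0//; lra.
Qed.

End Fundamental.

(** * Uniqueness from entire data *)

Section WronskianAlgebra.
Variable A : comNzRingType.
Implicit Types p s dp ds w h c e : A.

(** Cramer's rule: a vector parallel to (p, s) is a multiple of it, and the unit determinant gives
    the multiplier as a polynomial in the entries. The multiplier is thus entire when the entries
    are. *)
Lemma wronskian_quotient p s dp ds p' s' :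
  p * ds - dp * s = 1 -> p * s' = s * p' ->
  p' = (p' * ds - dp * s') * p /\ s' = (p' * ds - dp * s') * s.
Proof.
move=> /eqP + /eqP; rewrite -subr_eq0 -[_ == s * _]subr_eq0 => /eqP e1 /eqP e2.
split; apply/eqP; rewrite -subr_eq0; apply/eqP.
  transitivity (- p' * (p * ds - dp * s - 1) + dp * (p * s' - s * p')); first ring.
  by rewrite e1 e2 !mulr0 addr0.
transitivity (- s' * (p * ds - dp * s - 1) + ds * (p * s' - s * p')); first ring.
by rewrite e1 e2 !mulr0 addr0.
Qed.

(** Subtracting the two determinant identities shows that (dp - dp', ds - ds') is parallel to (p,
    s); Cramer's rule again gives a division-free multiplier. *)
Lemma wronskian_sub_derivative p s dp ds dp' ds' :
  p * ds - dp * s = 1 -> p * ds' - dp' * s = 1 ->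
  dp - dp' = ((dp - dp') * ds - dp * (ds - ds')) * p /\
  ds - ds' = ((dp - dp') * ds - dp * (ds - ds')) * s.
Proof.
move=> /eqP + /eqP; rewrite -subr_eq0 -[X in _ -> is_true X -> _]subr_eq0.
move=> /eqP e1 /eqP e2; split; apply/eqP; rewrite -subr_eq0; apply/eqP.
  transitivity (- (dp - dp') * (p * ds - dp * s - 1) +
    dp * ((p * ds - dp * s - 1) - (p * ds' - dp' * s - 1))); first ring.
  by rewrite e1 e2 subr0 !mulr0 addr0.
transitivity (- (ds - ds') * (p * ds - dp * s - 1) +
  ds * ((p * ds - dp * s - 1) - (p * ds' - dp' * s - 1))); first ring.
by rewrite e1 e2 subr0 !mulr0 addr0.
Qed.

(** The same with the roles exchanged: (p - p', s - s') is parallel to (dp, ds). *)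
Lemma wronskian_sub_value p s dp ds p' s' :
  p * ds - dp * s = 1 -> p' * ds - dp * s' = 1 ->
  p - p' = (p * (s - s') - (p - p') * s) * dp /\
  s - s' = (p * (s - s') - (p - p') * s) * ds.
Proof.
move=> /eqP + /eqP; rewrite -subr_eq0 -[X in _ -> is_true X -> _]subr_eq0.
move=> /eqP e1 /eqP e2; split; apply/eqP; rewrite -subr_eq0; apply/eqP.
  transitivity (- (p - p') * (p * ds - dp * s - 1) +
    p * ((p * ds - dp * s - 1) - (p' * ds - dp * s' - 1))); first ring.
  by rewrite e1 e2 subr0 !mulr0 addr0.
transitivity (- (s - s') * (p * ds - dp * s - 1) +
  s * ((p * ds - dp * s - 1) - (p' * ds - dp * s' - 1))); first ring.
by rewrite e1 e2 subr0 !mulr0 addr0.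
Qed.

Lemma lincomb_proportional p s p' s' h w : p' = h * p -> s' = h * s ->
  p' + w * s' = h * (p + w * s).
Proof. by move=> -> ->; ring. Qed.

Lemma lincomb_sub p s u v u' v' h w : u - u' = h * p -> v - v' = h * s ->
  (u + w * v) - (u' + w * v') = h * (p + w * s).
Proof.
move=> e1 e2; transitivity ((u - u') + w * (v - v')); first ring.
by rewrite e1 e2; ring.
Qed.

(** Change of basis from phi, psi to the Jost and reversed solutions; the bracket on the left is its
    determinant. One matrix serves both potentials because their data P, S, dP, dS at 0 agree. *)
Lemma reversed_wronskian p s p' s' P S dP dS w c :
  (p * s' - s * p') * (c * ((dP + w * dS) + w * (P + w * S))) =
  c * ((p' + w * s') * ((dS + w * S) * p - (dP + w * P) * s) -
       (p + w * s) * ((dS + w * S) * p' - (dP + w * P) * s')).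
Proof. by ring. Qed.

Lemma cancel_exponentials c1 c2 c (F1 F2 : A) e1 e2 : c1 * c2 = 1 ->
  (c1 * c * F2) * (c2 * e1) - (c1 * c * F1) * (c2 * e2) = c * (F2 * e1 - F1 * e2).
Proof.
move=> h; transitivity (c1 * c2 * c * (F2 * e1 - F1 * e2)); first ring.
by rewrite h mul1r.
Qed.

End WronskianAlgebra.

Section RealInequalities.
Local Open Scope complex_scope.
Variable R : realType.
Implicit Types u v w c t : R.

Lemma ratio_le_half u t : 0 < t -> 8 * u <= t -> 4 * u / t <= 1 / 2.
Proof. by move=> t0 ut; rewrite ler_pdivrMr//; lra. Qed.

Lemma mul_div_le u t c w : 0 < c -> u * (t / c) <= w -> u * t <= w * c.
Proof. by move=> c0; rewrite mulrA ler_pdivrMr. Qed.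

Lemma cnorm_subM_le (z1 z2 z3 z4 : R[i]) : cnorm z1 <= 2 -> cnorm z2 <= 2 ->
  cnorm z3 <= 2 -> cnorm z4 <= 2 -> cnorm (z1 * z2 - z3 * z4) <= 8.
Proof.
move=> h1 h2 h3 h4; apply: le_trans (cnormB _ _) _.
rewrite !cnormM (_ : 8 = 2 * 2 + 2 * 2); last ring.
by apply: lerD; apply: ler_pM; rewrite ?cnorm_ge0.
Qed.

End RealInequalities.

Opaque phi dphi psi dpsi cexp.

Section Uniqueness.
Local Open Scope complex_scope.
Variable R : realType.
Notation C := R[i].
Notation mu := (@lebesgue_measure R).
Variables (q1 q2 : R -> R) (a : R).
Hypotheses (a0 : 0 < a) (iq1 : mu.-integrable `[0, a] (EFin \o q1))
  (iq2 : mu.-integrable `[0, a] (EFin \o q2)).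

Let a0' := ltW a0.
Let Q1 := absint q1 0 a.
Let Q2 := absint q2 0 a.

Notation phi1 := (phi q1 a).
Notation dphi1 := (dphi q1 a).
Notation psi1 := (psi q1 a).
Notation dpsi1 := (dpsi q1 a).
Notation phi2 := (phi q2 a).
Notation dphi2 := (dphi q2 a).
Notation psi2 := (psi q2 a).
Notation dpsi2 := (dpsi q2 a).

Let E1 := fundamental_entire a0 iq1.
Let E2 := fundamental_entire a0 iq2.

Let big : R := 1 + 16 * Q1 + 16 * Q2.

Let bigP (t : R) : big <= t -> [/\ 1 <= t, 8 * Q1 <= t, 8 * Q2 <= t &
  16 * Q1 <= t].
Proof.
have h1 : 0 <= Q1 := absint_ge0 _ _ _; have h2 : 0 <= Q2 := absint_ge0 _ _ _.
rewrite /big; move: Q1 Q2 h1 h2 => u w u0 w0 h.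
by split; lra.
Qed.

Lemma jost_quotient_eq x : 0 <= x <= a ->
  (forall z, phi1 z x * psi2 z x = psi1 z x * phi2 z x) ->
  forall z, phi1 z x = phi2 z x /\ psi1 z x = psi2 z x.
Proof.
move=> xa H; have [e1 [e2 [e3 e4]]] := E1 xa; have [e1' [e2' [e3' e4']]] := E2 xa.
have det z : phi1 z x * dpsi1 z x - dphi1 z x * psi1 z x = 1.
  exact: fundamental_det.
pose h z := phi2 z x * dpsi1 z x - dphi1 z x * psi2 z x.
have h1 z : phi2 z x = h z * phi1 z x by have [] := wronskian_quotient (det z) (H z).
have h2 z : psi2 z x = h z * psi1 z x by have [] := wronskian_quotient (det z) (H z).
suff H1 z : h z - 1 = 0.
  by move=> z; rewrite h1 h2; move/eqP: (H1 z); rewrite subr_eq0 => /eqP ->; rewrite !mul1r.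
move: z; apply: (@liouville_decay _ _ big (2 * (4 * Q1 + 4 * Q2))).
  apply: (@eq_entire _ (fun z => h z - (1%:P).[z])).
    by move=> z; rewrite hornerC.
  by apply: entireB; [apply: entireB; exact: entireM|exact: entire_poly].
move=> k k0 /bigP[k1 k8 k8' _].
have kp : 0 < cnorm k by exact: lt_le_trans k1.
set E := cexp (- ('i * k)) x * cexp ('i * k) a.
have [m1 _] := jostF_estimate a0 iq1 k0 k1 k8 xa.
have [m2 _] := jostF_estimate a0 iq2 k0 k1 k8' xa.
have /andP[l1 _] := jostF_near1 a0 iq1 k0 k1 k8 xa.
have FF : jostF q2 a k x = h (k ^+ 2) * jostF q1 a k x.
  exact: lincomb_proportional.
have -> : 2 * (4 * Q1 + 4 * Q2) / cnorm k = 2 * ((4 * Q1 + 4 * Q2) / cnorm k).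
  by rewrite mulrA.
apply: (le_of_mul_half (cnorm_ge0 _) _ l1).
rewrite -cnormM.
have -> : (h (k ^+ 2) - 1) * (E * jostF q1 a k x) =
    (E * jostF q2 a k x - 1) - (E * jostF q1 a k x - 1).
  by rewrite FF; move: (h _) (jostF _ _ _ _) => u w; ring.
apply: le_trans (cnormB _ _) _; rewrite addrC mulrDl; exact: lerD.
Qed.

(** The multiplier [h] of f1' - f2' = h f1 is controlled by f' - ikf, which is only O(1): Liouville
    makes it constant, and the o(1) bound on the imaginary axis then makes it 0. *)
Lemma jost_value_eq :
  (forall z, phi1 z 0 = phi2 z 0) -> (forall z, psi1 z 0 = psi2 z 0) ->
  forall z, dphi1 z 0 = dphi2 z 0 /\ dpsi1 z 0 = dpsi2 z 0.
Proof.
move=> Hphi Hpsi; have xa : 0 <= (0 : R) <= a by rewrite lexx.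
have [e1 [e2 [e3 e4]]] := E1 xa; have [e1' [e2' [e3' e4']]] := E2 xa.
have det z : phi1 z 0 * dpsi1 z 0 - dphi1 z 0 * psi1 z 0 = 1.
  exact: fundamental_det.
have det2 z : phi1 z 0 * dpsi2 z 0 - dphi2 z 0 * psi1 z 0 = 1.
  by rewrite Hphi Hpsi; exact: fundamental_det.
pose h z := (dphi1 z 0 - dphi2 z 0) * dpsi1 z 0 - dphi1 z 0 * (dpsi1 z 0 - dpsi2 z 0).
have h1 z : dphi1 z 0 - dphi2 z 0 = h z * phi1 z 0.
  by have [] := wronskian_sub_derivative (det z) (det2 z).
have h2 z : dpsi1 z 0 - dpsi2 z 0 = h z * psi1 z 0.
  by have [] := wronskian_sub_derivative (det z) (det2 z).
have eh : entire h.
  by apply: entireB; apply: entireM => //; exact: entireB.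
have FF k : jostF q2 a k 0 = jostF q1 a k 0.
  by rewrite /jostF Hphi Hpsi.
have GG k : jostG q1 a k 0 - jostG q2 a k 0 = h (k ^+ 2) * jostF q1 a k 0.
  exact: lincomb_sub.
have key k (c1 c2 : R) : 0 <= complex.Im k -> big <= cnorm k ->
    cnorm (cexp ('i * k) a * (jostG q1 a k 0 - 'i * k * jostF q1 a k 0)) <= c1 ->
    cnorm (cexp ('i * k) a * (jostG q2 a k 0 - 'i * k * jostF q2 a k 0)) <= c2 ->
    cnorm (h (k ^+ 2)) <= 2 * (c1 + c2).
  move=> k0 /bigP[k1 k8 k8' _] b1 b2.
  have /andP[l1 _] := jostF_near1 a0 iq1 k0 k1 k8 xa.
  apply: (le_of_mul_half (cnorm_ge0 _) _ l1).
  rewrite -cnormM cexp0 mul1r.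
  have -> : h (k ^+ 2) * (cexp ('i * k) a * jostF q1 a k 0) =
    cexp ('i * k) a * (jostG q1 a k 0 - 'i * k * jostF q1 a k 0) -
    cexp ('i * k) a * (jostG q2 a k 0 - 'i * k * jostF q2 a k 0).
    rewrite FF mulrCA -GG.
    move: (jostG q1 _ _ _) (jostG q2 _ _ _) (jostF _ _ _ _) (cexp _ _) => u1 u2 u3 u4.
    by ring.
  apply: le_trans (cnormB _ _) _; exact: lerD.
have hc : forall z, h z = h 0.
  apply: (@liouville_upper _ _ big (2 * (4 * Q1 + 4 * Q2))) => // k k0 bk.
  have [k1 k8 k8' _] := bigP bk.
  have [_] := jostF_estimate a0 iq1 k0 k1 k8 xa.
  have [_] := jostF_estimate a0 iq2 k0 k1 k8' xa.
  rewrite cexp0 !(mul1r (cexp _ _)) => b2 b1; exact: key.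
suff h0 z : h z = 0.
  move=> z; have := h1 z; have := h2 z; rewrite h0 !mul0r => /eqP + /eqP.
  by rewrite !subr_eq0 => /eqP -> /eqP ->.
rewrite hc; apply: (@eq0_cnorm_le _ 20) => e e0.
have [K1 b1] := jostF_derivative_decay a0 iq1 e0.
have [K2 b2] := jostF_derivative_decay a0 iq2 e0.
pose t := Num.max big (Num.max K1 K2).
have bt : big <= t by rewrite le_max lexx.
have [t1 t8 t8' _] := bigP bt.
have t0 : 0 < t by exact: lt_le_trans t1.
have nt : cnorm ('i * t%:C : C) = t.
  by rewrite cnormM cnorm_i mul1r cnorm_real gtr0_norm.
have it : complex.Im ('i * t%:C : C) = t.
  by rewrite ImM/= mul0r mul1r add0r.
have := @key ('i * t%:C) (5 * e) (5 * e); rewrite it nt => H.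
rewrite -(hc (('i * t%:C) ^+ 2)); apply: le_trans (H (ltW t0) bt _ _) _.
- by apply: b1 => //; rewrite !le_max lexx !orbT.
- by apply: b2 => //; rewrite !le_max lexx !orbT.
- by have -> : e * 20 = 2 * (5 * e + 5 * e) by ring.
Qed.

(** Here f1 - f2 = h f1'. After normalisation the left side is at most 1 and f1' is at least |k|/4,
    so h is at most 4/|k| and vanishes at once. *)
Lemma jost_derivative_eq :
  (forall z, dphi1 z 0 = dphi2 z 0) -> (forall z, dpsi1 z 0 = dpsi2 z 0) ->
  forall z, phi1 z 0 = phi2 z 0 /\ psi1 z 0 = psi2 z 0.
Proof.
move=> Hphi Hpsi; have xa : 0 <= (0 : R) <= a by rewrite lexx.
have [e1 [e2 [e3 e4]]] := E1 xa; have [e1' [e2' [e3' e4']]] := E2 xa.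
have det z : phi1 z 0 * dpsi1 z 0 - dphi1 z 0 * psi1 z 0 = 1.
  exact: fundamental_det.
have det2 z : phi2 z 0 * dpsi1 z 0 - dphi1 z 0 * psi2 z 0 = 1.
  by rewrite Hphi Hpsi; exact: fundamental_det.
pose h z := phi1 z 0 * (psi1 z 0 - psi2 z 0) - (phi1 z 0 - phi2 z 0) * psi1 z 0.
have h1 z : phi1 z 0 - phi2 z 0 = h z * dphi1 z 0.
  by have [] := wronskian_sub_value (det z) (det2 z).
have h2 z : psi1 z 0 - psi2 z 0 = h z * dpsi1 z 0.
  by have [] := wronskian_sub_value (det z) (det2 z).
have eh : entire h.
  by apply: entireB; apply: entireM => //; exact: entireB.
suff h0 z : h z = 0.
  move=> z; have := h1 z; have := h2 z; rewrite h0 !mul0r => /eqP + /eqP.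
  by rewrite !subr_eq0 => /eqP -> /eqP ->.
move: z; apply: (@liouville_decay _ _ big 4) => // k k0 /bigP[k1 k8 k8' k16].
have kp : 0 < cnorm k by exact: lt_le_trans k1.
have FF : jostF q1 a k 0 - jostF q2 a k 0 = h (k ^+ 2) * jostG q1 a k 0.
  exact: lincomb_sub.
have [m1 _] := jostF_estimate a0 iq1 k0 k1 k8 xa.
have [m2 _] := jostF_estimate a0 iq2 k0 k1 k8' xa.
have Gl := jostG_lower a0 iq1 k0 k1 k8 k16.
have r1 := ratio_le_half kp k8; have r2 := ratio_le_half kp k8'.
rewrite ler_pdivlMr//.
suff : cnorm (h (k ^+ 2)) * (cnorm k / 4) <= 1.
  by move/mul_div_le => /(_ (ltr0n _ 4)); rewrite mul1r.
apply: (@le_trans _ _ (cnorm (h (k ^+ 2)) * cnorm (cexp ('i * k) a * jostG q1 a k 0))).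
  by rewrite ler_wpM2l ?cnorm_ge0.
rewrite -cnormM.
have -> : h (k ^+ 2) * (cexp ('i * k) a * jostG q1 a k 0) =
   (cexp (- ('i * k)) 0 * cexp ('i * k) a * jostF q1 a k 0 - 1) -
   (cexp (- ('i * k)) 0 * cexp ('i * k) a * jostF q2 a k 0 - 1).
  rewrite mulrCA -FF cexp0.
  by move: (jostF q1 _ _ _) (jostF q2 _ _ _) (cexp _ _) => u1 u2 u3; ring.
apply: le_trans (cnormB _ _) _; rewrite [leRHS](_ : 1 = 1 / 2 + 1 / 2 :> R); last by field.
exact: lerD (le_trans m1 r1) (le_trans m2 r2).
Qed.

Hypotheses (Tphi : forall z, phi1 z 0 = phi2 z 0)
  (Tpsi : forall z, psi1 z 0 = psi2 z 0)
  (Tdphi : forall z, dphi1 z 0 = dphi2 z 0)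
  (Tdpsi : forall z, dpsi1 z 0 = dpsi2 z 0).

Lemma fundamental_eq x : 0 <= x <= a ->
  forall z, phi1 z x = phi2 z x /\ psi1 z x = psi2 z x.
Proof.
move=> xa; apply: jost_quotient_eq => //.
have [e1 [e2 [e3 e4]]] := E1 xa; have [e1' [e2' [e3' e4']]] := E2 xa.
suff H z : phi1 z x * psi2 z x - psi1 z x * phi2 z x = 0.
  by move=> z; apply/eqP; rewrite -subr_eq0 H.
(* 16 is 8 times 2: four factors of size at most 2 give 8, and the Wronskian that multiplies [h] is
   at least |k|/2. *)
move: z; apply: (@liouville_decay _ _ big 16).
  by apply: entireB; exact: entireM.
move=> k k0 /bigP[k1 k8 k8' k16].
have kp : 0 < cnorm k by exact: lt_le_trans k1.
set h := _ - _; set l := 'i * k.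
have wl := jost_wronskian_lower a0 iq1 k0 k1 k8.
have /andP[_ m1] := jostF_near1 a0 iq1 k0 k1 k8 xa.
have /andP[_ m2] := jostF_near1 a0 iq2 k0 k1 k8' xa.
have n1 := revF_bound a0 iq1 k0 k1 k8 xa.
have n2 := revF_bound a0 iq2 k0 k1 k8' xa.
rewrite ler_pdivlMr//.
suff : cnorm h * (cnorm k / 2) <= 8.
  by move/mul_div_le => /(_ (ltr0n _ 2)); rewrite -natrM.
apply: le_trans (_ : cnorm h * cnorm (cexp l a * (jostG q1 a k 0 + l * jostF q1 a k 0)) <= _).
  by rewrite ler_wpM2l ?cnorm_ge0.
rewrite -cnormM.
have -> : h * (cexp l a * (jostG q1 a k 0 + l * jostF q1 a k 0)) =
  (cexp (- l) x * cexp l a * jostF q2 a k x) * (cexp l x * revF q1 a k x) -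
  (cexp (- l) x * cexp l a * jostF q1 a k x) * (cexp l x * revF q2 a k x).
  rewrite (cancel_exponentials _ _ _ _ _ (cexpN l x)).
  (* Agreement of the transfer matrices enters here: the second reversed solution gets the
     coefficients of the first. *)
  have -> : revF q2 a k x = (dpsi1 (k ^+ 2) 0 + 'i * k * psi1 (k ^+ 2) 0) * phi2 (k ^+ 2) x -
      (dphi1 (k ^+ 2) 0 + 'i * k * phi1 (k ^+ 2) 0) * psi2 (k ^+ 2) x.
    by rewrite /revF Tphi Tpsi Tdphi Tdpsi.
  exact: reversed_wronskian.
exact (cnorm_subM_le m2 n1 m1 n2).
Qed.

End Uniqueness.

Lemma prim_unique_interior (R : realType) (a b : R) (f g1 g2 : R -> R) (x : R) :
  prim a b f g1 -> prim a b f g2 ->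
  {within `[a, b], continuous g1} -> {within `[a, b], continuous g2} ->
  a < x -> x < b -> g1 x = g2 x.
Proof.
move=> p1 p2 c1 c2 ax xb; have ab := lt_trans ax xb.
have xab : x \in `]a, b[ by rewrite in_itv/= ax.
move/(continuous_within_itvP _ ab) : c1 => [/(_ _ xab) c1 _ _].
move/(continuous_within_itvP _ ab) : c2 => [/(_ _ xab) c2 _ _].
have d1 := prim_is_derive_at ax xb p1 c1.
have d2 := prim_is_derive_at ax xb p2 c2.
by rewrite -(@derive_val _ _ _ _ _ _ _ d1) (@derive_val _ _ _ _ _ _ _ d2).
Qed.

(** * From the transfer matrix to the potential *)

Section InverseProblem.
Local Open Scope complex_scope.
Variable R : realType.
Notation C := R[i].
Notation mu := (@lebesgue_measure R).
Notation Re := (@complex.Re R).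
Variables (q1 q2 : R -> R) (a : R).
Hypotheses (a0 : 0 < a) (iq1 : mu.-integrable `[0, a] (EFin \o q1))
  (iq2 : mu.-integrable `[0, a] (EFin \o q2)).

Let a0' := ltW a0.

(** Equal solutions have equal derivatives inside the interval, by continuity, and at its ends by
    assumption. This common derivative is an indefinite integral of both q1 y and q2 y, at energy 0,
    so these agree almost everywhere. *)
Lemma ae_potential_mul (y1 v1 y2 v2 : R -> C) :
  cprim 0 a y1 v1 -> cprim 0 a v1 (fun x => ((q1 x)%:C - 0) * y1 x) ->
  cprim 0 a y2 v2 -> cprim 0 a v2 (fun x => ((q2 x)%:C - 0) * y2 x) ->
  (forall x, 0 <= x <= a -> y1 x = y2 x) -> v1 0 = v2 0 -> v1 a = v2 a ->
  {ae mu, forall x, 0 <= x <= a -> q1 x * Re (y1 x) = q2 x * Re (y1 x)}.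
Proof.
move=> [p1 _] [p1' _] [p2 _] [p2' _] yy v0 va.
have p2y : prim 0 a (fun x => Re (y1 x)) (fun x => Re (v2 x)).
  by apply: eq_prim p2 => x xa //; rewrite yy.
have vv x : 0 <= x <= a -> Re (v1 x) = Re (v2 x).
  move=> /andP[]; rewrite le_eqVlt => /predU1P[<-|x0]; first by rewrite v0.
  rewrite le_eqVlt => /predU1P[->|xa]; first by rewrite va.
  apply: (prim_unique_interior p1 p2y _ _ x0 xa).
    exact: prim_continuous p1'.
  exact: prim_continuous p2'.
have p2v : prim 0 a (fun x => Re (v1 x)) (fun x => Re (((q2 x)%:C - 0) * y2 x)).
  by apply: eq_prim p2' => x xa //; rewrite vv.
have := prim_ae_unique p1' p2v; apply: filterS; first exact: (ae_filter_ringOfSetsType mu).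
move=> x H xa.
have := H xa; rewrite !subr0 !ReM/= !mul0r !subr0.
by rewrite (yy x xa).
Qed.

(** A single solution may vanish somewhere, but phi and psi have Wronskian 1, so (q1 - q2) phi = 0
    and (q1 - q2) psi = 0 together give q1 = q2. *)
Lemma ae_potential_eq :
  (forall z, phi q1 a z 0 = phi q2 a z 0) ->
  (forall z, psi q1 a z 0 = psi q2 a z 0) ->
  (forall z, dphi q1 a z 0 = dphi q2 a z 0) ->
  (forall z, dpsi q1 a z 0 = dpsi q2 a z 0) ->
  {ae mu, forall x, 0 <= x <= a -> q1 x = q2 x}.
Proof.
move=> T1 T2 T3 T4.
have E := fundamental_eq a0 iq1 iq2 T1 T2 T3 T4.
have [p1 p1'] := phi_prim a0 iq1 0; have [p2 p2'] := phi_prim a0 iq2 0.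
have [r1 r1'] := psi_prim a0 iq1 0; have [r2 r2'] := psi_prim a0 iq2 0.
have [_ e1] := phi_end a0 iq1 0; have [_ e2] := phi_end a0 iq2 0.
have [_ e3] := psi_end a0 iq1 0; have [_ e4] := psi_end a0 iq2 0.
have h1 := ae_potential_mul p1 p1' p2 p2' (fun x xa => (E x xa 0).1) (T3 0)
  (etrans e1 (esym e2)).
have h2 := ae_potential_mul r1 r1' r2 r2' (fun x xa => (E x xa 0).2) (T4 0)
  (etrans e3 (esym e4)).
move: h1 h2; apply: filterS2; first exact: (ae_filter_ringOfSetsType mu).
move=> x h1 h2 xa.
have {}h1 := h1 xa; have {}h2 := h2 xa.
have det := fundamental_det a0 iq1 0 xa.
have [[i1 i2] [i3 i4]] := fundamental_real q1 a 0 x.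
have {det} : Re (phi q1 a 0 x) * Re (dpsi q1 a 0 x) -
    Re (dphi q1 a 0 x) * Re (psi q1 a 0 x) = 1.
  by move: det => /(congr1 Re); rewrite ReB !ReM i1 i2 !mul0r !subr0.
move: (Re (phi q1 a 0 x)) h1 (Re (dpsi q1 a 0 x)) (Re (dphi q1 a 0 x)).
move: (Re (psi q1 a 0 x)) h2 => v' h2 u h1 u' v det.
have : (q1 x - q2 x) * 1 = 0.
  rewrite -det.
  have -> : (q1 x - q2 x) * (u * u' - v * v') =
    (q1 x * u - q2 x * u) * u' - v * (q1 x * v' - q2 x * v') by ring.
  by rewrite h1 h2 !subrr mul0r mulr0 subr0.
by rewrite mulr1 => /eqP; rewrite subr_eq0 => /eqP.
Qed.

Let E1 := fundamental_entire a0 iq1.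
Let E2 := fundamental_entire a0 iq2.
Let x0 : 0 <= (0 : R) <= a. Proof. by rewrite lexx. Qed.

Lemma entire_eq_pos (h1 h2 : C -> C) : entire h1 -> entire h2 ->
  (forall k : R, 0 < k -> h1 ((k ^+ 2)%:C) = h2 ((k ^+ 2)%:C)) ->
  forall z, h1 z = h2 z.
Proof.
move=> e1 e2 H z; apply/eqP; rewrite -subr_eq0; apply/eqP.
apply: (@entire_eq0 _ (fun z => h1 z - h2 z)); first exact: entireB.
move=> x xp; have := H (Num.sqrt x); rewrite sqrtr_gt0 sqr_sqrtr ?ltW// => -> //.
by rewrite subrr.
Qed.

Lemma inverse_jost_value :
  (forall k : R, 0 < k -> phi q1 a (k ^+ 2)%:C 0 = phi q2 a (k ^+ 2)%:C 0) ->
  (forall k : R, 0 < k -> psi q1 a (k ^+ 2)%:C 0 = psi q2 a (k ^+ 2)%:C 0) ->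
  {ae mu, forall x, 0 <= x <= a -> q1 x = q2 x}.
Proof.
move=> H1 H2; have [e1 [_ [e2 _]]] := E1 x0; have [e1' [_ [e2' _]]] := E2 x0.
have {}H1 := entire_eq_pos e1 e1' H1; have {}H2 := entire_eq_pos e2 e2' H2.
have D := jost_value_eq a0 iq1 iq2 H1 H2.
by apply: (ae_potential_eq H1 H2) => z; have [] := D z.
Qed.

Lemma inverse_jost_derivative :
  (forall k : R, 0 < k -> dphi q1 a (k ^+ 2)%:C 0 = dphi q2 a (k ^+ 2)%:C 0) ->
  (forall k : R, 0 < k -> dpsi q1 a (k ^+ 2)%:C 0 = dpsi q2 a (k ^+ 2)%:C 0) ->
  {ae mu, forall x, 0 <= x <= a -> q1 x = q2 x}.
Proof.
move=> H1 H2; have [_ [e1 [_ e2]]] := E1 x0; have [_ [e1' [_ e2']]] := E2 x0.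
have {}H1 := entire_eq_pos e1 e1' H1; have {}H2 := entire_eq_pos e2 e2' H2.
have D := jost_derivative_eq a0 iq1 iq2 H1 H2.
by apply: (ae_potential_eq _ _ H1 H2) => z; have [] := D z.
Qed.

Lemma inverse_jost_quotient :
  (forall k : R, 0 < k ->
    phi q1 a (k ^+ 2)%:C 0 * psi q2 a (k ^+ 2)%:C 0 =
    psi q1 a (k ^+ 2)%:C 0 * phi q2 a (k ^+ 2)%:C 0) ->
  {ae mu, forall x, 0 <= x <= a -> q1 x = q2 x}.
Proof.
move=> H; have [e1 [_ [e2 _]]] := E1 x0; have [e1' [_ [e2' _]]] := E2 x0.
have D := jost_quotient_eq a0 iq1 iq2 x0
  (entire_eq_pos (entireM e1 e2') (entireM e2 e1') H).
by apply: inverse_jost_value => k _; have [] := D (k ^+ 2)%:C.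
Qed.

End InverseProblem.

(** * Identification of the Jost solution *)

Section RealLemmas.
Variable R : realType.
Notation mu := (@lebesgue_measure R).
Implicit Types (a b c s t x : R) (f g : R -> R).

Lemma integrable_itv_glue a b c g : a <= b -> b <= c ->
  mu.-integrable `[a, b] (EFin \o g) -> mu.-integrable `[b, c] (EFin \o g) ->
  mu.-integrable `[a, c] (EFin \o g).
Proof.
move=> ab bc i1 i2.
have {}i2 : mu.-integrable `]b, c] (EFin \o g).
  apply: integrableS i2 => // x /=; rewrite !in_itv/= => /andP[bx ->].
  by rewrite ltW.
have U : `[a, c]%classic = `[a, b]%classic `|` `]b, c]%classic :> set R.
  by rewrite -itv_bndbnd_setU// bnd_simp.
have [/integrableP[m1 l1] /integrableP[m2 l2]] := (i1, i2).
rewrite U; apply/integrableP; split; first exact/measurable_funU.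
rewrite ge0_integral_setU//; first exact: lte_add_pinfty.
  by apply: measurableT_comp => //; exact/measurable_funU.
apply/disj_setPS => x [] /=; rewrite !in_itv/= => /andP[_ xb] /andP[bx _].
by move: xb; rewrite leNgt bx.
Qed.

Lemma prim_ae_congr a b f g g' : prim a b f g ->
  mu.-integrable `[a, b] (EFin \o g') ->
  {ae mu, forall x, a <= x <= b -> g x = g' x} -> prim a b f g'.
Proof.
move=> [ig fg] ig' gg; split => // s t as_ st tb; rewrite fg//.
have i1 := integrable_sub_itv as_ tb ig; have i2 := integrable_sub_itv as_ tb ig'.
rewrite /Rintegral; congr fine; apply: ae_eq_integral => //.
- exact: measurable_int i1.
- exact: measurable_int i2.
- move: gg; apply: filterS; first exact: (ae_filter_ringOfSetsType mu).
  move=> x gg; rewrite /= in_itv/= => /andP[sx xt]; congr EFin; apply: gg.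
  by rewrite (le_trans as_ sx) (le_trans xt tb).
Qed.

Lemma prim_right_derivative a b f g : a < b -> prim a b f g ->
  {within `[a, b], continuous g} -> right_derivative f a = g a.
Proof.
move=> ab p cg; apply/cvg_lim; first exact: Rhausdorff.
move/(continuous_within_itvP _ ab) : cg => [_ cga _].
apply/cvgrPdist_le => e e0.
move/cvgrPdist_le : cga => /(_ _ e0).
rewrite near_withinE => -[d /= d0 H].
have pid : prim a b (fun x => x) (fun _ => 1 : R).
  by apply: prim_is_derive; exact: cst_continuous.
(* Subtracting the tangent turns the error of the difference quotient into a mean of [g - g a],
   small by continuity at [a]. *)
have p2 : prim a b (fun x => f x - g a * x) (fun x => g x - g a).
  apply: eq_prim (primB p (primZ (g a) pid)) => x _ //.
  by rewrite mulr1.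
near=> h.
have h0 : 0 < h by near: h; exact: nbhs_right_gt.
have hd : h < d by near: h; exact: nbhs_right_lt.
have hb : a + h <= b.
  by rewrite -lerBrDl; near: h; apply: nbhs_right_le; rewrite subr_gt0.
have ah : a <= a + h by rewrite lerDl ltW.
have pe := primZ e pid.
have := prim_le p2 pe.1 _ (lexx a) ah hb.
rewrite -(pe.2 _ _ (lexx a) ah hb) -mulrBr (addrC a) addrK (addrC h) mulr1 => bound.
rewrite -(ler_pM2l h0) -[X in X * `|_|](gtr0_norm h0) -normrM mulrBr.
rewrite (mulrA h) divff ?gt_eqF// mul1r -normrN.
rewrite [leRHS]mulrC.
have -> : - (h * g a - (f (a + h) - f a)) =
  f (a + h) - g a * (a + h) - (f a - g a * a) by ring.
apply: bound => x /andP[]; rewrite le_eqVlt => /predU1P[<- _|ax xh].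
  by rewrite subrr normr0 ltW.
rewrite distrC; apply: H => //; rewrite /ball/=.
by rewrite ltr_distlC; apply/andP; split; lra.
Unshelve. all: by end_near. Qed.

(** A periodic function that tends to 0 at infinity is identically 0; its values at phases 0 and
    pi/2 are the two coefficients. *)
Lemma trig_cvg0 (k u w : R) : k != 0 ->
  u * cos (k * x) + w * sin (k * x) @[x --> +oo] --> (0 : R) -> u = 0 /\ w = 0.
Proof.
move=> k0 g0; pose g x := u * cos (k * x) + w * sin (k * x).
have per x n : g (x + n%:R * (2 * pi / `|k|)) = g x.
  have nk : `|k| != 0 by rewrite normr_eq0.
  have H (z : R) : cos (z + n%:R * (2 * pi)) = cos z /\ sin (z + n%:R * (2 * pi)) = sin z.
    elim: n => [|n [IH1 IH2]]; first by rewrite mul0r addr0.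
    have -> : z + n.+1%:R * (2 * pi) = (z + n%:R * (2 * pi)) + pi *+ 2.
      by rewrite -natr1 mulr2n; ring.
    by rewrite cosD2pi sinD2pi.
  rewrite /g mulrDr.
  have [kp|kn] := ltP 0 k.
    have -> : k * (n%:R * (2 * pi / `|k|)) = n%:R * (2 * pi).
      by rewrite gtr0_norm//; field; rewrite gt_eqF.
    by have [-> ->] := H (k * x).
  have {}kn : k < 0 by rewrite lt_neqAle k0.
  have -> : k * x + k * (n%:R * (2 * pi / `|k|)) = k * x - n%:R * (2 * pi).
    by rewrite ltr0_norm//; field; exact: k0.
  have [] := H (k * x - n%:R * (2 * pi)).
  by rewrite subrK => -> ->.
have gx x : g x = 0.
  apply/eqP; rewrite -normr_eq0 eq_le normr_ge0 andbT.
  apply/ler_addgt0Pl => e e0; rewrite addr0.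
  move/cvgrPdist_le : g0 => /(_ _ e0) [A [Ar HA]].
  have T0 : 0 < 2 * pi / `|k| by rewrite divr_gt0 ?mulr_gt0 ?pi_gt0// normr_gt0.
  pose n := (Num.truncn (`|A - x| / (2 * pi / `|k|))).+1.
  have := HA (x + n%:R * (2 * pi / `|k|)); rewrite -/(g _) per sub0r normrN; apply.
  have : `|A - x| / (2 * pi / `|k|) < n%:R by exact: truncnS_gt.
  rewrite ltr_pdivrMr// => h; have := ler_norm (A - x); lra.
split.
  by have := gx 0; rewrite /g mulr0 cos0 sin0 mulr0 addr0 mulr1.
have := gx (pi / 2 / k); rewrite /g (_ : k * (pi / 2 / k) = pi / 2); last by field.
by rewrite cos_pihalf sin_pihalf mulr0 add0r mulr1.
Qed.

(** Variation of constants: k y cos(kx) - v sin(kx) and k y sin(kx) + v cos(kx) are constant along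
    the free equation. *)
Lemma free_solution (k : R) s t (y v : R -> R) : s <= t ->
  prim s t y v -> prim s t v (fun x => - k ^+ 2 * y x) ->
  forall x x0, s <= x <= t -> s <= x0 <= t ->
  k * y x = (k * y x0 * cos (k * x0) - v x0 * sin (k * x0)) * cos (k * x) +
            (k * y x0 * sin (k * x0) + v x0 * cos (k * x0)) * sin (k * x).
Proof.
move=> st py pv x x0 xst x0st.
have pc : prim s t (fun x => cos (k * x)) (fun x => k * - sin (k * x)).
  apply: (@prim_comp_scale _ _ _ _ _ (fun x => - sin x)).
  by move=> z; apply: cvgN; exact: continuous_sin.
have ps := prim_comp_scale s t k (@is_derive_sin R) (@continuous_cos R).
have p1 := primB (primZ k (primM st py pc)) (primM st pv ps).
have p2 := primD (primZ k (primM st py ps)) (primM st pv pc).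
have h1 := prim_eq_cst p1 _ xst x0st.
have h2 := prim_eq_cst p2 _ xst x0st.
have {}h1 : k * (y x * cos (k * x)) - v x * sin (k * x) =
    k * (y x0 * cos (k * x0)) - v x0 * sin (k * x0).
  by apply: h1 => z _ /=; ring.
have {}h2 : k * (y x * sin (k * x)) + v x * cos (k * x) =
    k * (y x0 * sin (k * x0)) + v x0 * cos (k * x0).
  by apply: h2 => z _ /=; ring.
rewrite -!(mulrA k) -h1 -h2.
have e := cos2Dsin2 (k * x).
transitivity (k * y x * (cos (k * x) ^+ 2 + sin (k * x) ^+ 2)); last by ring.
by rewrite e mulr1.
Qed.

End RealLemmas.

(** * Uniqueness of the Jost solution on the half-line *)

Section HalfLine.
Variable R : realType.
Notation mu := (@lebesgue_measure R).
Variables (q : R -> R) (a k : R).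
Hypotheses (a0 : 0 < a) (k0 : k != 0)
  (iq : mu.-integrable `[0, a] (EFin \o q))
  (q0 : {ae mu, forall x : R, a <= x -> q x = 0}).

Section Uniqueness.
Variable y : R -> R.
Hypothesis sy : schrodinger_sol q k y.

(** Intervals start at s > 0, where [schrodinger_sol] provides a derivative; the endpoint 0 is
    reached afterwards by continuity of y. *)
Lemma schrodinger_prim : exists y2 : R -> R,
  [/\ forall s t, 0 < s -> prim s t y (derive1 y),
      forall s t, 0 < s -> prim s t (derive1 y) y2 &
      {ae mu, forall x : R, 0 < x -> - y2 x + q x * y x = k ^+ 2 * y x}].
Proof.
have [_ dy [y2 [iy2 yy2 ey2]]] := sy; exists y2.
have p2 s t : 0 < s -> prim s t (derive1 y) y2.
  move=> s0; split; first exact: integrable_sub_itv (ltW s0) (lexx t) (iy2 t).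
  by move=> u w su uw _; apply: yy2 => //; exact: lt_le_trans su.
split => // s t s0.
have [ts|st] := ltP t s.
  split; first by rewrite set_itv_ge ?bnd_simp -?ltNge//; exact: integrable_set0.
  by move=> u w su uw wt; have := lt_le_trans ts (le_trans su (le_trans uw wt)); rewrite ltxx.
have cd := prim_continuous st (p2 s t s0).
split.
  apply: continuous_compact_integrable => //; exact: segment_compact.
have cy x : 0 < x -> {for x, continuous y}.
  by move=> x0; apply: differentiable_continuous; apply/derivable1_diffP; exact: dy.
move=> u w su + wt; rewrite le_eqVlt => /predU1P[<-|uw].
  by rewrite subrr set_itv1 Rintegral_set1.
have u0 : 0 < u by exact: lt_le_trans su.
rewrite /Rintegral (@continuous_FTC2 _ (derive1 y) y)//.
- by apply: continuous_subspaceW cd; exact: sub_itvcc.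
- split => [x||].
  + by rewrite in_itv/= => /andP[ux _]; apply: dy; exact: lt_trans ux.
  + exact: cvg_at_right_filter (cy _ u0).
  + exact: cvg_at_left_filter (cy _ (lt_trans u0 uw)).
Qed.

Lemma schrodinger_inner s : 0 < s -> prim s a y (derive1 y) /\
  prim s a (derive1 y) (fun x => (q x - k ^+ 2) * y x).
Proof.
move=> s0; have [y2 [p1 p2 e]] := schrodinger_prim; split; first exact: p1.
have [as_|sa] := ltP a s.
  split; first by rewrite set_itv_ge ?bnd_simp -?ltNge//; exact: integrable_set0.
  by move=> u w su uw wt; have := lt_le_trans as_ (le_trans su (le_trans uw wt)); rewrite ltxx.
apply: (prim_ae_congr (p2 s a s0)).
  have iqs : mu.-integrable `[s, a] (EFin \o (fun x => q x + - k ^+ 2)).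
    apply: integrable_itvD; first exact: integrable_sub_itv (ltW s0) (lexx a) iq.
    by apply: continuous_integrable_itv; exact: cst_continuous.
  have := integrable_prim_mul sa (p1 s a s0) iqs.
  by apply: eq_integrable => // x _ /=; rewrite mulrC.
move: e; apply: filterS; first exact: (ae_filter_ringOfSetsType mu).
move=> x ex /andP[sx _]; rewrite mulrBl -ex ?(lt_le_trans s0)//; ring.
Qed.

Lemma schrodinger_outer t : a <= t -> prim a t y (derive1 y) /\
  prim a t (derive1 y) (fun x => - k ^+ 2 * y x).
Proof.
move=> at_; have [y2 [p1 p2 e]] := schrodinger_prim; split; first exact: p1.
apply: (prim_ae_congr (p2 a t a0)).
  have iqs : mu.-integrable `[a, t] (EFin \o (fun x : R => - k ^+ 2)).
    by apply: continuous_integrable_itv; exact: cst_continuous.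
  have := integrable_prim_mul at_ (p1 a t a0) iqs.
  by apply: eq_integrable => // x _ /=; rewrite mulrC.
move: e q0; apply: filterS2; first exact: (ae_filter_ringOfSetsType mu).
move=> x ex qx /andP[ax _]; have := ex (lt_le_trans a0 ax).
by rewrite qx// mul0r addr0 mulNr => <-; rewrite opprK.
Qed.

(** Beyond [a] the solution is trigonometric with coefficients A/k and B/k; its behaviour at
    infinity forces these to be c and d, and hence fixes the data at [a]. *)
Lemma schrodinger_asymptotics (c d : R) :
  y x - (c * cos (k * x) + d * sin (k * x)) @[x --> +oo] --> (0 : R) ->
  y a = c * cos (k * a) + d * sin (k * a) /\
  derive1 y a = k * (d * cos (k * a) - c * sin (k * a)).
Proof.
move=> H.
pose A := k * y a * cos (k * a) - derive1 y a * sin (k * a).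
pose B := k * y a * sin (k * a) + derive1 y a * cos (k * a).
have yE x : a <= x -> k * y x = A * cos (k * x) + B * sin (k * x).
  move=> ax; have [p1 p2] := schrodinger_outer ax.
  by apply: (free_solution ax p1 p2); rewrite ?ax ?lexx.
have [AE BE] : A / k - c = 0 /\ B / k - d = 0.
  apply: (trig_cvg0 k0); apply: cvg_trans H; apply: near_eq_cvg.
  near=> x; have ax : a <= x by near: x; apply: nbhs_pinfty_ge; exact: num_real.
  have -> : y x = k^-1 * (k * y x) by rewrite mulKf.
  by rewrite yE//; ring.
have {}AE : A = k * c.
  by move/eqP : AE; rewrite subr_eq0 => /eqP <-; field.
have {}BE : B = k * d.
  by move/eqP : BE; rewrite subr_eq0 => /eqP <-; field.
have e := cos2Dsin2 (k * a).
split.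
  apply: (mulfI k0); rewrite yE// AE BE; ring.
transitivity (derive1 y a * (cos (k * a) ^+ 2 + sin (k * a) ^+ 2)).
  by rewrite e mulr1.
transitivity (B * cos (k * a) - A * sin (k * a)); first by rewrite /A /B; ring.
by rewrite AE BE; ring.
Unshelve. all: by end_near. Qed.

(** The Wronskians of y with P and with S are constant, and that of P with S is 1, so y is obtained
    by Cramer's rule at every x > 0; the value at 0 follows by continuity. *)
Lemma schrodinger_representation (P dP S dS : R -> R) :
  prim 0 a P dP -> prim 0 a dP (fun x => (q x - k ^+ 2) * P x) ->
  prim 0 a S dS -> prim 0 a dS (fun x => (q x - k ^+ 2) * S x) ->
  P a = 1 -> dP a = 0 -> S a = 0 -> dS a = 1 ->
  forall x, 0 <= x <= a -> y x = y a * P x + derive1 y a * S x.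
Proof.
move=> p1 p2 p3 p4 Pa dPa Sa dSa.
have H x : 0 < x -> x <= a -> y x = y a * P x + derive1 y a * S x.
  move=> x0 xa; have [py pd] := schrodinger_inner x0.
  have sub f g (p : prim 0 a f g) := primS (ltW x0) (lexx a) p.
  have w1 := prim_eq_cst (primB (primM xa py (sub _ _ p2)) (primM xa pd (sub _ _ p1))).
  have w2 := prim_eq_cst (primB (primM xa py (sub _ _ p4)) (primM xa pd (sub _ _ p3))).
  have w3 := prim_eq_cst (primB (primM xa (sub _ _ p1) (sub _ _ p4))
    (primM xa (sub _ _ p2) (sub _ _ p3))).
  have xx : x <= x <= a by rewrite lexx.
  have aa : x <= a <= a by rewrite xa lexx.
  have {}w1 : y x * dP x - derive1 y x * P x = y a * dP a - derive1 y a * P a.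
    by apply: w1 => // z _; ring.
  have {}w2 : y x * dS x - derive1 y x * S x = y a * dS a - derive1 y a * S a.
    by apply: w2 => // z _; ring.
  have {}w3 : P x * dS x - dP x * S x = P a * dS a - dP a * S a.
    by apply: w3 => // z _; ring.
  move: w1 w2 w3; rewrite Pa dPa Sa dSa !mulr0 !mulr1 sub0r !subr0 => w1 w2 w3.
  transitivity (y x * (P x * dS x - dP x * S x)); first by rewrite w3 mulr1.
  have {1}-> : y a = y x * dS x - derive1 y x * S x by [].
  have -> : derive1 y a = - (y x * dP x - derive1 y x * P x) by rewrite w1 opprK.
  by ring.
move=> x /andP[]; rewrite le_eqVlt => /predU1P[<- _|]; last exact: H.
have [cy _ _] := sy.
have /(continuous_within_itvP _ a0) [_ cP _] := prim_continuous (ltW a0) p1.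
have /(continuous_within_itvP _ a0) [_ cS _] := prim_continuous (ltW a0) p3.
apply: (@cvg_unique _ (@Rhausdorff R) (y x @[x --> 0^'+])) => //.
have : y a * P x + derive1 y a * S x @[x --> 0^'+] -->
    y a * P 0 + derive1 y a * S 0.
  by apply: cvgD; apply: cvgM => //; exact: cvg_cst.
apply: cvg_trans; apply: near_eq_cvg; near=> t; apply/esym/H.
  by near: t; exact: nbhs_right_gt.
by near: t; exact: nbhs_right_le.
Unshelve. all: by end_near. Qed.

End Uniqueness.

End HalfLine.

(** * Existence of the Jost solution by gluing at [a] *)

Section Existence.
Variable R : realType.
Notation mu := (@lebesgue_measure R).
Variables (q : R -> R) (a k : R) (P dP S dS : R -> R).
Hypotheses (a0 : 0 < a) (qa0 : forall x, a <= x -> q x = 0).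
Hypotheses (pP : prim 0 a P dP) (pdP : prim 0 a dP (fun x => (q x - k ^+ 2) * P x))
  (pS : prim 0 a S dS) (pdS : prim 0 a dS (fun x => (q x - k ^+ 2) * S x))
  (Pa : P a = 1) (dPa : dP a = 0) (Sa : S a = 0) (dSa : dS a = 1).
Variables (c d : R).

Let free x := c * cos (k * x) + d * sin (k * x).
Let dfree x := k * (d * cos (k * x) - c * sin (k * x)).

(** A free wave beyond [a], continued to the left by the fundamental solutions with matching data.
    The pairs (c, d) = (1, 0) and (0, 1) give the real and imaginary parts of the Jost solution. *)
Definition glued_sol x : R :=
  if x <= a then free a * P x + dfree a * S x else free x.
Let dglued x : R := if x <= a then free a * dP x + dfree a * dS x else dfree x.
Let ddglued x : R := (q x - k ^+ 2) * glued_sol x.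

Let free_prim s t : prim s t free dfree /\ prim s t dfree (fun x => - k ^+ 2 * free x).
Proof.
have pc : prim s t (fun x => cos (k * x)) (fun x => k * - sin (k * x)).
  apply: (@prim_comp_scale _ _ _ _ _ (fun x => - sin x)).
  by move=> z; apply: cvgN; exact: continuous_sin.
have ps := prim_comp_scale s t k (@is_derive_sin R) (@continuous_cos R).
split; first by apply: eq_prim (primD (primZ c pc) (primZ d ps)) => x _ //;
  rewrite /dfree; ring.
apply: eq_prim (primB (primZ (k * d) pc) (primZ (k * c) ps)) => x _ //.
  by rewrite /dfree; ring.
by rewrite /free; ring.
Qed.

Let glued_in x : 0 <= x <= a -> glued_sol x = free a * P x + dfree a * S x /\
  dglued x = free a * dP x + dfree a * dS x.
Proof. by move=> /andP[_ xa]; rewrite /glued_sol /dglued xa. Qed.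

Let glued_out t x : a <= x <= t -> glued_sol x = free x /\ dglued x = dfree x.
Proof.
move=> /andP[ax _]; rewrite /glued_sol /dglued; case: ifP => // xa.
have -> : x = a by apply: le_anti; rewrite ax xa.
by rewrite Pa dPa Sa dSa !mulr0 !mulr1 addr0 add0r.
Qed.

Let glued_prim t : a <= t -> prim 0 t glued_sol dglued /\ prim 0 t dglued ddglued.
Proof.
move=> at_; have [f1 f2] := free_prim a t.
have i1 : prim 0 a glued_sol dglued.
  by apply: eq_prim (primD (primZ (free a) pP) (primZ (dfree a) pS)) => x xa;
    have [e1 e2] := glued_in xa; rewrite ?e1 ?e2.
have i2 : prim 0 a dglued ddglued.
  apply: eq_prim (primD (primZ (free a) pdP) (primZ (dfree a) pdS)) => x xa;
    have [e1 e2] := glued_in xa; rewrite ?e2 // /ddglued e1; ring.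
have o1 : prim a t glued_sol dglued.
  by apply: eq_prim f1 => x xa; have [e1 e2] := glued_out xa.
have o2 : prim a t dglued ddglued.
  apply: eq_prim f2 => x xa; have [e1 e2] := glued_out xa; rewrite ?e2 //.
  by rewrite /ddglued e1 qa0 ?sub0r//; move/andP: xa => [].
split.
  exact: (prim_glue (integrable_itv_glue (ltW a0) at_ i1.1 o1.1) i1 o1).
exact: (prim_glue (integrable_itv_glue (ltW a0) at_ i2.1 o2.1) i2 o2).
Qed.

Let glued_derive (x : R) : 0 < x -> is_derive x 1 glued_sol (dglued x).
Proof.
move=> x0; pose t := Num.max a x + 1.
have at_ : a <= t by apply: (@le_trans _ _ (Num.max a x)); rewrite ?le_max ?lexx// lerDl.
have xt : x < t.
  by apply: (@le_lt_trans _ _ (Num.max a x)); rewrite ?le_max ?lexx ?orbT// ltrDl.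
have [p1 p2] := glued_prim at_; apply: (prim_is_derive_at x0 xt p1).
have t0 := lt_trans x0 xt.
have /(continuous_within_itvP _ t0) [c1 _ _] := prim_continuous (ltW t0) p2.
by apply: c1; rewrite in_itv/= x0.
Qed.

Lemma glued_schrodinger : schrodinger_sol q k glued_sol.
Proof.
have d1 x : 0 < x -> derive1 glued_sol x = dglued x.
  by move=> x0; rewrite derive1E; have h := glued_derive x0; exact: derive_val.
split.
- have [p1 _] := glued_prim (lexx a).
  by have /(continuous_within_itvP _ a0) [_ c1 _] := prim_continuous (ltW a0) p1.
- by move=> x x0; have h := glued_derive x0; exact: ex_derive.
- exists ddglued; split.
  + move=> t; have tm : t <= Num.max a t by rewrite le_max lexx orbT.
    have am : a <= Num.max a t by rewrite le_max lexx.
    have [_ [i2 _]] := glued_prim am.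
    exact: integrable_sub_itv (lexx 0) tm i2.
  + move=> s t s0 st; have tm : t <= Num.max a t by rewrite le_max lexx orbT.
    have am : a <= Num.max a t by rewrite le_max lexx.
    have [_ [_ i2]] := glued_prim am.
    by rewrite !d1 ?(lt_le_trans s0)//; apply: i2 => //; exact: ltW.
  + apply: nearW => x _; rewrite /ddglued; ring.
Qed.

Lemma glued_asymptotics :
  glued_sol x - (c * cos (k * x) + d * sin (k * x)) @[x --> +oo] --> (0 : R).
Proof.
apply: cvg_near_cst; near=> x.
have ax : a < x by near: x; apply: nbhs_pinfty_gt; exact: num_real.
by rewrite /glued_sol leNgt ax/= subrr.
Unshelve. all: by end_near. Qed.

End Existence.

Section JostData.
Local Open Scope complex_scope.
Variable R : realType.
Notation C := R[i].
Notation mu := (@lebesgue_measure R).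
Notation Re := (@complex.Re R).
Notation Im := (@complex.Im R).
Variables (q : R -> R) (a k : R).
Hypotheses (a0 : 0 < a) (k0 : k != 0)
  (iq : mu.-integrable `[0, a] (EFin \o q)) (qa0 : forall x, a <= x -> q x = 0).

Let K : C := (k ^+ 2)%:C.
Let P x := Re (phi q a K x).
Let dP x := Re (dphi q a K x).
Let S x := Re (psi q a K x).
Let dS x := Re (dpsi q a K x).

Let Re_mul_real (u : R) (w : C) : Re ((u%:C - K) * w) = (u - k ^+ 2) * Re w.
Proof. by rewrite /K -rmorphB/= ReM/= mul0r subr0. Qed.

Let prims : [/\ prim 0 a P dP, prim 0 a dP (fun x => (q x - k ^+ 2) * P x),
  prim 0 a S dS & prim 0 a dS (fun x => (q x - k ^+ 2) * S x)].
Proof.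
have [[p1 _] [p2 _]] := phi_prim a0 iq K; have [[p3 _] [p4 _]] := psi_prim a0 iq K.
split; [exact p1| |exact p3|].
  by apply: eq_prim p2 => x _; [|rewrite Re_mul_real].
by apply: eq_prim p4 => x _; [|rewrite Re_mul_real].
Qed.

Let ends : [/\ P a = 1, dP a = 0, S a = 0 & dS a = 1].
Proof.
rewrite /P /dP /S /dS.
by have [-> ->] := phi_end a0 iq K; have [-> ->] := psi_end a0 iq K.
Qed.

(** Ensures that [jost_solution] satisfies its specification and is not merely the default value of
    [xget]. *)
Lemma jost_solution_exists : exists f, is_jost_solution q k f.
Proof.
have [p1 p2 p3 p4] := prims; have [e1 e2 e3 e4] := ends.
exists (fun x => glued_sol a k P S 1 0 x +i* glued_sol a k P S 0 1 x).
split.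
- exact: (glued_schrodinger a0 qa0 p1 p2 p3 p4 e1 e2 e3 e4).
- exact: (glued_schrodinger a0 qa0 p1 p2 p3 p4 e1 e2 e3 e4).
- have := @glued_asymptotics _ a k P S 1 0.
  apply: cvg_trans; apply: near_eq_cvg; apply: nearW => x.
  by rewrite ReB/= mul1r mul0r addr0.
- have := @glued_asymptotics _ a k P S 0 1.
  apply: cvg_trans; apply: near_eq_cvg; apply: nearW => x.
  by rewrite ImB/= mul1r mul0r add0r.
Qed.

(** Applied to the real part of the Jost solution with (c, d) = (1, 0) and to the imaginary part
    with (0, 1). *)
Let data (y : R -> R) (c d : R) : schrodinger_sol q k y ->
  y x - (c * cos (k * x) + d * sin (k * x)) @[x --> +oo] --> (0 : R) ->
  let ya := c * cos (k * a) + d * sin (k * a) in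
  let da := k * (d * cos (k * a) - c * sin (k * a)) in
  y 0 = ya * P 0 + da * S 0 /\ right_derivative y 0 = ya * dP 0 + da * dS 0.
Proof.
move=> sy ylim ya da; have [p1 p2 p3 p4] := prims; have [e1 e2 e3 e4] := ends.
have q0 : {ae mu, forall x : R, a <= x -> q x = 0} by apply: nearW.
have [ya1 da1] := schrodinger_asymptotics a0 k0 q0 sy ylim.
have rep x : 0 <= x <= a -> y x = ya * P x + da * S x.
  move=> xa; rewrite /ya /da -ya1 -da1.
  exact: (schrodinger_representation a0 iq sy p1 p2 p3 p4 e1 e2 e3 e4).
split; first by rewrite rep// lexx ltW.
apply: (@prim_right_derivative _ _ a _ (fun x => ya * dP x + da * dS x) a0).
  by apply: eq_prim (primD (primZ ya p1) (primZ da p3)) => x xa //; rewrite rep.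
exact: prim_continuous (ltW a0) (primD (primZ ya p2) (primZ da p4)).
Qed.

Lemma jost_data :
  jost_function q k = expi (k * a) * jostF q a k%:C 0 /\
  jost_derivative0 q k = expi (k * a) * jostG q a k%:C 0.
Proof.
have [sr si lr li] : is_jost_solution q k (jost_solution q k).
  by apply: xgetPex; exact: jost_solution_exists.
have lr' : Re (jost_solution q k x) - (1 * cos (k * x) + 0 * sin (k * x))
    @[x --> +oo] --> (0 : R).
  move: lr; apply: cvg_trans; apply: near_eq_cvg; apply: nearW => x.
  by rewrite ReB/= mul1r mul0r addr0.
have li' : Im (jost_solution q k x) - (0 * cos (k * x) + 1 * sin (k * x))
    @[x --> +oo] --> (0 : R).
  move: li; apply: cvg_trans; apply: near_eq_cvg; apply: nearW => x.
  by rewrite ImB/= mul1r mul0r add0r.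
have [r1 r2] := data sr lr'; have [i1 i2] := data si li'.
have [[h1 h2] [h3 h4]] := fundamental_real q a (k ^+ 2) 0.
have K2 : k%:C ^+ 2 = K by rewrite /K rmorphXn.
split.
  rewrite /jost_function /jostF K2; apply: complex_ext.
    by rewrite r1 !(ReM, ImM, ReD, ImD)/= h1 h3 /P /S; ring.
  by rewrite i1 !(ReM, ImM, ReD, ImD)/= h1 h3 /P /S; ring.
rewrite /jost_derivative0 /jostG K2; apply: complex_ext => /=.
  by rewrite r2 !(ReM, ImM, ReD, ImD)/= h2 h4 /dP /dS; ring.
by rewrite i2 !(ReM, ImM, ReD, ImD)/= h2 h4 /dP /dS; ring.
Qed.

End JostData.

(** * The four data *)

Section CompactSupport.
Local Open Scope complex_scope.
Variable R : realType.
Notation C := R[i].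
Notation mu := (@lebesgue_measure R).
Notation Re := (@complex.Re R).
Notation Im := (@complex.Im R).

Lemma L11_integrable (q : R -> R) (a : R) : L11 q ->
  mu.-integrable `[0, a] (EFin \o q).
Proof.
move=> [mq iq _].
have i0 : mu.-integrable `[0, +oo[ (EFin \o q).
  apply/integrableP; split; first exact/measurable_EFinP.
  apply: le_lt_trans iq; apply: ge0_le_integral => //=.
  - by apply/measurable_EFinP; exact: measurableT_comp.
  - apply/measurable_EFinP; apply: measurable_funM.
      by apply: measurable_funD => //; exact: measurable_cst.
    exact: measurableT_comp.
  - move=> x; rewrite in_itv/= andbT => x0; rewrite lee_fin.
    by rewrite ler_peMl// lerDl.
apply: integrableS i0 => // x /=; rewrite !in_itv/= andbT.
by move=> /andP[].
Qed.

(* Vanishing everywhere, and not only almost everywhere, on [a, +oo[ makes the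
   equation of the glued Jost solution hold at every point. *)
Definition qcut (q : R -> R) (a : R) : R -> R := q \_ `]-oo, a[.

Lemma qcutE q a x : qcut q a x = if x < a then q x else 0.
Proof.
rewrite /qcut patchE; case: ifPn => [|]; first by rewrite inE/= in_itv/= => ->.
by rewrite notin_setE/= in_itv/= => /negP/negbTE ->.
Qed.

Lemma qcut_integrable q a : L11 q -> mu.-integrable `[0, a] (EFin \o qcut q a).
Proof.
move=> /(@L11_integrable q a) iq; rewrite /qcut -restrict_EFin.
apply/integrable_restrict => //; apply: integrableS iq => //.
exact: measurableI.
Qed.

Lemma schrodinger_sol_ae q q' k y :
  {ae mu, forall x : R, 0 < x -> q x = q' x} ->
  schrodinger_sol q k y -> schrodinger_sol q' k y.
Proof.
move=> qq [h1 h2 [y2 [h3 h4 h5]]]; split => //; exists y2; split => //.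
move: qq h5; apply: filterS2; first exact: (ae_filter_ringOfSetsType mu).
by move=> x e h x0; rewrite -e// h.
Qed.

(** Both potentials have the same set of Jost solutions, so [xget] selects the same function,
    including its values at x < 0. *)
Lemma jost_solution_ae q q' k :
  {ae mu, forall x : R, 0 < x -> q x = q' x} ->
  jost_solution q k = jost_solution q' k.
Proof.
move=> qq.
have qq' : {ae mu, forall x : R, 0 < x -> q' x = q x}.
  move: qq; apply: filterS; first exact: (ae_filter_ringOfSetsType mu).
  by move=> x h x0; rewrite h.
rewrite /jost_solution; congr xget; apply/seteqP; split => f [h1 h2 h3 h4] /=.
  by split => //; exact: schrodinger_sol_ae qq _.
by split => //; exact: schrodinger_sol_ae qq' _.
Qed.

Section OnePotential.
Variables (q : R -> R) (a k : R).
Hypotheses (a0 : 0 < a) (Lq : L11 q)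
  (q0 : {ae mu, forall x : R, a <= x -> q x = 0}) (k0 : k != 0).

Let r := qcut q a.
Let ir := qcut_integrable a Lq.
Let K : C := (k ^+ 2)%:C.

Let r0 x : a <= x -> r x = 0.
Proof. by move=> ax; rewrite /r qcutE ltNge ax. Qed.

Let qr : {ae mu, forall x : R, 0 < x -> q x = r x}.
Proof.
move: q0; apply: filterS; first exact: (ae_filter_ringOfSetsType mu).
by move=> x h _; rewrite /r qcutE; case: ltP => // /h.
Qed.

Lemma fundamental_ReE : [/\ phi r a K 0 = (Re (phi r a K 0))%:C,
  psi r a K 0 = (Re (psi r a K 0))%:C, dphi r a K 0 = (Re (dphi r a K 0))%:C &
  dpsi r a K 0 = (Re (dpsi r a K 0))%:C].
Proof.
have [[h1 h2] [h3 h4]] := fundamental_real r a (k ^+ 2) 0.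
by split; apply: complex_ext.
Qed.

Let K2 : k%:C ^+ 2 = K. Proof. by rewrite /K rmorphXn. Qed.

Lemma jost_functionE : jost_function q k =
  expi (k * a) * (Re (phi r a K 0) +i* (k * Re (psi r a K 0))).
Proof.
have [h _] := jost_data a0 k0 ir r0.
rewrite /jost_function (jost_solution_ae k qr) -/(jost_function r k) h.
congr (_ * _); have [e1 e2 _ _] := fundamental_ReE.
rewrite /jostF K2 e1 e2; apply: complex_ext; rewrite !(ReD, ImD, ReM, ImM)/=; ring.
Qed.

Lemma jost_derivative0E : jost_derivative0 q k =
  expi (k * a) * (Re (dphi r a K 0) +i* (k * Re (dpsi r a K 0))).
Proof.
have [_ h] := jost_data a0 k0 ir r0.
rewrite /jost_derivative0 (jost_solution_ae k qr) -/(jost_derivative0 r k) h.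
congr (_ * _); have [_ _ e1 e2] := fundamental_ReE.
rewrite /jostG K2 e1 e2; apply: complex_ext; rewrite !(ReD, ImD, ReM, ImM)/=; ring.
Qed.

(** If phi and psi both vanished at 0, their Wronskian with the derivatives would be 0 and not 1. *)
Lemma jost_function_factor_neq0 :
  Re (phi r a K 0) +i* (k * Re (psi r a K 0)) != 0.
Proof.
apply/eqP => -[h1 /eqP]; rewrite mulf_eq0 (negbTE k0)/= => /eqP h2.
have a00 : 0 <= (0 : R) <= a by rewrite lexx ltW.
have := fundamental_det a0 ir K a00; have [-> -> _ _] := fundamental_ReE.
by rewrite h1 h2 mul0r mulr0 subrr => /eqP; rewrite eq_sym oner_eq0.
Qed.

End OnePotential.

Lemma expi_neq0 (t : R) : expi t != 0.
Proof.
apply/eqP => h; have := cnorm_expi t; rewrite h cnorm0 => /eqP.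
by rewrite eq_sym oner_eq0.
Qed.

(** After cross-multiplication the two sides are complex conjugates, so the imaginary part k (p1 s2
    - s1 p2) vanishes. The exponential factors cancel because both potentials share the same [a]. *)
Lemma quotient_real_parts (k p1 s1 p2 s2 : R) (e e' : C) : k != 0 ->
  e != 0 -> e' != 0 -> p1 +i* (k * s1) != 0 -> p2 +i* (k * s2) != 0 ->
  (e' * (p1 +i* (- k * s1))) / (e * (p1 +i* (k * s1))) =
  (e' * (p2 +i* (- k * s2))) / (e * (p2 +i* (k * s2))) ->
  p1 * s2 = s1 * p2.
Proof.
move=> k0 e0 e'0 n1 n2 /eqP; rewrite eqr_div ?mulf_neq0// => /eqP.
rewrite !(mulrCA _ e) -!mulrA => /(mulfI e0)/(mulfI e'0) [_ H].
by apply: (mulfI k0); lra.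
Qed.

Lemma scaled_real_parts (k p1 s1 p2 s2 : R) (e : C) : k != 0 -> e != 0 ->
  e * (p1 +i* (k * s1)) = e * (p2 +i* (k * s2)) -> p1 = p2 /\ s1 = s2.
Proof. by move=> k0 e0 /(mulfI e0) [-> /(mulfI k0)]. Qed.

Lemma eq_real_complex (z1 z2 : C) (x1 x2 : R) :
  z1 = x1%:C -> z2 = x2%:C -> x1 = x2 -> z1 = z2.
Proof. by move=> -> -> ->. Qed.

(** Two nonzero complex numbers with the same phase are real multiples of each other, hence have
    proportional real and imaginary parts. Here [r1] and [r2] stand for the moduli. *)
Lemma phase_real_parts (k p1 s1 p2 s2 r1 r2 : R) (e u : C) : k != 0 ->
  e != 0 -> r1 != 0 -> r2 != 0 ->
  e * (p1 +i* (k * s1)) = r1%:C * u -> e * (p2 +i* (k * s2)) = r2%:C * u ->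
  p1 * s2 = s1 * p2.
Proof.
move=> k0 e0 r10 r20 h1 h2.
have : r2%:C * (p1 +i* (k * s1)) = r1%:C * (p2 +i* (k * s2)).
  by apply: (mulfI e0); rewrite mulrCA h1 [RHS]mulrCA h2; ring.
move=> H; have /= := congr1 Re H; have /= := congr1 Im H.
rewrite !mul0r !subr0 !addr0 => E2 E1.
have {}E2 : r2 * s1 = r1 * s2.
  by apply: (mulfI k0); rewrite mulrCA E2; ring.
apply: (mulfI (mulf_neq0 r20 r10)).
transitivity ((r2 * p1) * (r1 * s2)); first ring.
by rewrite E1 -E2; ring.
Qed.

Opaque jost_function jost_derivative0.

Section TwoPotentials.
Variables (q1 q2 : R -> R) (a : R).
Hypotheses (a0 : 0 < a) (L1 : L11 q1) (L2 : L11 q2)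
  (z1 : {ae mu, forall x : R, a <= x -> q1 x = 0})
  (z2 : {ae mu, forall x : R, a <= x -> q2 x = 0}).

Let r1 := qcut q1 a.
Let r2 := qcut q2 a.
Let i1 := qcut_integrable a L1.
Let i2 := qcut_integrable a L2.
Let E1 k (k0 : k != 0) := jost_functionE a0 L1 z1 k0.
Let E2 k (k0 : k != 0) := jost_functionE a0 L2 z2 k0.
Let N1 k (k0 : k != 0) := jost_function_factor_neq0 a0 L1 k0.
Let N2 k (k0 : k != 0) := jost_function_factor_neq0 a0 L2 k0.

Lemma ae_eq_of_qcut : {ae mu, forall x : R, 0 <= x <= a -> r1 x = r2 x} ->
  {ae mu, forall x : R, 0 <= x -> q1 x = q2 x}.
Proof.
have z12 : {ae mu, forall x : R, a <= x -> q1 x = q2 x}.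
  move: z1 z2; apply: filterS2; first exact: (ae_filter_ringOfSetsType mu).
  by move=> x h1 h2 ax; rewrite h1 ?h2.
move: z12; apply: filterS2; first exact: (ae_filter_ringOfSetsType mu).
move=> x h12 h x0; have [xa|ax] := ltP x a; last exact: h12.
by move: h; rewrite /r1 /r2 !qcutE xa x0 ltW// => /(_ isT).
Qed.

(** Common core of the S-matrix and the phase shift: each determines f(k) up to a nonzero real
    factor, that is, the ratio of phi to psi at 0. *)
Lemma real_quotient_determines :
  (forall k : R, 0 < k ->
    Re (phi r1 a (k ^+ 2)%:C 0) * Re (psi r2 a (k ^+ 2)%:C 0) =
    Re (psi r1 a (k ^+ 2)%:C 0) * Re (phi r2 a (k ^+ 2)%:C 0)) ->
  {ae mu, forall x : R, 0 <= x -> q1 x = q2 x}.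
Proof.
move=> H; apply: ae_eq_of_qcut; apply: (inverse_jost_quotient a0 i1 i2) => k k0.
have [-> -> _ _] := fundamental_ReE q1 a k.
have [-> -> _ _] := fundamental_ReE q2 a k.
by rewrite -!rmorphM/= H.
Qed.

Lemma S_matrix_determines :
  (forall k : R, 0 < k -> S_matrix q1 k = S_matrix q2 k) ->
  {ae mu, forall x : R, 0 <= x -> q1 x = q2 x}.
Proof.
move=> H; apply: real_quotient_determines => k kp.
have k0 : k != 0 by rewrite gt_eqF.
have nk0 : - k != 0 by rewrite oppr_eq0.
have := H k kp; rewrite /S_matrix (E1 k0) (E1 nk0) (E2 k0) (E2 nk0) sqrrN.
exact: (quotient_real_parts k0 (expi_neq0 _) (expi_neq0 _) (N1 k0) (N2 k0)).
Qed.

Lemma phase_shift_determines (delta1 delta2 : R -> R) :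
  is_phase_shift q1 delta1 -> is_phase_shift q2 delta2 ->
  (forall k : R, 0 < k -> delta1 k = delta2 k) ->
  {ae mu, forall x : R, 0 <= x -> q1 x = q2 x}.
Proof.
move=> [_ h1 _] [_ h2 _] d12; apply: real_quotient_determines => k kp.
have k0 : k != 0 by rewrite gt_eqF.
have e1 := h1 k kp; have e2 := h2 k kp; rewrite (d12 k kp) in e1.
have n1 : cnorm (jost_function q1 k) != 0.
  by rewrite gt_eqF// cnorm_gt0// (E1 k0) mulf_neq0 ?expi_neq0 ?(N1 k0).
have n2 : cnorm (jost_function q2 k) != 0.
  by rewrite gt_eqF// cnorm_gt0// (E2 k0) mulf_neq0 ?expi_neq0 ?(N2 k0).
rewrite -cnormE in e1; rewrite -cnormE in e2.
apply: (phase_real_parts k0 (expi_neq0 (k * a)) n1 n2 (u := expi (- delta2 k))).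
  by rewrite -(E1 k0).
by rewrite -(E2 k0).
Qed.

Lemma jost_function_determines :
  (forall k : R, 0 < k -> jost_function q1 k = jost_function q2 k) ->
  {ae mu, forall x : R, 0 <= x -> q1 x = q2 x}.
Proof.
move=> H; apply: ae_eq_of_qcut.
have key k : 0 < k ->
    Re (phi r1 a (k ^+ 2)%:C 0) = Re (phi r2 a (k ^+ 2)%:C 0) /\
    Re (psi r1 a (k ^+ 2)%:C 0) = Re (psi r2 a (k ^+ 2)%:C 0).
  move=> kp; have k0 : k != 0 by rewrite gt_eqF.
  have := H k kp; rewrite (E1 k0) (E2 k0).
  exact: (scaled_real_parts k0 (expi_neq0 _)).
apply: (inverse_jost_value a0 i1 i2) => k kp; have [h1 h2] := key k kp;
  have [e1 e3 _ _] := fundamental_ReE q1 a k;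
  have [e2 e4 _ _] := fundamental_ReE q2 a k.
  exact (eq_real_complex e1 e2 h1).
exact (eq_real_complex e3 e4 h2).
Qed.

Lemma jost_derivative0_determines :
  (forall k : R, 0 < k -> jost_derivative0 q1 k = jost_derivative0 q2 k) ->
  {ae mu, forall x : R, 0 <= x -> q1 x = q2 x}.
Proof.
move=> H; apply: ae_eq_of_qcut.
have key k : 0 < k ->
    Re (dphi r1 a (k ^+ 2)%:C 0) = Re (dphi r2 a (k ^+ 2)%:C 0) /\
    Re (dpsi r1 a (k ^+ 2)%:C 0) = Re (dpsi r2 a (k ^+ 2)%:C 0).
  move=> kp; have k0 : k != 0 by rewrite gt_eqF.
  have := H k kp.
  rewrite (jost_derivative0E a0 L1 z1 k0) (jost_derivative0E a0 L2 z2 k0).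
  exact: (scaled_real_parts k0 (expi_neq0 _)).
apply: (inverse_jost_derivative a0 i1 i2) => k kp; have [h1 h2] := key k kp;
  have [_ _ e1 e3] := fundamental_ReE q1 a k;
  have [_ _ e2 e4] := fundamental_ReE q2 a k.
  exact (eq_real_complex e1 e2 h1).
exact (eq_real_complex e3 e4 h2).
Qed.

End TwoPotentials.

End CompactSupport.

Theorem theorem7p2p1 (R : realType) (a : R) (q1 q2 : R -> R) :
  0 < a -> L11 q1 -> L11 q2 ->
  {ae @lebesgue_measure R, forall x : R, a <= x -> q1 x = 0} ->
  {ae @lebesgue_measure R, forall x : R, a <= x -> q2 x = 0} ->
  let coincide :=
    {ae @lebesgue_measure R, forall x : R, 0 <= x -> q1 x = q2 x} in
  [/\ (forall k : R, 0 < k -> S_matrix q1 k = S_matrix q2 k) -> coincide,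
      (forall delta1 delta2 : R -> R,
         is_phase_shift q1 delta1 -> is_phase_shift q2 delta2 ->
         (forall k : R, 0 < k -> delta1 k = delta2 k) -> coincide),
      (forall k : R, 0 < k -> jost_function q1 k = jost_function q2 k) ->
        coincide &
      (forall k : R, 0 < k -> jost_derivative0 q1 k = jost_derivative0 q2 k) ->
        coincide].
Proof.
move=> a0 L1 L2 z1 z2 coincide; split.
- exact: (S_matrix_determines a0 L1 L2 z1 z2).
- exact: (phase_shift_determines a0 L1 L2 z1 z2).
- exact: (jost_function_determines a0 L1 L2 z1 z2).
- exact: (jost_derivative0_determines a0 L1 L2 z1 z2).
Qed.
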